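(* Let $d\geq 2$. The set of nilpotent elements of the Green ring $r(H_{n,d})$ is equal to the additive subgroup $$\langle\, [M(d,i)]-[M(d,j)] \;|\; i\equiv j \ (\mathrm{mod}\ m)\,\rangle ;$$ that is, the Jacobson radical $J(r(H_{n,d}))$ of $r(H_{n,d})$ has the $\mathbb{Z}$-basis $$\{\,[M(d,im+j)]-[M(d,(i-1)m+j)] \;|\; 1\leq i\leq d-1,\ 0\leq j\leq m-1\,\}.$$
   Context: Let $K$ be an algebraically closed field of characteristic $0$, let $n,d\geq 2$ be integers with $d\mid n$, put $m=n/d$, and let $q\in K$ be a primitive $d$-th root of unity. The generalized Taft algebra $H_{n,d}=H_{n,d}(q)$ is the $K$-algebra generated by $g,h$ subject to $g^n=1$, $h^d=0$, $hg=qgh$; it is a Hopf algebra of dimension $nd$ with $\Delta(g)=g\otimes g$, $\Delta(h)=1\otimes h+h\otimes g$, $\varepsilon(g)=1$, $\varepsilon(h)=0$, $S(g)=g^{-1}$, $S(h)=-q^{-1}g^{n-1}h$. Modules are finite dimensional left modules; tensor products of modules are over $K$ with action through $\Delta$. Fix a primitive $n$-th root of unity $\omega\in K$ with $\omega^m=q$. For $1\leq l\leq d$ and $i\in\mathbb{Z}_n=\mathbb{Z}/(n)$, $M(l,i)$ is the $H_{n,d}$-module with basis $v_0,\dots,v_{l-1}$ and action $g\cdot v_j=\omega^i q^{-j}v_j$, $h\cdot v_j=v_{j+1}$ for $0\le j\leq l-2$, $h\cdot v_{l-1}=0$. The modules $M(l,i)$ form a complete list of pairwise non-isomorphic indecomposable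 $H_{n,d}$-modules. The Green ring $r(H)$ of a Hopf algebra $H$ is the abelian group generated by isomorphism classes $[V]$ of finite dimensional $H$-modules modulo $[V\oplus W]=[V]+[W]$, with multiplication $[V][W]=[V\otimes W]$. *)

(* Defs.v *)
From HB Require Import structures.
From mathcomp Require Import all_boot all_order all_algebra.
From mathcomp Require Import boolp classical_sets.
From mathcomp Require Import generic_quotient mxtens.

Set Implicit Arguments.
Unset Strict Implicit.
Unset Printing Implicit Defensive.

Import GRing.Theory.
Local Open Scope ring_scope.
Local Open Scope quotient_scope.

(* A K-algebra is a ring with a ring morphism from K to its center. The
   library's algType excludes the zero ring, hence the algebra 'M[K]_0 acting
   on the zero module. *)
HB.mixin Record isPzAlgebra (K : fieldType) A of GRing.PzRing A := {
  algin : K -> A;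
  algin_zmod_subproof : zmod_morphism algin;
  algin_monoid_subproof : monoid_morphism algin;
  algin_central : forall k (x : A), algin k * x = x * algin k
}.

#[short(type="pzAlgType")]
HB.structure Definition PzAlgebra (K : fieldType) :=
  { A of isPzAlgebra K A & GRing.PzRing A }.

HB.instance Definition _ (K : fieldType) (A : pzAlgType K) :=
  GRing.isZmodMorphism.Build K A (@algin K A) (@algin_zmod_subproof K A).
HB.instance Definition _ (K : fieldType) (A : pzAlgType K) :=
  GRing.isMonoidMorphism.Build K A (@algin K A) (@algin_monoid_subproof K A).

Section MatrixAlgebra.
Variables (K : fieldType) (r : nat).
Local Lemma scalar_zmod : zmod_morphism (fun k : K => k%:M : 'M_r).
Proof. by move=> a b; rewrite raddfB. Qed.
Local Lemma scalar_monoid : monoid_morphism (fun k : K => k%:M : 'M_r).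
Proof. by split => // a b; rewrite scalar_mxM. Qed.
Local Lemma scalar_central k (A : 'M[K]_r) : k%:M * A = A * k%:M.
Proof. exact/esym/scalar_mxC. Qed.
HB.instance Definition _ :=
  isPzAlgebra.Build K 'M[K]_r scalar_zmod scalar_monoid scalar_central.
End MatrixAlgebra.

Section BaseAlgebra.
Variable K : fieldType.
Local Lemma base_zmod : zmod_morphism (fun k : K => k).
Proof. by []. Qed.
Local Lemma base_monoid : monoid_morphism (fun k : K => k).
Proof. by []. Qed.
HB.instance Definition _ :=
  isPzAlgebra.Build K K^o base_zmod base_monoid (@mulrC K).
End BaseAlgebra.

Record alghom (K : fieldType) (A B : pzAlgType K) := AlgHom {
  alghom_fun :> {rmorphism A -> B};
  alghomC : forall k, alghom_fun (algin k) = algin k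
}.

Section AlghomBasics.
Variables (K : fieldType) (A B C : pzAlgType K).

Definition idalg : alghom A A := @AlgHom K A A idfun (fun=> erefl).

Lemma compalgC (g : alghom B C) (f : alghom A B) k :
  (g \o f) (algin k) = algin k.
Proof. by rewrite /= !alghomC. Qed.

Definition compalg (g : alghom B C) (f : alghom A B) : alghom A C :=
  @AlgHom K A C (g \o f) (compalgC g f).
End AlghomBasics.

Definition unitalg (K : fieldType) (A : pzAlgType K) : alghom K^o A :=
  @AlgHom K K^o A (@algin K A : {rmorphism K -> A}) (fun=> erefl).

(* Noncommutative polynomial expressions with coefficients in K. *)
Inductive ncpoly (K X : Type) :=
  | NCgen of X
  | NCconst of K
  | NCadd of ncpoly K X & ncpoly K X
  | NCmul of ncpoly K X & ncpoly K X.
Arguments NCgen {K X}.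
Arguments NCconst {K X}.

Fixpoint NCexp (K : fieldType) X (t : ncpoly K X) k :=
  if k is k'.+1 then NCmul t (NCexp t k') else NCconst 1.

HB.instance Definition _ K X := gen_eqMixin (ncpoly K X).
HB.instance Definition _ K X := gen_choiceMixin (ncpoly K X).

Section Presentation.
Variables (K : fieldType) (X : Type).
Variable R : ncpoly K X -> ncpoly K X -> Prop.
Implicit Types s t u : ncpoly K X.

(* The congruence generated by R and the axioms of K-algebras. *)
Inductive prescong : ncpoly K X -> ncpoly K X -> Prop :=
  | PCrel s t : R s t -> prescong s t
  | PCrefl t : prescong t t
  | PCsym s t : prescong s t -> prescong t s
  | PCtrans s t u : prescong s t -> prescong t u -> prescong s u
  | PCadd s s' t t' : prescong s s' -> prescong t t' ->
      prescong (NCadd s t) (NCadd s' t')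
  | PCmul s s' t t' : prescong s s' -> prescong t t' ->
      prescong (NCmul s t) (NCmul s' t')
  | PCaddA s t u : prescong (NCadd s (NCadd t u)) (NCadd (NCadd s t) u)
  | PCaddC s t : prescong (NCadd s t) (NCadd t s)
  | PCadd0 t : prescong (NCadd (NCconst 0) t) t
  | PCaddN t : prescong (NCadd (NCmul (NCconst (-1)) t) t) (NCconst 0)
  | PCmulA s t u : prescong (NCmul s (NCmul t u)) (NCmul (NCmul s t) u)
  | PCmul1 t : prescong (NCmul (NCconst 1) t) t
  | PCmulDl s t u :
      prescong (NCmul (NCadd s t) u) (NCadd (NCmul s u) (NCmul t u))
  | PCmulDr s t u :
      prescong (NCmul s (NCadd t u)) (NCadd (NCmul s t) (NCmul s u))
  | PCconstD a b : prescong (NCconst (a + b)) (NCadd (NCconst a) (NCconst b))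
  | PCconstM a b : prescong (NCconst (a * b)) (NCmul (NCconst a) (NCconst b))
  | PCconstC a t : prescong (NCmul (NCconst a) t) (NCmul t (NCconst a)).

Definition prescongb : rel (ncpoly K X) := fun s t => `[< prescong s t >].

Lemma prescongb_refl : reflexive prescongb.
Proof. by move=> t; apply/asboolP; exact: PCrefl. Qed.
Lemma prescongb_sym : symmetric prescongb.
Proof. by move=> s t; apply/asboolP/asboolP; exact: PCsym. Qed.
Lemma prescongb_trans : transitive prescongb.
Proof.
by move=> t s u /asboolP st /asboolP tu; apply/asboolP; exact: PCtrans st tu.
Qed.
Canonical prescong_equiv :=
  EquivRel prescongb prescongb_refl prescongb_sym prescongb_trans.

Definition presalg := {eq_quot prescong_equiv}.
HB.instance Definition _ := Choice.on presalg.

Definition pres_class t : presalg := \pi_{eq_quot prescong_equiv} t.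

Lemma pres_classP s t : prescong s t <-> pres_class s = pres_class t.
Proof.
split=> [st|/eqmodP/asboolP //].
by apply/eqmodP/asboolP.
Qed.

Lemma pres_classK (x : presalg) : pres_class (repr x) = x.
Proof. exact: reprK. Qed.

Lemma prescong_repr t : prescong (repr (pres_class t)) t.
Proof. by apply/pres_classP; rewrite pres_classK. Qed.

Definition pres_add (x y : presalg) := pres_class (NCadd (repr x) (repr y)).
Definition pres_mul (x y : presalg) := pres_class (NCmul (repr x) (repr y)).
Definition pres_opp (x : presalg) :=
  pres_class (NCmul (NCconst (-1)) (repr x)).

Lemma pres_addE s t :
  pres_add (pres_class s) (pres_class t) = pres_class (NCadd s t).
Proof. by apply/pres_classP; apply: PCadd; exact: prescong_repr. Qed.
Lemma pres_mulE s t :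
  pres_mul (pres_class s) (pres_class t) = pres_class (NCmul s t).
Proof. by apply/pres_classP; apply: PCmul; exact: prescong_repr. Qed.
Lemma pres_oppE t :
  pres_opp (pres_class t) = pres_class (NCmul (NCconst (-1)) t).
Proof.
by apply/pres_classP; apply: PCmul; [exact: PCrefl|exact: prescong_repr].
Qed.

Lemma pres_addA : associative pres_add.
Proof.
move=> x y z; rewrite -[x]pres_classK -[y]pres_classK -[z]pres_classK.
by rewrite !pres_addE; apply/pres_classP; exact: PCaddA.
Qed.
Lemma pres_addC : commutative pres_add.
Proof. by move=> x y; apply/pres_classP; exact: PCaddC. Qed.
Lemma pres_add0 : left_id (pres_class (NCconst 0)) pres_add.
Proof.
move=> x; rewrite -[x]pres_classK !pres_addE.
by apply/pres_classP; exact: PCadd0.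
Qed.
Lemma pres_addN : left_inverse (pres_class (NCconst 0)) pres_opp pres_add.
Proof.
move=> x; rewrite -[x]pres_classK pres_oppE pres_addE.
by apply/pres_classP; exact: PCaddN.
Qed.
HB.instance Definition _ :=
  GRing.isZmodule.Build presalg pres_addA pres_addC pres_add0 pres_addN.

Lemma pres_mulA : associative pres_mul.
Proof.
move=> x y z; rewrite -[x]pres_classK -[y]pres_classK -[z]pres_classK.
by rewrite !pres_mulE; apply/pres_classP; exact: PCmulA.
Qed.
Lemma pres_mul1 : left_id (pres_class (NCconst 1)) pres_mul.
Proof.
move=> x; rewrite -[x]pres_classK !pres_mulE.
by apply/pres_classP; exact: PCmul1.
Qed.
Lemma pres_constC k x :
  pres_mul (pres_class (NCconst k)) x = pres_mul x (pres_class (NCconst k)).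
Proof.
rewrite -[x]pres_classK !pres_mulE.
by apply/pres_classP; exact: PCconstC.
Qed.
Lemma pres_mul1r : right_id (pres_class (NCconst 1)) pres_mul.
Proof. by move=> x; rewrite -pres_constC pres_mul1. Qed.
Lemma pres_mulDl : left_distributive pres_mul pres_add.
Proof.
move=> x y z; rewrite -[x]pres_classK -[y]pres_classK -[z]pres_classK.
rewrite !(pres_mulE, pres_addE).
by apply/pres_classP; exact: PCmulDl.
Qed.
Lemma pres_mulDr : right_distributive pres_mul pres_add.
Proof.
move=> x y z; rewrite -[x]pres_classK -[y]pres_classK -[z]pres_classK.
rewrite !(pres_mulE, pres_addE).
by apply/pres_classP; exact: PCmulDr.
Qed.
HB.instance Definition _ := GRing.Zmodule_isPzRing.Build presalg
  pres_mulA pres_mul1 pres_mul1r pres_mulDl pres_mulDr.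

Definition pres_const (k : K) : presalg := pres_class (NCconst k).

Lemma pres_const_zmod : zmod_morphism pres_const.
Proof.
suff addc : {morph pres_const : a b / a + b}.
  by move=> a b; apply/eqP; rewrite eq_sym subr_eq -addc subrK.
move=> a b; rewrite [RHS]pres_addE.
by apply/pres_classP; exact: PCconstD.
Qed.
Lemma pres_const_monoid : monoid_morphism pres_const.
Proof.
split=> // a b; rewrite [RHS]pres_mulE.
by apply/pres_classP; exact: PCconstM.
Qed.
HB.instance Definition _ := isPzAlgebra.Build K presalg
  pres_const_zmod pres_const_monoid pres_constC.

Definition pres_gen (x : X) : presalg := pres_class (NCgen x).

Lemma pres_classD s t :
  pres_class (NCadd s t) = pres_class s + pres_class t.
Proof. by rewrite -pres_addE. Qed.
Lemma pres_classM s t :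
  pres_class (NCmul s t) = pres_class s * pres_class t.
Proof. by rewrite -pres_mulE. Qed.
Lemma pres_classC k : pres_class (NCconst k) = algin k.
Proof. by []. Qed.
Lemma pres_classX t k : pres_class (NCexp t k) = pres_class t ^+ k.
Proof.
by elim: k => [|k IHk] //=; rewrite pres_classM IHk exprS.
Qed.
Lemma pres_rel s t : R s t -> pres_class s = pres_class t.
Proof. by move=> Rst; apply/pres_classP; exact: PCrel. Qed.

Section Lift.
Variables (A : pzAlgType K) (f : X -> A).

Fixpoint nceval t : A :=
  match t with
  | NCgen x => f x
  | NCconst k => algin k
  | NCadd s t => nceval s + nceval t
  | NCmul s t => nceval s * nceval t
  end.

Lemma nceval_exp t k : nceval (NCexp t k) = nceval t ^+ k.
Proof. by elim: k => [|k IHk] /=; rewrite ?rmorph1 // IHk exprS. Qed.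

Hypothesis fR : forall s t, R s t -> nceval s = nceval t.

Lemma nceval_cong s t : prescong s t -> nceval s = nceval t.
Proof.
elim=> //= {s t}.
- by move=> s t u _ -> _ ->.
- by move=> s s' t t' _ -> _ ->.
- by move=> s s' t t' _ -> _ ->.
- by move=> s t u; rewrite addrA.
- by move=> s t; rewrite addrC.
- by move=> t; rewrite rmorph0 add0r.
- by move=> t; rewrite rmorphN1 mulN1r addNr rmorph0.
- by move=> s t u; rewrite mulrA.
- by move=> t; rewrite rmorph1 mul1r.
- by move=> s t u; rewrite mulrDl.
- by move=> s t u; rewrite mulrDr.
- by move=> a b; rewrite rmorphD.
- by move=> a b; rewrite rmorphM.
- by move=> a t; rewrite algin_central.
Qed.

Definition pres_lift_fun (x : presalg) : A := nceval (repr x).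

Lemma pres_lift_funE t : pres_lift_fun (pres_class t) = nceval t.
Proof. exact/nceval_cong/prescong_repr. Qed.

Lemma pres_lift_zmod : zmod_morphism pres_lift_fun.
Proof.
suff addl : {morph pres_lift_fun : x y / x + y}.
  by move=> x y; apply/eqP; rewrite eq_sym subr_eq -addl subrK.
move=> x y; rewrite -[x]pres_classK -[y]pres_classK -pres_classD.
by rewrite !pres_lift_funE.
Qed.
Lemma pres_lift_monoid : monoid_morphism pres_lift_fun.
Proof.
split=> [|x y]; first by rewrite pres_lift_funE /= rmorph1.
rewrite -[x]pres_classK -[y]pres_classK -pres_classM.
by rewrite !pres_lift_funE.
Qed.
HB.instance Definition _ :=
  GRing.isZmodMorphism.Build presalg A pres_lift_fun pres_lift_zmod.
HB.instance Definition _ :=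
  GRing.isMonoidMorphism.Build presalg A pres_lift_fun pres_lift_monoid.

Lemma pres_liftC k : pres_lift_fun (algin k) = algin k.
Proof. exact: pres_lift_funE. Qed.

Definition pres_lift : alghom presalg A :=
  @AlgHom K presalg A pres_lift_fun pres_liftC.

Lemma pres_liftE x : pres_lift (pres_gen x) = f x.
Proof. exact: pres_lift_funE. Qed.
End Lift.

Lemma pres_ind (P : presalg -> Prop) :
  (forall x, P (pres_gen x)) -> (forall k, P (algin k)) ->
  (forall x y, P x -> P y -> P (x + y)) ->
  (forall x y, P x -> P y -> P (x * y)) -> forall x, P x.
Proof.
move=> Pg Pc PD PM x; rewrite -[x]pres_classK.
elim: (repr x) => [y|k|s IHs t IHt|s IHs t IHt]; [exact: Pg|exact: Pc|..].
  by rewrite pres_classD; exact: PD.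
by rewrite pres_classM; exact: PM.
Qed.

Lemma pres_ext (A : pzAlgType K) (f g : alghom presalg A) :
  (forall x, f (pres_gen x) = g (pres_gen x)) -> f =1 g.
Proof.
move=> fg; apply: pres_ind => [//|k|x y fx fy|x y fx fy].
- by rewrite !alghomC.
- by rewrite !rmorphD fx fy.
- by rewrite !rmorphM fx fy.
Qed.

Lemma pres_intertw (r r' : nat) (F : alghom presalg 'M[K]_r)
    (G : alghom presalg 'M[K]_r') (P : 'M[K]_(r', r)) :
  (forall x, P *m F (pres_gen x) = G (pres_gen x) *m P) ->
  forall x, P *m F x = G x *m P.
Proof.
move=> FG; apply: pres_ind => [//|k|x y fx fy|x y fx fy].
- by rewrite !alghomC; exact: scalar_mxC.
- by rewrite !rmorphD mulmxDr mulmxDl fx fy.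
- by rewrite !rmorphM /= mulmxA fx -mulmxA fy mulmxA.
Qed.

End Presentation.

(* The tensor product of A and B is generated by commuting copies of A and B,
   with a (x) b = (a (x) 1) (1 (x) b). *)
Section Tensor.
Variables (K : fieldType) (A B : pzAlgType K).

Inductive tens_rel : ncpoly K (A + B) -> ncpoly K (A + B) -> Prop :=
  | TensDl a a' : tens_rel (NCgen (inl (a + a')))
                           (NCadd (NCgen (inl a)) (NCgen (inl a')))
  | TensMl a a' : tens_rel (NCgen (inl (a * a')))
                           (NCmul (NCgen (inl a)) (NCgen (inl a')))
  | TensCl k : tens_rel (NCgen (inl (algin k))) (NCconst k)
  | TensDr b b' : tens_rel (NCgen (inr (b + b')))
                           (NCadd (NCgen (inr b)) (NCgen (inr b')))
  | TensMr b b' : tens_rel (NCgen (inr (b * b')))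
                           (NCmul (NCgen (inr b)) (NCgen (inr b')))
  | TensCr k : tens_rel (NCgen (inr (algin k))) (NCconst k)
  | TensComm a b : tens_rel (NCmul (NCgen (inl a)) (NCgen (inr b)))
                            (NCmul (NCgen (inr b)) (NCgen (inl a))).

Definition tensalg : pzAlgType K := presalg tens_rel.

Definition tinl_fun (a : A) : tensalg := pres_gen tens_rel (inl a).
Definition tinr_fun (b : B) : tensalg := pres_gen tens_rel (inr b).

Lemma tinl_zmod : zmod_morphism tinl_fun.
Proof.
suff addl : {morph tinl_fun : x y / x + y}.
  by move=> x y; apply/eqP; rewrite eq_sym subr_eq -addl subrK.
by move=> x y; rewrite -pres_classD; apply: pres_rel; exact: TensDl.
Qed.
Lemma tinl_monoid : monoid_morphism tinl_fun.
Proof.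
split=> [|x y].
  by rewrite -(rmorph1 (@algin K A)); apply: pres_rel; exact: TensCl.
by rewrite -pres_classM; apply: pres_rel; exact: TensMl.
Qed.
HB.instance Definition _ :=
  GRing.isZmodMorphism.Build A tensalg tinl_fun tinl_zmod.
HB.instance Definition _ :=
  GRing.isMonoidMorphism.Build A tensalg tinl_fun tinl_monoid.
Lemma tinlC k : tinl_fun (algin k) = algin k.
Proof. by apply: pres_rel; exact: TensCl. Qed.
Definition tinl : alghom A tensalg := @AlgHom K A tensalg tinl_fun tinlC.

Lemma tinr_zmod : zmod_morphism tinr_fun.
Proof.
suff addl : {morph tinr_fun : x y / x + y}.
  by move=> x y; apply/eqP; rewrite eq_sym subr_eq -addl subrK.
by move=> x y; rewrite -pres_classD; apply: pres_rel; exact: TensDr.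
Qed.
Lemma tinr_monoid : monoid_morphism tinr_fun.
Proof.
split=> [|x y].
  by rewrite -(rmorph1 (@algin K B)); apply: pres_rel; exact: TensCr.
by rewrite -pres_classM; apply: pres_rel; exact: TensMr.
Qed.
HB.instance Definition _ :=
  GRing.isZmodMorphism.Build B tensalg tinr_fun tinr_zmod.
HB.instance Definition _ :=
  GRing.isMonoidMorphism.Build B tensalg tinr_fun tinr_monoid.
Lemma tinrC k : tinr_fun (algin k) = algin k.
Proof. by apply: pres_rel; exact: TensCr. Qed.
Definition tinr : alghom B tensalg := @AlgHom K B tensalg tinr_fun tinrC.

Definition tens (a : A) (b : B) : tensalg := tinl a * tinr b.

Lemma tinlr_comm a b : tinl a * tinr b = tinr b * tinl a.
Proof. by rewrite -!pres_classM; apply: pres_rel; exact: TensComm. Qed.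

Section TensLift.
Variables (C : pzAlgType K) (f : alghom A C) (g : alghom B C).
Hypothesis fg_comm : forall a b, f a * g b = g b * f a.

Definition tens_lift_gen (x : A + B) : C :=
  match x with inl a => f a | inr b => g b end.

Lemma tens_lift_rel s t :
  tens_rel s t -> nceval tens_lift_gen s = nceval tens_lift_gen t.
Proof.
by case=> *; rewrite /= ?rmorphD ?rmorphM ?alghomC.
Qed.

Definition tens_lift : alghom tensalg C := pres_lift tens_lift_rel.

Lemma tens_lift_inl a : tens_lift (tinl a) = f a.
Proof. exact: (pres_liftE tens_lift_rel (inl a)). Qed.
Lemma tens_lift_inr b : tens_lift (tinr b) = g b.
Proof. exact: (pres_liftE tens_lift_rel (inr b)). Qed.
End TensLift.

Lemma tens_ext (C : pzAlgType K) (f g : alghom tensalg C) :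
  (forall a, f (tinl a) = g (tinl a)) -> (forall b, f (tinr b) = g (tinr b)) ->
  f =1 g.
Proof. by move=> fgl fgr; apply: pres_ext; case. Qed.

Lemma tens_intertw (r r' : nat) (F : alghom tensalg 'M[K]_r)
    (G : alghom tensalg 'M[K]_r') (P : 'M[K]_(r', r)) :
  (forall a, P *m F (tinl a) = G (tinl a) *m P) ->
  (forall b, P *m F (tinr b) = G (tinr b) *m P) ->
  forall x, P *m F x = G x *m P.
Proof. by move=> FGl FGr; apply: pres_intertw; case. Qed.

End Tensor.
Arguments tinl {K A B}.
Arguments tinr {K A B}.

Section TensMaps.
Variable K : fieldType.

Lemma tensmap_comm (A B A' B' : pzAlgType K) (f : alghom A A')
    (g : alghom B B') a b :
  compalg tinl f a * compalg tinr g b =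
  compalg tinr g b * compalg tinl f a :> tensalg A' B'.
Proof. exact: tinlr_comm. Qed.

Definition tensmap (A B A' B' : pzAlgType K) (f : alghom A A')
    (g : alghom B B') : alghom (tensalg A B) (tensalg A' B') :=
  tens_lift (tensmap_comm f g).

Lemma tens_assoc_comm (A B C : pzAlgType K) (x : tensalg A B) (c : C) :
  tensmap (idalg A) tinl x * compalg tinr tinr c =
  compalg tinr tinr c * tensmap (idalg A) tinl x :> tensalg A (tensalg B C).
Proof.
elim/pres_ind: x => [[a|b]|k|x y IHx IHy|x y IHx IHy].
- by rewrite (tens_lift_inl _ a); exact: tinlr_comm.
- by rewrite (tens_lift_inr _ b) /= -!rmorphM tinlr_comm.
- by rewrite !alghomC algin_central.
- by rewrite !rmorphD mulrDl mulrDr IHx IHy.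
- by rewrite !rmorphM -mulrA IHy !mulrA IHx.
Qed.

Definition tens_assoc (A B C : pzAlgType K) :
    alghom (tensalg (tensalg A B) C) (tensalg A (tensalg B C)) :=
  tens_lift (@tens_assoc_comm A B C).

Lemma tensmap_inl (A B A' B' : pzAlgType K) (f : alghom A A')
    (g : alghom B B') a : tensmap f g (tinl a) = tinl (f a).
Proof. exact: tens_lift_inl. Qed.
Lemma tensmap_inr (A B A' B' : pzAlgType K) (f : alghom A A')
    (g : alghom B B') b : tensmap f g (tinr b) = tinr (g b).
Proof. exact: tens_lift_inr. Qed.
Lemma tens_assoc_ll (A B C : pzAlgType K) a :
  tens_assoc A B C (tinl (tinl a)) = tinl a.
Proof. by rewrite [LHS]tens_lift_inl [LHS]tens_lift_inl. Qed.
Lemma tens_assoc_lr (A B C : pzAlgType K) b :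
  tens_assoc A B C (tinl (tinr b)) = tinr (tinl b).
Proof. by rewrite [LHS]tens_lift_inl [LHS]tens_lift_inr. Qed.
Lemma tens_assoc_r (A B C : pzAlgType K) c :
  tens_assoc A B C (tinr c) = tinr (tinr c).
Proof. exact: tens_lift_inr. Qed.

Lemma tens_unitl_comm (A : pzAlgType K) (k : K^o) (a : A) :
  unitalg A k * idalg A a = idalg A a * unitalg A k.
Proof. exact: algin_central. Qed.
Definition tens_unitl (A : pzAlgType K) : alghom (tensalg K^o A) A :=
  tens_lift (@tens_unitl_comm A).
Lemma tens_unitl_l (A : pzAlgType K) k : tens_unitl A (tinl k) = @algin K A k.
Proof. exact: tens_lift_inl. Qed.
Lemma tens_unitl_r (A : pzAlgType K) a : tens_unitl A (tinr a) = a.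
Proof. exact: tens_lift_inr. Qed.

Lemma tens_unitr_comm (A : pzAlgType K) (a : A) (k : K^o) :
  idalg A a * unitalg A k = unitalg A k * idalg A a.
Proof. exact/esym/algin_central. Qed.
Definition tens_unitr (A : pzAlgType K) : alghom (tensalg A K^o) A :=
  tens_lift (@tens_unitr_comm A).
Lemma tens_unitr_l (A : pzAlgType K) a : tens_unitr A (tinl a) = a.
Proof. exact: tens_lift_inl. Qed.
Lemma tens_unitr_r (A : pzAlgType K) k : tens_unitr A (tinr k) = @algin K A k.
Proof. exact: tens_lift_inr. Qed.

End TensMaps.

(* The antipode of a Hopf algebra is not recorded: the Green ring does not
   depend on it. *)
Record bialgebra (K : fieldType) := Bialgebra {
  bialg :> pzAlgType K;
  comul : alghom bialg (tensalg bialg bialg);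
  counit : alghom bialg K^o;
  comulA : forall x, tens_assoc bialg bialg bialg
                       (tensmap comul (idalg bialg) (comul x)) =
                     tensmap (idalg bialg) comul (comul x);
  counitl : forall x,
    tens_unitl bialg (tensmap counit (idalg bialg) (comul x)) = x;
  counitr : forall x,
    tens_unitr bialg (tensmap (idalg bialg) counit (comul x)) = x
}.

(* A module of dimension r is K^r, as column vectors, with the left action of
   x given by the matrix [x]; every finite dimensional left module is
   isomorphic to one of these. *)
Record fdmod (K : fieldType) (A : pzAlgType K) := FdMod {
  mdim : nat;
  maction :> alghom A 'M[K]_mdim
}.

HB.instance Definition _ (K : fieldType) (A : pzAlgType K) :=
  gen_eqMixin (fdmod A).
HB.instance Definition _ (K : fieldType) (A : pzAlgType K) :=
  gen_choiceMixin (fdmod A).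

Definition mod_iso (K : fieldType) (A : pzAlgType K) (V W : fdmod A) : Prop :=
  exists (P : 'M[K]_(mdim W, mdim V)) (Q : 'M[K]_(mdim V, mdim W)),
    [/\ P *m Q = 1%:M, Q *m P = 1%:M & forall x, P *m V x = W x *m P].

Section Reindex.
Variable K : fieldType.

Definition reindex_mx (r s : nat) (f : 'I_s -> 'I_r) : 'M[K]_(s, r) :=
  \matrix_(i, j) (f i == j)%:R.

Lemma reindex_mxl r s t (f : 'I_s -> 'I_r) (A : 'M[K]_(r, t)) i j :
  (reindex_mx f *m A) i j = A (f i) j.
Proof.
rewrite mxE (bigD1 (f i)) //= mxE eqxx mul1r big1 ?addr0 // => k.
by rewrite mxE eq_sym => /negPf ->; rewrite mul0r.
Qed.

Lemma reindex_mxr r s t (f : 'I_s -> 'I_r) (g : 'I_r -> 'I_s)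
    (A : 'M[K]_(t, s)) i j :
  cancel f g -> cancel g f -> (A *m reindex_mx f) i j = A i (g j).
Proof.
move=> fK gK; rewrite mxE (bigD1 (g j)) //= mxE gK eqxx mulr1.
rewrite big1 ?addr0 // => k; rewrite mxE => kj.
case: eqP => [fkj|]; last by rewrite mulr0.
by rewrite -fkj fK eqxx in kj.
Qed.

Lemma reindex_intertw r s (f : 'I_s -> 'I_r) (g : 'I_r -> 'I_s)
    (A : 'M[K]_r) (B : 'M[K]_s) :
  cancel f g -> cancel g f -> (forall i j, A (f i) (f j) = B i j) ->
  reindex_mx f *m A = B *m reindex_mx f.
Proof.
move=> fK gK AB; apply/matrixP => i j.
by rewrite reindex_mxl (reindex_mxr _ _ _ fK gK) -AB gK.
Qed.

Lemma reindex_iso (A : pzAlgType K) (V W : fdmod A)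
    (f : 'I_(mdim W) -> 'I_(mdim V)) (g : 'I_(mdim V) -> 'I_(mdim W)) :
  cancel f g -> cancel g f ->
  (forall x, reindex_mx f *m V x = W x *m reindex_mx f) -> mod_iso V W.
Proof.
move=> fK gK VW; exists (reindex_mx f), (reindex_mx g); split => //.
  by apply/matrixP => i j; rewrite reindex_mxl !mxE fK.
by apply/matrixP => i j; rewrite reindex_mxl !mxE gK.
Qed.
End Reindex.

Section DirectSum.
Variables (K : fieldType) (A : pzAlgType K).

Section Action.
Variables (r s : nat) (f : alghom A 'M[K]_r) (g : alghom A 'M[K]_s).

Definition dsum_fun (x : A) : 'M[K]_(r + s) := block_mx (f x) 0 0 (g x).

Lemma dsum_zmod : zmod_morphism dsum_fun.
Proof.
by move=> x y; rewrite /dsum_fun opp_block_mx add_block_mx !oppr0 !addr0 !rmorphB.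
Qed.
Lemma dsum_monoid : monoid_morphism dsum_fun.
Proof.
split=> [|x y]; rewrite /dsum_fun; first by rewrite !rmorph1 -scalar_mx_block.
rewrite [RHS]mulmx_block !rmorphM /=.
by rewrite !(mulmx0, mul0mx, addr0, add0r).
Qed.
HB.instance Definition _ :=
  GRing.isZmodMorphism.Build A 'M[K]_(r + s) dsum_fun dsum_zmod.
HB.instance Definition _ :=
  GRing.isMonoidMorphism.Build A 'M[K]_(r + s) dsum_fun dsum_monoid.
Lemma dsumC k : dsum_fun (algin k) = algin k.
Proof. by rewrite /dsum_fun !alghomC -scalar_mx_block. Qed.
Definition dsum_action : alghom A 'M[K]_(r + s) :=
  @AlgHom K A 'M[K]_(r + s) dsum_fun dsumC.
End Action.

Definition mod_sum (V W : fdmod A) : fdmod A := FdMod (dsum_action V W).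

Definition zero_fun (x : A) : 'M[K]_0 := 0.
Lemma zero_zmod : zmod_morphism zero_fun.
Proof. by move=> x y; apply/matrixP; case. Qed.
Lemma zero_monoid : monoid_morphism zero_fun.
Proof. by split=> [|x y]; apply/matrixP; case. Qed.
HB.instance Definition _ :=
  GRing.isZmodMorphism.Build A 'M[K]_0 zero_fun zero_zmod.
HB.instance Definition _ :=
  GRing.isMonoidMorphism.Build A 'M[K]_0 zero_fun zero_monoid.
Lemma zeroC k : zero_fun (algin k) = algin k.
Proof. by apply/matrixP; case. Qed.
Definition mod_zero : fdmod A := FdMod (@AlgHom K A 'M[K]_0 zero_fun zeroC).

End DirectSum.

Section TensorAction.
Variables (K : fieldType) (A B : pzAlgType K).
Variables (r s : nat) (f : alghom A 'M[K]_r) (g : alghom B 'M[K]_s).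

Definition kronl_fun (x : A) : 'M[K]_(r * s) := f x *t (1%:M : 'M[K]_s).
Definition kronr_fun (y : B) : 'M[K]_(r * s) := (1%:M : 'M[K]_r) *t g y.

Lemma tens11 : (1%:M : 'M[K]_r) *t (1%:M : 'M[K]_s) = 1%:M.
Proof.
apply/matrixP => i j; case: (mxtens_indexP i) => i1 i2.
case: (mxtens_indexP j) => j1 j2; rewrite tensmxE !mxE.
rewrite (can_eq (@mxtens_indexK _ _)) xpair_eqE.
by case: eqP; case: eqP; rewrite /= ?mulr0 ?mul1r ?mul0r.
Qed.

Lemma kronl_zmod : zmod_morphism kronl_fun.
Proof.
move=> x y; apply/matrixP => i j.
by rewrite /kronl_fun rmorphB !mxE mulrBl.
Qed.
Lemma kronl_monoid : monoid_morphism kronl_fun.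
Proof.
split=> [|x y]; rewrite /kronl_fun; first by rewrite rmorph1 tens11.
by rewrite [RHS]tensmx_mul mulmx1 rmorphM.
Qed.
HB.instance Definition _ :=
  GRing.isZmodMorphism.Build A 'M[K]_(r * s) kronl_fun kronl_zmod.
HB.instance Definition _ :=
  GRing.isMonoidMorphism.Build A 'M[K]_(r * s) kronl_fun kronl_monoid.
Lemma kronlC k : kronl_fun (algin k) = algin k.
Proof.
rewrite /kronl_fun alghomC; apply/matrixP => i j.
case: (mxtens_indexP i) => i1 i2; case: (mxtens_indexP j) => j1 j2.
rewrite tensmxE !mxE (can_eq (@mxtens_indexK _ _)) xpair_eqE.
by case: eqP; case: eqP; rewrite /= ?mulr0 ?mulr1.
Qed.
Definition kronl : alghom A 'M[K]_(r * s) :=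
  @AlgHom K A 'M[K]_(r * s) kronl_fun kronlC.

Lemma kronr_zmod : zmod_morphism kronr_fun.
Proof.
move=> x y; apply/matrixP => i j.
by rewrite /kronr_fun rmorphB !mxE mulrBr.
Qed.
Lemma kronr_monoid : monoid_morphism kronr_fun.
Proof.
split=> [|x y]; rewrite /kronr_fun; first by rewrite rmorph1 tens11.
by rewrite [RHS]tensmx_mul mulmx1 rmorphM.
Qed.
HB.instance Definition _ :=
  GRing.isZmodMorphism.Build B 'M[K]_(r * s) kronr_fun kronr_zmod.
HB.instance Definition _ :=
  GRing.isMonoidMorphism.Build B 'M[K]_(r * s) kronr_fun kronr_monoid.
Lemma kronrC k : kronr_fun (algin k) = algin k.
Proof.
rewrite /kronr_fun alghomC; apply/matrixP => i j.
case: (mxtens_indexP i) => i1 i2; case: (mxtens_indexP j) => j1 j2.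
rewrite tensmxE !mxE (can_eq (@mxtens_indexK _ _)) xpair_eqE.
by case: eqP; case: eqP; rewrite /= ?mulr0 ?mul1r ?mul0r.
Qed.
Definition kronr : alghom B 'M[K]_(r * s) :=
  @AlgHom K B 'M[K]_(r * s) kronr_fun kronrC.

Lemma kron_comm a b : kronl a * kronr b = kronr b * kronl a.
Proof.
rewrite [LHS]tensmx_mul [RHS]tensmx_mul.
by rewrite !mulmx1 !mul1mx.
Qed.

(* a (x) b acts on K^r (x) K^s as the Kronecker product of f a and g b. *)
Definition kron : alghom (tensalg A B) 'M[K]_(r * s) := tens_lift kron_comm.

Lemma kron_tens a b : kron (tens a b) = f a *t g b.
Proof.
rewrite rmorphM [X in X * _]tens_lift_inl [X in _ * X]tens_lift_inr.
by rewrite [LHS]tensmx_mul mulmx1 mul1mx.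
Qed.

Lemma kron_inl a i1 i2 j1 j2 :
  kron (tinl a) (mxtens_index (i1, i2)) (mxtens_index (j1, j2)) =
  f a i1 j1 * (i2 == j2)%:R.
Proof. by rewrite tens_lift_inl [LHS]tensmxE mxE. Qed.

Lemma kron_inr b i1 i2 j1 j2 :
  kron (tinr b) (mxtens_index (i1, i2)) (mxtens_index (j1, j2)) =
  (i1 == j1)%:R * g b i2 j2.
Proof. by rewrite tens_lift_inr [LHS]tensmxE mxE. Qed.

End TensorAction.

Lemma kron_tensmap (K : fieldType) (A B A' B' : pzAlgType K) (r s : nat)
    (p : alghom A A') (q : alghom B B')
    (f : alghom A' 'M[K]_r) (g : alghom B' 'M[K]_s) x :
  kron (compalg f p) (compalg g q) x = kron f g (tensmap p q x).
Proof.
apply: (tens_ext (g := compalg (kron f g) (tensmap p q))) => y.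
  transitivity (kron f g (tinl (p y))); last first.
    by congr (kron f g _); rewrite tens_lift_inl.
  by rewrite [LHS]tens_lift_inl [RHS]tens_lift_inl.
transitivity (kron f g (tinr (q y))); last first.
  by congr (kron f g _); rewrite tens_lift_inr.
by rewrite [LHS]tens_lift_inr [RHS]tens_lift_inr.
Qed.

Section ModuleTensor.
Variables (K : fieldType) (H : bialgebra K).
Implicit Types V W U : fdmod H.

Definition mod_tens V W : fdmod H := FdMod (compalg (kron V W) (comul H)).

Lemma mod_tensE V W x : mod_tens V W x = kron V W (comul H x).
Proof. by []. Qed.

Definition mod_unit : fdmod H :=
  FdMod (compalg (unitalg 'M[K]_1) (counit H)).

End ModuleTensor.

Section IsoClass.
Variables (K : fieldType) (A : pzAlgType K).
Implicit Types V W U : fdmod A.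

Lemma mod_iso_refl V : mod_iso V V.
Proof.
by exists 1%:M, 1%:M; split=> [||x]; rewrite ?mulmx1 ?mul1mx.
Qed.
Lemma mod_iso_sym V W : mod_iso V W -> mod_iso W V.
Proof.
case=> P [Q [PQ QP PV]]; exists Q, P; split=> // x.
by rewrite -[W x]mulmx1 -PQ (mulmxA (W x)) -PV !mulmxA QP mul1mx.
Qed.
Lemma mod_iso_trans V W U : mod_iso V W -> mod_iso W U -> mod_iso V U.
Proof.
case=> P [Q [PQ QP PV]] [P' [Q' [PQ' QP' PW]]].
exists (P' *m P), (Q *m Q'); split=> [||x].
- by rewrite mulmxA -(mulmxA P') PQ mulmx1.
- by rewrite mulmxA -(mulmxA Q) QP' mulmx1.
- by rewrite -mulmxA PV mulmxA PW mulmxA.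
Qed.

Definition mod_isob : rel (fdmod A) := fun V W => `[< mod_iso V W >].
Lemma mod_isob_refl : reflexive mod_isob.
Proof. by move=> V; apply/asboolP; exact: mod_iso_refl. Qed.
Lemma mod_isob_sym : symmetric mod_isob.
Proof. by move=> V W; apply/asboolP/asboolP; exact: mod_iso_sym. Qed.
Lemma mod_isob_trans : transitive mod_isob.
Proof.
by move=> W V U /asboolP VW /asboolP WU; apply/asboolP; exact: mod_iso_trans VW WU.
Qed.
Canonical mod_iso_equiv :=
  EquivRel mod_isob mod_isob_refl mod_isob_sym mod_isob_trans.

Definition isoclass := {eq_quot mod_iso_equiv}.
HB.instance Definition _ := Choice.on isoclass.

Definition iso_cls V : isoclass := \pi_{eq_quot mod_iso_equiv} V.

Lemma iso_clsP V W : mod_iso V W <-> iso_cls V = iso_cls W.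
Proof.
split=> [VW|/eqmodP/asboolP //].
by apply/eqmodP/asboolP.
Qed.

Lemma iso_clsK (x : isoclass) : iso_cls (repr x) = x.
Proof. exact: reprK. Qed.

Lemma iso_cls_repr V : mod_iso (repr (iso_cls V)) V.
Proof. by apply/iso_clsP; rewrite iso_clsK. Qed.

Lemma mod_sum_iso V V' W W' :
  mod_iso V V' -> mod_iso W W' -> mod_iso (mod_sum V W) (mod_sum V' W').
Proof.
case=> P [Q [PQ QP PV]] [P' [Q' [PQ' QP' PW]]].
exists (block_mx P 0 0 P'), (block_mx Q 0 0 Q'); split=> [||x] /=.
- rewrite mulmx_block !(mulmx0, mul0mx, addr0, add0r) PQ PQ'.
  by rewrite -scalar_mx_block.
- rewrite mulmx_block !(mulmx0, mul0mx, addr0, add0r) QP QP'.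
  by rewrite -scalar_mx_block.
- by rewrite /dsum_fun !mulmx_block !(mulmx0, mul0mx, addr0, add0r) PV PW.
Qed.

Lemma block_entries (m n : nat) (M : 'M[K]_m) (N : 'M[K]_n) i j :
  block_mx M 0 0 N i j =
  match split i, split j with
  | inl i', inl j' => M i' j'
  | inr i', inr j' => N i' j'
  | _, _ => 0
  end.
Proof.
by rewrite !mxE; case: split => i'; rewrite !mxE; case: split => j'; rewrite ?mxE.
Qed.

Definition sumC_ord m n (i : 'I_(m + n)) : 'I_(n + m) :=
  match split i with inl a => rshift n a | inr b => lshift m b end.
Lemma sumC_ordK m n : cancel (@sumC_ord m n) (@sumC_ord n m).
Proof.
move=> i; rewrite /sumC_ord -[in RHS](splitK i); case: (split i) => a.
  by rewrite (unsplitK (inr a)).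
by rewrite (unsplitK (inl a)).
Qed.

Lemma mod_sumC V W : mod_iso (mod_sum V W) (mod_sum W V).
Proof.
apply: (@reindex_iso _ _ (mod_sum V W) (mod_sum W V) (@sumC_ord (mdim W) (mdim V))
                             (@sumC_ord (mdim V) (mdim W))).
- exact: sumC_ordK.
- exact: sumC_ordK.
move=> x; apply: reindex_intertw => [||i j]; [exact: sumC_ordK..|].
rewrite /= /dsum_fun !block_entries /sumC_ord.
by case: (split i) => a; case: (split j) => b;
  rewrite ?(unsplitK (inl _)) ?(unsplitK (inr _)).
Qed.

Definition sumA_ord m n p (i : 'I_(m + n + p)) : 'I_(m + (n + p)) :=
  match split i with
  | inl i' => match split i' with
              | inl a => lshift (n + p) a
              | inr b => rshift m (lshift p b)
              end
  | inr c => rshift m (rshift n c)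
  end.
Definition sumA_ord' m n p (i : 'I_(m + (n + p))) : 'I_(m + n + p) :=
  match split i with
  | inl a => lshift p (lshift n a)
  | inr i' => match split i' with
              | inl b => lshift p (rshift m b)
              | inr c => rshift (m + n) c
              end
  end.
Lemma split_l m n (a : 'I_m) : split (lshift n a) = inl a.
Proof. exact: (unsplitK (inl a)). Qed.
Lemma split_r m n (a : 'I_n) : split (rshift m a) = inr a.
Proof. exact: (unsplitK (inr a)). Qed.
Lemma sumA_ordK m n p : cancel (@sumA_ord m n p) (@sumA_ord' m n p).
Proof.
move=> i; rewrite /sumA_ord /sumA_ord' -[in RHS](splitK i).
case: (split i) => a /=; last by rewrite !split_r.
by rewrite -[in RHS](splitK a); case: (split a) => b /=; rewrite ?(split_l, split_r).
Qed.
Lemma sumA_ord'K m n p : cancel (@sumA_ord' m n p) (@sumA_ord m n p).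
Proof.
move=> i; rewrite /sumA_ord /sumA_ord' -[in RHS](splitK i).
case: (split i) => a /=; first by rewrite !split_l.
by rewrite -[in RHS](splitK a); case: (split a) => b /=; rewrite ?(split_l, split_r).
Qed.

Lemma mod_sumA V W U :
  mod_iso (mod_sum V (mod_sum W U)) (mod_sum (mod_sum V W) U).
Proof.
pose f := @sumA_ord (mdim V) (mdim W) (mdim U).
pose g := @sumA_ord' (mdim V) (mdim W) (mdim U).
have fK : cancel f g by exact: sumA_ordK.
have gK : cancel g f by exact: sumA_ord'K.
apply: (@reindex_iso _ _ (mod_sum V (mod_sum W U)) (mod_sum (mod_sum V W) U) f g fK gK) => x.
apply: (reindex_intertw fK gK) => i j.
rewrite /= /dsum_fun !block_entries /f /sumA_ord.
case: (split i) => a /=; case: (split j) => b /=;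
  rewrite ?split_r ?block_entries.
- by case: (split a) => c; case: (split b) => d;
    rewrite ?(split_l, split_r) ?block_entries ?(split_l, split_r).
- by case: (split a) => c;
    rewrite ?(split_l, split_r) ?block_entries ?(split_l, split_r).
- by case: (split b) => c;
    rewrite ?(split_l, split_r) ?block_entries ?(split_l, split_r).
- by rewrite !split_r.
Qed.

Lemma mod_sum0 V : mod_iso (mod_sum (mod_zero A) V) V.
Proof.
pose f : 'I_(mdim V) -> 'I_(0 + mdim V) := @rshift 0 (mdim V).
pose g : 'I_(0 + mdim V) -> 'I_(mdim V) := id.
have fK : cancel f g by move=> i; apply: val_inj.
have gK : cancel g f by move=> i; apply: val_inj.
apply: (@reindex_iso _ _ (mod_sum (mod_zero A) V) V f g fK gK) => x.
apply: (reindex_intertw fK gK) => i j.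
by rewrite /= /dsum_fun block_entries /f !split_r.
Qed.

Definition iso_add (x y : isoclass) := iso_cls (mod_sum (repr x) (repr y)).
Lemma iso_addE V W : iso_add (iso_cls V) (iso_cls W) = iso_cls (mod_sum V W).
Proof. by apply/iso_clsP; apply: mod_sum_iso; exact: iso_cls_repr. Qed.

Lemma iso_addA : associative iso_add.
Proof.
move=> x y z; rewrite -[x]iso_clsK -[y]iso_clsK -[z]iso_clsK !iso_addE.
by apply/iso_clsP; exact: mod_sumA.
Qed.
Lemma iso_addC : commutative iso_add.
Proof. by move=> x y; apply/iso_clsP; exact: mod_sumC. Qed.
Lemma iso_add0 : left_id (iso_cls (mod_zero A)) iso_add.
Proof.
move=> x; rewrite -[x]iso_clsK iso_addE.
by apply/iso_clsP; exact: mod_sum0.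
Qed.
HB.instance Definition _ :=
  GRing.isNmodule.Build isoclass iso_addA iso_addC iso_add0.

End IsoClass.

Section IsoClassMul.
Variables (K : fieldType) (H : bialgebra K).
Implicit Types V W U : fdmod H.

Lemma mod_tens_iso V V' W W' :
  mod_iso V V' -> mod_iso W W' -> mod_iso (mod_tens V W) (mod_tens V' W').
Proof.
case=> P [Q [PQ QP PV]] [P' [Q' [PQ' QP' PW]]].
exists (P *t P'), (Q *t Q'); split=> [||x].
- by rewrite tensmx_mul PQ PQ' tens11.
- by rewrite tensmx_mul QP QP' tens11.
apply: (tens_intertw (F := kron V W) (G := kron V' W')) => y.
  rewrite !tens_lift_inl [LHS]tensmx_mul [RHS]tensmx_mul.
  by rewrite PV mulmx1 mul1mx.
rewrite !tens_lift_inr [LHS]tensmx_mul [RHS]tensmx_mul.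
by rewrite PW mulmx1 mul1mx.
Qed.

Lemma fst_pair (S T : Type) (x : S) (y : T) : (x, y).1 = x. Proof. by []. Qed.
Lemma snd_pair (S T : Type) (x : S) (y : T) : (x, y).2 = y. Proof. by []. Qed.

Definition mulA_ord m n p (i : 'I_(m * n * p)) : 'I_(m * (n * p)) :=
  let u := mxtens_unindex i in let v := mxtens_unindex u.1 in
  mxtens_index (v.1, mxtens_index (v.2, u.2)).
Definition mulA_ord' m n p (i : 'I_(m * (n * p))) : 'I_(m * n * p) :=
  let u := mxtens_unindex i in let v := mxtens_unindex u.2 in
  mxtens_index (mxtens_index (u.1, v.1), v.2).
Lemma mulA_ordK m n p : cancel (@mulA_ord m n p) (@mulA_ord' m n p).
Proof.
move=> i; case: (mxtens_indexP i) => i' c; case: (mxtens_indexP i') => a b.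
by rewrite /mulA_ord /mulA_ord' !(mxtens_indexK, fst_pair, snd_pair).
Qed.
Lemma mulA_ord'K m n p : cancel (@mulA_ord' m n p) (@mulA_ord m n p).
Proof.
move=> i; case: (mxtens_indexP i) => a i'; case: (mxtens_indexP i') => b c.
by rewrite /mulA_ord /mulA_ord' !(mxtens_indexK, fst_pair, snd_pair).
Qed.

Lemma index_eq m n (i i' : 'I_m) (j j' : 'I_n) :
  (mxtens_index (i, j) == mxtens_index (i', j')) = (i == i') && (j == j').
Proof. by rewrite (can_eq (@mxtens_indexK _ _)). Qed.

Lemma kron_assoc (A B C : pzAlgType K) (r s t : nat) (f : alghom A 'M[K]_r)
    (g : alghom B 'M[K]_s) (h : alghom C 'M[K]_t) x :
  reindex_mx K (@mulA_ord r s t) *m kron f (kron g h) (tens_assoc A B C x) =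
  kron (kron f g) h x *m reindex_mx K (@mulA_ord r s t).
Proof.
have fK := @mulA_ordK r s t; have gK := @mulA_ord'K r s t.
set P := reindex_mx _ _.
apply: (tens_intertw (F := compalg (kron f (kron g h)) (tens_assoc A B C))) => y.
  apply: (tens_intertw
    (F := compalg (compalg (kron f (kron g h)) (tens_assoc A B C)) tinl)
    (G := compalg (kron (kron f g) h) tinl)) => {}y.
    have -> : compalg (compalg (kron f (kron g h)) (tens_assoc A B C)) tinl
        (tinl y) = kron f (kron g h) (tinl y).
      by rewrite -(tens_assoc_ll B C y).
    apply: (reindex_intertw fK gK) => i j /=.
    case: (mxtens_indexP i) => i' i3; case: (mxtens_indexP i') => i1 i2.
    case: (mxtens_indexP j) => j' j3; case: (mxtens_indexP j') => j1 j2.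
    rewrite /mulA_ord !(mxtens_indexK, fst_pair, snd_pair) !kron_inl index_eq.
    by rewrite -mulrA -natrM mulnb.
  have -> : compalg (compalg (kron f (kron g h)) (tens_assoc A B C)) tinl
      (tinr y) = kron f (kron g h) (tinr (tinl y)).
    by rewrite -(tens_assoc_lr A C y).
  apply: (reindex_intertw fK gK) => i j /=.
  case: (mxtens_indexP i) => i' i3; case: (mxtens_indexP i') => i1 i2.
  case: (mxtens_indexP j) => j' j3; case: (mxtens_indexP j') => j1 j2.
  rewrite /mulA_ord !(mxtens_indexK, fst_pair, snd_pair).
  by rewrite kron_inr !kron_inl kron_inr mulrA.
have -> : compalg (kron f (kron g h)) (tens_assoc A B C) (tinr y) =
    kron f (kron g h) (tinr (tinr y)).
  by rewrite -(tens_assoc_r A B y).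
apply: (reindex_intertw fK gK) => i j /=.
case: (mxtens_indexP i) => i' i3; case: (mxtens_indexP i') => i1 i2.
case: (mxtens_indexP j) => j' j3; case: (mxtens_indexP j') => j1 j2.
rewrite /mulA_ord !(mxtens_indexK, fst_pair, snd_pair) !kron_inr index_eq.
by rewrite mulrA -natrM mulnb.
Qed.

Lemma kron_ext (A B : pzAlgType K) r s (f f' : alghom A 'M[K]_r)
    (g g' : alghom B 'M[K]_s) : f =1 f' -> g =1 g' -> kron f g =1 kron f' g'.
Proof.
move=> ff gg; apply: tens_ext => y.
  by rewrite !tens_lift_inl /= /kronl_fun ff.
by rewrite !tens_lift_inr /= /kronr_fun gg.
Qed.

Lemma mod_tensA V W U :
  mod_iso (mod_tens V (mod_tens W U)) (mod_tens (mod_tens V W) U).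
Proof.
pose f := @mulA_ord (mdim V) (mdim W) (mdim U).
pose g := @mulA_ord' (mdim V) (mdim W) (mdim U).
have fK : cancel f g by exact: mulA_ordK.
have gK : cancel g f by exact: mulA_ord'K.
have EV y : mod_tens V (mod_tens W U) y =
    kron V (kron W U) (tensmap (idalg H) (comul H) (comul H y)).
  by rewrite -kron_tensmap; exact: kron_ext.
have EU y : mod_tens (mod_tens V W) U y =
    kron (kron V W) U (tensmap (comul H) (idalg H) (comul H y)).
  by rewrite -kron_tensmap; exact: kron_ext.
apply: (@reindex_iso _ _ (mod_tens V (mod_tens W U))
                         (mod_tens (mod_tens V W) U) f g fK gK) => x.
by rewrite EV EU -comulA; exact: kron_assoc.
Qed.

Definition mul1_ord n (i : 'I_n) : 'I_(1 * n) := mxtens_index (ord0, i).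
Definition mul1_ord' n (i : 'I_(1 * n)) : 'I_n := (mxtens_unindex i).2.
Lemma mul1_ordK n : cancel (@mul1_ord n) (@mul1_ord' n).
Proof. by move=> i; rewrite /mul1_ord' mxtens_indexK. Qed.
Lemma mul1_ord'K n : cancel (@mul1_ord' n) (@mul1_ord n).
Proof.
move=> i; case: (mxtens_indexP i) => a b.
by rewrite /mul1_ord' mxtens_indexK /mul1_ord (ord1 a).
Qed.

Lemma mod_tens1 V : mod_iso (mod_tens (mod_unit H) V) V.
Proof.
have fK := @mul1_ordK (mdim V); have gK := @mul1_ord'K (mdim V).
apply: (@reindex_iso _ _ (mod_tens (mod_unit H) V) V _ _ fK gK) => x.
rewrite -{2}(counitl x) [in LHS]mod_tensE.
rewrite (@kron_ext _ _ _ _ (compalg (unitalg 'M[K]_1) (counit H))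
  (compalg (unitalg 'M[K]_1) (counit H)) V (compalg V (idalg H))) //.
rewrite kron_tensmap; move: (tensmap _ _ _) => {}x.
apply: (tens_intertw (F := kron _ _) (G := compalg V (tens_unitl H))) => y.
  have -> : compalg V (tens_unitl H) (tinl y) = V (@algin K H y).
    by rewrite -(tens_unitl_l H y).
  apply: (reindex_intertw fK gK) => i j /=.
  rewrite [LHS]kron_inl alghomC !mxE !eqxx mulr1n.
  by case: eqP; rewrite ?mulr1 ?mulr0.
have -> : compalg V (tens_unitl H) (tinr y) = V y.
  by rewrite -[in RHS](tens_unitl_r y).
apply: (reindex_intertw fK gK) => i j /=.
by rewrite [LHS]kron_inr eqxx mul1r.
Qed.

Definition mulr1_ord n (i : 'I_n) : 'I_(n * 1) := mxtens_index (i, ord0).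
Definition mulr1_ord' n (i : 'I_(n * 1)) : 'I_n := (mxtens_unindex i).1.
Lemma mulr1_ordK n : cancel (@mulr1_ord n) (@mulr1_ord' n).
Proof. by move=> i; rewrite /mulr1_ord' mxtens_indexK. Qed.
Lemma mulr1_ord'K n : cancel (@mulr1_ord' n) (@mulr1_ord n).
Proof.
move=> i; case: (mxtens_indexP i) => a b.
by rewrite /mulr1_ord' mxtens_indexK /mulr1_ord (ord1 b).
Qed.

Lemma mod_tens1r V : mod_iso (mod_tens V (mod_unit H)) V.
Proof.
have fK := @mulr1_ordK (mdim V); have gK := @mulr1_ord'K (mdim V).
apply: (@reindex_iso _ _ (mod_tens V (mod_unit H)) V _ _ fK gK) => x.
rewrite -{2}(counitr x) [in LHS]mod_tensE.
rewrite (@kron_ext _ _ _ _ V (compalg V (idalg H))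
  (compalg (unitalg 'M[K]_1) (counit H))
  (compalg (unitalg 'M[K]_1) (counit H))) //.
rewrite kron_tensmap; move: (tensmap _ _ _) => {}x.
apply: (tens_intertw (F := kron _ _) (G := compalg V (tens_unitr H))) => y.
  have -> : compalg V (tens_unitr H) (tinl y) = V y.
    by rewrite -[in RHS](tens_unitr_l y).
  apply: (reindex_intertw fK gK) => i j /=.
  by rewrite [LHS]kron_inl eqxx mulr1.
have -> : compalg V (tens_unitr H) (tinr y) = V (@algin K H y).
  by rewrite -(tens_unitr_r H y).
apply: (reindex_intertw fK gK) => i j /=.
rewrite [LHS]kron_inr alghomC !mxE !eqxx mulr1n.
by case: eqP; rewrite ?mul1r ?mul0r.
Qed.

Definition mulDl_ord m n p (i : 'I_(m * p + n * p)) : 'I_((m + n) * p) :=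
  match split i with
  | inl a => let u := mxtens_unindex a in mxtens_index (lshift n u.1, u.2)
  | inr b => let u := mxtens_unindex b in mxtens_index (rshift m u.1, u.2)
  end.
Definition mulDl_ord' m n p (i : 'I_((m + n) * p)) : 'I_(m * p + n * p) :=
  let u := mxtens_unindex i in
  match split u.1 with
  | inl a => lshift (n * p) (mxtens_index (a, u.2))
  | inr b => rshift (m * p) (mxtens_index (b, u.2))
  end.
Lemma mulDl_ordK m n p : cancel (@mulDl_ord m n p) (@mulDl_ord' m n p).
Proof.
move=> i; rewrite /mulDl_ord /mulDl_ord' -[in RHS](splitK i).
by case: (split i) => a; case: (mxtens_indexP a) => b c; cbv beta iota zeta delta [unsplit];
  rewrite !(mxtens_indexK, fst_pair, snd_pair, split_l, split_r).
Qed.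
Lemma mulDl_ord'K m n p : cancel (@mulDl_ord' m n p) (@mulDl_ord m n p).
Proof.
move=> i; case: (mxtens_indexP i) => a b.
rewrite /mulDl_ord /mulDl_ord' !mxtens_indexK fst_pair snd_pair -[in RHS](splitK a).
by case: (split a) => c; cbv beta iota zeta delta [unsplit];
  do 3 (cbv beta iota zeta;
    rewrite ?(mxtens_indexK, fst_pair, snd_pair, split_l, split_r)).
Qed.

Lemma mod_tensDl V W U :
  mod_iso (mod_tens (mod_sum V W) U) (mod_sum (mod_tens V U) (mod_tens W U)).
Proof.
pose f := @mulDl_ord (mdim V) (mdim W) (mdim U).
pose g := @mulDl_ord' (mdim V) (mdim W) (mdim U).
have fK : cancel f g by exact: mulDl_ordK.
have gK : cancel g f by exact: mulDl_ord'K.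
apply: (@reindex_iso _ _ (mod_tens (mod_sum V W) U) (mod_sum (mod_tens V U) (mod_tens W U)) f g fK gK) => x.
rewrite /= /dsum_fun /=; move: (comul H x) => {x}.
apply: (tens_intertw (F := kron (dsum_action V W) U)
  (G := dsum_action (kron V U) (kron W U))) => y;
  apply: (reindex_intertw fK gK) => i j;
  rewrite /= /dsum_fun block_entries /f /mulDl_ord;
  case: (split i) => a; case: (split j) => b;
  case: (mxtens_indexP a) => a1 a2; case: (mxtens_indexP b) => b1 b2;
  rewrite !(mxtens_indexK, fst_pair, snd_pair) ?kron_inl ?kron_inr /= /dsum_fun ?block_entries
    ?(split_l, split_r) ?mul0r //; rewrite ?(inj_eq (@lshift_inj _ _))
    ?(inj_eq (@rshift_inj _ _)) // ?eq_lrshift ?eq_rlshift ?mul0r //.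
Qed.

Definition mulDr_ord m n p (i : 'I_(m * n + m * p)) : 'I_(m * (n + p)) :=
  match split i with
  | inl a => let u := mxtens_unindex a in mxtens_index (u.1, lshift p u.2)
  | inr b => let u := mxtens_unindex b in mxtens_index (u.1, rshift n u.2)
  end.
Definition mulDr_ord' m n p (i : 'I_(m * (n + p))) : 'I_(m * n + m * p) :=
  let u := mxtens_unindex i in
  match split u.2 with
  | inl a => lshift (m * p) (mxtens_index (u.1, a))
  | inr b => rshift (m * n) (mxtens_index (u.1, b))
  end.
Lemma mulDr_ordK m n p : cancel (@mulDr_ord m n p) (@mulDr_ord' m n p).
Proof.
move=> i; rewrite /mulDr_ord /mulDr_ord' -[in RHS](splitK i).
by case: (split i) => a; case: (mxtens_indexP a) => b c; cbv beta iota zeta delta [unsplit];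
  rewrite !(mxtens_indexK, fst_pair, snd_pair, split_l, split_r).
Qed.
Lemma mulDr_ord'K m n p : cancel (@mulDr_ord' m n p) (@mulDr_ord m n p).
Proof.
move=> i; case: (mxtens_indexP i) => a b.
rewrite /mulDr_ord /mulDr_ord' !mxtens_indexK fst_pair snd_pair -[in RHS](splitK b).
by case: (split b) => c; cbv beta iota zeta delta [unsplit];
  do 3 (cbv beta iota zeta;
    rewrite ?(mxtens_indexK, fst_pair, snd_pair, split_l, split_r)).
Qed.

Lemma mod_tensDr V W U :
  mod_iso (mod_tens V (mod_sum W U)) (mod_sum (mod_tens V W) (mod_tens V U)).
Proof.
pose f := @mulDr_ord (mdim V) (mdim W) (mdim U).
pose g := @mulDr_ord' (mdim V) (mdim W) (mdim U).
have fK : cancel f g by exact: mulDr_ordK.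
have gK : cancel g f by exact: mulDr_ord'K.
apply: (@reindex_iso _ _ (mod_tens V (mod_sum W U)) (mod_sum (mod_tens V W) (mod_tens V U)) f g fK gK) => x.
rewrite /= /dsum_fun /=; move: (comul H x) => {x}.
apply: (tens_intertw (F := kron V (dsum_action W U))
  (G := dsum_action (kron V W) (kron V U))) => y;
  apply: (reindex_intertw fK gK) => i j;
  rewrite /= /dsum_fun block_entries /f /mulDr_ord;
  case: (split i) => a; case: (split j) => b;
  case: (mxtens_indexP a) => a1 a2; case: (mxtens_indexP b) => b1 b2;
  rewrite !(mxtens_indexK, fst_pair, snd_pair) ?kron_inl ?kron_inr /= /dsum_fun ?block_entries
    ?(split_l, split_r) ?mulr0 //; rewrite ?(inj_eq (@lshift_inj _ _))
    ?(inj_eq (@rshift_inj _ _)) // ?eq_lrshift ?eq_rlshift ?mulr0 //.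
Qed.

Lemma mod_tens0 V : mod_iso (mod_tens (mod_zero H) V) (mod_zero H).
Proof. by exists 0, 0; split=> *; apply/matrixP; case. Qed.

Lemma mod_tens0r V : mod_iso (mod_tens V (mod_zero H)) (mod_zero H).
Proof.
have no (i : 'I_(mdim V * 0)) : False by case: (mxtens_indexP i) => ? [].
by exists 0, 0; split=> *; apply/matrixP => i j; [case: i|case: (no i)|case: i].
Qed.

Definition iso_mul (x y : isoclass H) := iso_cls (mod_tens (repr x) (repr y)).
Lemma iso_mulE V W : iso_mul (iso_cls V) (iso_cls W) = iso_cls (mod_tens V W).
Proof. by apply/iso_clsP; apply: mod_tens_iso; exact: iso_cls_repr. Qed.

Lemma iso_clsD V W : iso_cls (mod_sum V W) = iso_cls V + iso_cls W.
Proof. exact/esym/iso_addE. Qed.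

Lemma iso_mulA : associative iso_mul.
Proof.
move=> x y z; rewrite -[x]iso_clsK -[y]iso_clsK -[z]iso_clsK !iso_mulE.
by apply/iso_clsP; exact: mod_tensA.
Qed.
Lemma iso_mul1 : left_id (iso_cls (mod_unit H)) iso_mul.
Proof.
move=> x; rewrite -[x]iso_clsK iso_mulE.
by apply/iso_clsP; exact: mod_tens1.
Qed.
Lemma iso_mul1r : right_id (iso_cls (mod_unit H)) iso_mul.
Proof.
move=> x; rewrite -[x]iso_clsK iso_mulE.
by apply/iso_clsP; exact: mod_tens1r.
Qed.
Lemma iso_mulDl : left_distributive iso_mul +%R.
Proof.
move=> x y z; rewrite -[x]iso_clsK -[y]iso_clsK -[z]iso_clsK.
rewrite -iso_clsD !iso_mulE -iso_clsD.
by apply/iso_clsP; exact: mod_tensDl.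
Qed.
Lemma iso_mulDr : right_distributive iso_mul +%R.
Proof.
move=> x y z; rewrite -[x]iso_clsK -[y]iso_clsK -[z]iso_clsK.
rewrite -iso_clsD !iso_mulE -iso_clsD.
by apply/iso_clsP; exact: mod_tensDr.
Qed.
Lemma iso_mul0 : left_zero 0 iso_mul.
Proof.
by move=> x; rewrite -[x]iso_clsK iso_mulE; apply/iso_clsP; exact: mod_tens0.
Qed.
Lemma iso_mul0r : right_zero 0 iso_mul.
Proof.
by move=> x; rewrite -[x]iso_clsK iso_mulE; apply/iso_clsP; exact: mod_tens0r.
Qed.
HB.instance Definition _ := GRing.Nmodule_isPzSemiRing.Build (isoclass H)
  iso_mulA iso_mul1 iso_mul1r iso_mulDl iso_mulDr iso_mul0 iso_mul0r.

Lemma iso_clsM V W : iso_cls (mod_tens V W) = iso_cls V * iso_cls W.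
Proof. exact/esym/iso_mulE. Qed.

End IsoClassMul.

Section Grothendieck.
Variable S : pzSemiRingType.
Implicit Types (p q r : S * S) (a b c u : S).

(* The pair (a, b) stands for the formal difference a - b. *)
Definition groth_rel p q : Prop :=
  exists u, p.1 + q.2 + u = q.1 + p.2 + u.
Definition groth_relb : rel (S * S) := fun p q => `[< groth_rel p q >].

Lemma groth_relb_refl : reflexive groth_relb.
Proof. by move=> p; apply/asboolP; exists 0. Qed.
Lemma groth_relb_sym : symmetric groth_relb.
Proof. by move=> p q; apply/asboolP/asboolP => -[u E]; exists u. Qed.
Lemma groth_relb_trans : transitive groth_relb.
Proof.
move=> q p r /asboolP[u E] /asboolP[v F]; apply/asboolP.
exists (q.1 + q.2 + u + v).
transitivity ((p.1 + q.2 + u) + (q.1 + r.2 + v)).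
  by rewrite !addrA [LHS](ACl (1*4*5*3*2*6)%AC).
by rewrite E F !addrA [LHS](ACl (4*2*1*5*3*6)%AC).
Qed.
Canonical groth_equiv :=
  EquivRel groth_relb groth_relb_refl groth_relb_sym groth_relb_trans.

Definition groth := {eq_quot groth_equiv}.
HB.instance Definition _ := Choice.on groth.

Definition groth_cls p : groth := \pi_{eq_quot groth_equiv} p.

Lemma groth_clsP p q : groth_rel p q <-> groth_cls p = groth_cls q.
Proof.
split=> [pq|/eqmodP/asboolP //].
by apply/eqmodP/asboolP.
Qed.

Lemma groth_clsK (x : groth) : groth_cls (repr x) = x.
Proof. exact: reprK. Qed.

Lemma groth_repr p : groth_rel (repr (groth_cls p)) p.
Proof. by apply/groth_clsP; rewrite groth_clsK. Qed.

Definition gadd p q := (p.1 + q.1, p.2 + q.2).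
Definition gopp p := (p.2, p.1).
Definition gmul p q := (p.1 * q.1 + p.2 * q.2, p.1 * q.2 + p.2 * q.1).

Definition groth_add (x y : groth) := groth_cls (gadd (repr x) (repr y)).
Definition groth_opp (x : groth) := groth_cls (gopp (repr x)).
Definition groth_mul (x y : groth) := groth_cls (gmul (repr x) (repr y)).

Lemma groth_addE p q :
  groth_add (groth_cls p) (groth_cls q) = groth_cls (gadd p q).
Proof.
case: (groth_repr p) (groth_repr q) => u Eu [v Ev].
apply/groth_clsP; exists (u + v) => /=.
move: (repr (groth_cls p)) (repr (groth_cls q)) Eu Ev => p' q' Eu Ev.
transitivity ((p'.1 + p.2 + u) + (q'.1 + q.2 + v)).
  by rewrite !addrA [LHS](ACl (1*3*5*2*4*6)%AC).
by rewrite Eu Ev !addrA [LHS](ACl (1*4*2*5*3*6)%AC).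
Qed.
Lemma groth_oppE p : groth_opp (groth_cls p) = groth_cls (gopp p).
Proof.
case: (groth_repr p) => u Eu; apply/groth_clsP; exists u => /=.
by rewrite (addrC _ p.1) (addrC p.2) -Eu.
Qed.

Lemma gmul_congl p p' q : groth_rel p p' -> groth_rel (gmul p q) (gmul p' q).
Proof.
case=> u E; exists (u * q.1 + u * q.2) => /=.
transitivity ((p.1 + p'.2 + u) * q.1 + (p'.1 + p.2 + u) * q.2).
  by rewrite !mulrDl !addrA [LHS](ACl (1*4*5*3*2*6)%AC).
transitivity ((p'.1 + p.2 + u) * q.1 + (p.1 + p'.2 + u) * q.2).
  by rewrite E.
by rewrite !mulrDl !addrA [LHS](ACl (1*5*4*2*3*6)%AC).
Qed.
Lemma gmul_congr p q q' : groth_rel q q' -> groth_rel (gmul p q) (gmul p q').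
Proof.
case=> u E; exists (p.1 * u + p.2 * u) => /=.
transitivity (p.1 * (q.1 + q'.2 + u) + p.2 * (q'.1 + q.2 + u)).
  by rewrite !mulrDr !addrA [LHS](ACl (1*3*5*4*2*6)%AC).
transitivity (p.1 * (q'.1 + q.2 + u) + p.2 * (q.1 + q'.2 + u)).
  by rewrite E.
by rewrite !mulrDr !addrA [LHS](ACl (1*5*2*4*3*6)%AC).
Qed.
Lemma groth_mulE p q :
  groth_mul (groth_cls p) (groth_cls q) = groth_cls (gmul p q).
Proof.
transitivity (groth_cls (gmul p (repr (groth_cls q)))).
  by apply/groth_clsP/gmul_congl/groth_repr.
by apply/groth_clsP/gmul_congr/groth_repr.
Qed.

Lemma groth_addA : associative groth_add.
Proof.
move=> x y z; rewrite -[x]groth_clsK -[y]groth_clsK -[z]groth_clsK.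
by rewrite !groth_addE /gadd /= !addrA.
Qed.
Lemma groth_addC : commutative groth_add.
Proof.
by move=> x y; congr groth_cls; rewrite /gadd addrC [X in (_, X)]addrC.
Qed.
Lemma groth_add0 : left_id (groth_cls (0, 0)) groth_add.
Proof.
move=> x; rewrite -[x]groth_clsK groth_addE /gadd /= !add0r.
by rewrite -surjective_pairing.
Qed.
Lemma groth_addN : left_inverse (groth_cls (0, 0)) groth_opp groth_add.
Proof.
move=> x; rewrite -[x]groth_clsK groth_oppE groth_addE.
by apply/groth_clsP; exists 0; rewrite /= !addr0 add0r addrC.
Qed.
HB.instance Definition _ :=
  GRing.isZmodule.Build groth groth_addA groth_addC groth_add0 groth_addN.

Lemma groth_mulA : associative groth_mul.
Proof.
move=> x y z; rewrite -[x]groth_clsK -[y]groth_clsK -[z]groth_clsK.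
rewrite !groth_mulE; congr groth_cls; rewrite /gmul /=.
rewrite !mulrDl !mulrDr !mulrA !addrA.
by rewrite [X in (X, _)](ACl (1*4*2*3)%AC) [X in (_, X)](ACl (1*4*2*3)%AC).
Qed.
Lemma groth_mul1 : left_id (groth_cls (1, 0)) groth_mul.
Proof.
move=> x; rewrite -[x]groth_clsK groth_mulE /gmul /=.
by rewrite !mul1r !mul0r !addr0 -surjective_pairing.
Qed.
Lemma groth_mul1r : right_id (groth_cls (1, 0)) groth_mul.
Proof.
move=> x; rewrite -[x]groth_clsK groth_mulE /gmul /=.
by rewrite !mulr1 !mulr0 addr0 add0r -surjective_pairing.
Qed.
Lemma groth_mulDl : left_distributive groth_mul +%R.
Proof.
move=> x y z; rewrite -[x]groth_clsK -[y]groth_clsK -[z]groth_clsK.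
rewrite [X in groth_mul X]groth_addE !groth_mulE [RHS]groth_addE.
congr groth_cls; rewrite /gmul /gadd /= !mulrDl !addrA.
by rewrite [X in (X, _)](ACl (1*3*2*4)%AC) [X in (_, X)](ACl (1*3*2*4)%AC).
Qed.
Lemma groth_mulDr : right_distributive groth_mul +%R.
Proof.
move=> x y z; rewrite -[x]groth_clsK -[y]groth_clsK -[z]groth_clsK.
rewrite [X in groth_mul _ X]groth_addE !groth_mulE [RHS]groth_addE.
congr groth_cls; rewrite /gmul /gadd /= !mulrDr !addrA.
by rewrite [X in (X, _)](ACl (1*3*2*4)%AC) [X in (_, X)](ACl (1*3*2*4)%AC).
Qed.
HB.instance Definition _ := GRing.Zmodule_isPzRing.Build groth
  groth_mulA groth_mul1 groth_mul1r groth_mulDl groth_mulDr.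

Definition groth_in a : groth := groth_cls (a, 0).

Lemma groth_inD a b : groth_in (a + b) = groth_in a + groth_in b.
Proof. by rewrite [RHS]groth_addE /gadd /= addr0. Qed.
Lemma groth_inM a b : groth_in (a * b) = groth_in a * groth_in b.
Proof. by rewrite [RHS]groth_mulE /gmul /= !mulr0 !mul0r !addr0. Qed.
Lemma groth_in1 : groth_in 1 = 1.
Proof. by []. Qed.
Lemma groth_in0 : groth_in 0 = 0.
Proof. by []. Qed.
Lemma groth_clsB p : groth_cls p = groth_in p.1 - groth_in p.2.
Proof.
transitivity (groth_add (groth_in p.1) (groth_opp (groth_in p.2))) => //.
by rewrite groth_oppE groth_addE /gadd /= addr0 add0r -surjective_pairing.
Qed.

End Grothendieck.

Section Green.
Variables (K : fieldType) (H : bialgebra K).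
Implicit Types V W : fdmod H.

Definition green := groth (isoclass H).
HB.instance Definition _ := GRing.PzRing.on green.

Definition green_cls V : green := groth_in (iso_cls V).

Lemma green_cls_iso V W : mod_iso V W -> green_cls V = green_cls W.
Proof. by move=> VW; congr groth_in; apply/iso_clsP. Qed.
Lemma green_clsD V W : green_cls (mod_sum V W) = green_cls V + green_cls W.
Proof. by rewrite /green_cls iso_clsD [LHS]groth_inD. Qed.
Lemma green_clsM V W : green_cls (mod_tens V W) = green_cls V * green_cls W.
Proof. by rewrite /green_cls iso_clsM [LHS]groth_inM. Qed.
Lemma green_cls1 : green_cls (mod_unit H) = 1.
Proof. by []. Qed.

Lemma green_ind (x : green) :
  exists V W, x = green_cls V - green_cls W.
Proof.
exists (repr (repr x).1), (repr (repr x).2).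
by rewrite /green_cls !iso_clsK -[in LHS](groth_clsK x); exact: groth_clsB.
Qed.

(* The additive group of green is the abelian group generated by the classes
   of modules subject to [V (+) W] = [V] + [W]: additive maps out of it are the
   additive isomorphism invariants of modules. Uniqueness is green_ind. *)
Section Universal.
Variables (Z : zmodType) (f : fdmod H -> Z).
Hypothesis f_iso : forall V W, mod_iso V W -> f V = f W.
Hypothesis f_sum : forall V W, f (mod_sum V W) = f V + f W.

Let F (x : isoclass H) : Z := f (repr x).

Local Lemma F_cls V : F (iso_cls V) = f V.
Proof. exact/f_iso/iso_cls_repr. Qed.
Local Lemma F_add x y : F (x + y) = F x + F y.
Proof.
by rewrite -[x]iso_clsK -[y]iso_clsK -iso_clsD !F_cls f_sum.
Qed.

Definition green_lift (x : green) : Z := F (repr x).1 - F (repr x).2.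

Local Lemma green_lift_cls p :
  green_lift (groth_cls p) = F p.1 - F p.2.
Proof.
case: (groth_repr p) => u /(congr1 F); rewrite !F_add => /addIr E.
by apply/eqP; rewrite /green_lift subr_eq addrAC eq_sym subr_eq eq_sym E.
Qed.

Lemma green_lift_zmod : zmod_morphism green_lift.
Proof.
move=> x y; rewrite -[x]groth_clsK -[y]groth_clsK.
transitivity (green_lift (groth_add (groth_cls (repr x))
    (groth_opp (groth_cls (repr y))))) => //.
rewrite groth_oppE groth_addE !green_lift_cls /= !F_add.
by rewrite !opprD opprK !addrA [LHS](ACl (1*3*4*2)%AC).
Qed.
HB.instance Definition _ :=
  GRing.isZmodMorphism.Build green Z green_lift green_lift_zmod.

Lemma green_liftE V : green_lift (green_cls V) = f V.
Proof.
rewrite green_lift_cls /= F_cls (_ : F 0 = 0) ?subr0 //.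
by apply: (addrI (F 0)); rewrite -F_add !addr0.
Qed.
End Universal.

End Green.

Local Open Scope classical_set_scope.

Section Radicals.
Variable R : pzRingType.
Implicit Types I J : set R.

Definition nilpotents : set R := [set x | exists k, x ^+ k = 0].

Definition left_ideal I : Prop :=
  [/\ I 0, forall x y, I x -> I y -> I (x - y) & forall a x, I x -> I (a * x)].

Definition maximal_left_ideal I : Prop :=
  [/\ left_ideal I, I <> setT &
      forall J, left_ideal J -> I `<=` J -> J <> setT -> J = I].

Definition jacobson_radical : set R :=
  [set x | forall I, maximal_left_ideal I -> I x].
End Radicals.
Arguments nilpotents : clear implicits.
Arguments jacobson_radical : clear implicits.

Section AdditiveGroups.
Variable V : zmodType.

Definition add_subgroup (G : set V) : Prop :=
  G 0 /\ forall x y, G x -> G y -> G (x - y).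

Definition add_span (S : set V) : set V :=
  [set x | forall G, add_subgroup G -> S `<=` G -> G x].

Definition is_Zbasis (I : finType) (b : I -> V) (G : set V) : Prop :=
  (forall x, G x <-> exists c : I -> int, x = \sum_i b i *~ c i) /\
  (forall c : I -> int, \sum_i b i *~ c i = 0 -> forall i, c i = 0).
End AdditiveGroups.

Inductive taft_gen := TaftG | TaftH.

Section QBinomial.
Variables (K : fieldType) (q : K).

Fixpoint qbin n k : K :=
  match n, k with
  | _, 0 => 1
  | 0, _.+1 => 0
  | n'.+1, k'.+1 => qbin n' k' + q ^+ k'.+1 * qbin n' k'.+1
  end.
Definition qnum k : K := \sum_(i < k) q ^+ i.

Lemma qbinn0 n : qbin n 0 = 1. Proof. by case: n. Qed.
Lemma qbin_small n k : (n < k)%N -> qbin n k = 0.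
Proof.
elim: n k => [|n IHn] [|k] //= nk; rewrite !IHn ?mulr0 ?addr0 //.
exact: ltnW.
Qed.
Lemma qbinnn n : qbin n n = 1.
Proof. by elim: n => //= n ->; rewrite qbin_small ?mulr0 ?addr0. Qed.

Lemma qnumS k : qnum k.+1 = qnum k + q ^+ k.
Proof. by rewrite /qnum big_ord_recr. Qed.
Lemma qnumSl k : qnum k.+1 = 1 + q * qnum k.
Proof.
rewrite /qnum big_ord_recl expr0 mulr_sumr; congr (1 + _).
by apply: eq_bigr => i _; rewrite exprS.
Qed.

Lemma qbin_absorb n k : qnum k.+1 * qbin n.+1 k.+1 = qnum n.+1 * qbin n k.
Proof.
elim: n k => [|n IHn] k.
  case: k => [|k] /=; last by rewrite !(mulr0, addr0).
  by rewrite !mulr0 addr0.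
have -> : qbin n.+2 k.+1 = qbin n.+1 k + q ^+ k.+1 * qbin n.+1 k.+1 by [].
rewrite mulrDr mulrCA IHn.
case: k => [|k].
  rewrite !qbinn0 !mulr1 expr1 [RHS]qnumSl; congr (_ + _).
  by rewrite /qnum big_ord1.
rewrite [qnum n.+2]qnumSl mulrDl mul1r qnumSl mulrDl mul1r -addrA.
congr (_ + _).
rewrite -mulrA IHn -mulrA.
have -> : qbin n.+1 k.+1 = qbin n k + q ^+ k.+1 * qbin n k.+1 by [].
by rewrite mulrDr mulrDr exprS; congr (_ + _); rewrite -mulrA; congr (q * _); rewrite mulrCA.
Qed.

Lemma qnumE k : (1 - q) * qnum k = 1 - q ^+ k.
Proof. by rewrite -[LHS]opprK -mulNr opprB /qnum -subrX1 opprB. Qed.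

Lemma qbin_prim d k :
  d.-primitive_root q -> (0 < k < d)%N -> qbin d k = 0.
Proof.
move=> qd /andP[k0 kd].
have qk : 1 - q ^+ k != 0.
  by rewrite subr_eq0 eq_sym -(prim_order_dvd qd) gtnNdvd.
have qk0 : qnum k != 0 by apply: contraNneq qk => E; rewrite -qnumE E mulr0.
have q1 : 1 - q != 0.
  by apply: contraNneq qk => E; rewrite -qnumE E mul0r.
have qd0 : qnum d = 0.
  apply/eqP; rewrite -(mulrI_eq0 _ (mulfI q1)) qnumE.
  by rewrite (prim_expr_order qd) subrr.
case: d k k0 kd qk0 qd0 {qd qk} => [|d] [|k] // _ _ qk0 qd0.
apply/eqP; rewrite -(mulrI_eq0 _ (mulfI qk0)) qbin_absorb qd0.
by rewrite mul0r.
Qed.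

Variables (A : pzAlgType K) (a b : A).
Hypothesis abC : a * b = algin q * (b * a).

Lemma qcommX k : a * b ^+ k = algin (q ^+ k) * (b ^+ k * a).
Proof.
elim: k => [|k IHk]; first by rewrite !expr0 rmorph1 mul1r mulr1 mul1r.
rewrite exprSr mulrA IHk -!mulrA abC.
by rewrite [b ^+ k * (_ * _)]mulrA -algin_central !mulrA -rmorphM -exprSr.
Qed.

Lemma qbinomial n :
  (a + b) ^+ n = \sum_(k < n.+1) algin (qbin n k) * (b ^+ k * a ^+ (n - k)).
Proof.
elim: n => [|n IHn].
  by rewrite big_ord1 /= !expr0 !mulr1 rmorph1.
rewrite exprS IHn mulrDl !mulr_sumr.
have -> : \sum_(i < n.+1) a * (algin (qbin n i) * (b ^+ i * a ^+ (n - i))) =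
    \sum_(i < n.+2) algin (q ^+ i * qbin n i) * (b ^+ i * a ^+ (n.+1 - i)).
  rewrite [RHS]big_ord_recr /= qbin_small // mulr0 rmorph0 mul0r addr0.
  apply: eq_bigr => i _; rewrite mulrA -algin_central -mulrA [a * _]mulrA.
  rewrite qcommX -!mulrA -exprS -subSn ?(leq_ord i) // mulrA -rmorphM.
  by rewrite [qbin _ _ * _]mulrC.
have -> : \sum_(i < n.+1) b * (algin (qbin n i) * (b ^+ i * a ^+ (n - i))) =
    \sum_(i < n.+1) algin (qbin n i) * (b ^+ i.+1 * a ^+ (n - i)).
  by apply: eq_bigr => i _; rewrite mulrA -algin_central -mulrA exprS !mulrA.
rewrite [RHS]big_ord_recl [in LHS]big_ord_recl -addrA; congr (_ + _).
  by rewrite !qbinn0 expr0 mulr1.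
rewrite -big_split; apply: eq_bigr => i _ /=.
rewrite /bump /= !add1n subSS -mulrDl; congr (_ * _).
by rewrite -rmorphD addrC.
Qed.

Lemma qbinomial_prim d : d.-primitive_root q -> a ^+ d = 0 -> b ^+ d = 0 ->
  (a + b) ^+ d = 0.
Proof.
move=> qd a0 b0; rewrite qbinomial big1 // => k _.
have [->|k_gt0] := posnP k; first by rewrite subn0 a0 !mulr0.
have [kd|dk] := ltnP k d.
  by rewrite (qbin_prim qd) ?k_gt0 // rmorph0 mul0r.
have -> : k = d :> nat by apply/eqP; rewrite eqn_leq dk leq_ord.
by rewrite b0 mul0r mulr0.
Qed.

End QBinomial.

Section Taft.
Variables (K : fieldType) (n d : nat) (q : K).

Inductive taft_rel : ncpoly K taft_gen -> ncpoly K taft_gen -> Prop :=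
  | TaftGn : taft_rel (NCexp (NCgen TaftG) n) (NCconst 1)
  | TaftHd : taft_rel (NCexp (NCgen TaftH) d) (NCconst 0)
  | TaftHG : taft_rel (NCmul (NCgen TaftH) (NCgen TaftG))
               (NCmul (NCconst q) (NCmul (NCgen TaftG) (NCgen TaftH))).

(* The generalized Taft algebra H_{n,d}(q). *)
Definition taft : pzAlgType K := presalg taft_rel.
Definition taft_g : taft := pres_gen taft_rel TaftG.
Definition taft_h : taft := pres_gen taft_rel TaftH.

Lemma taft_gn : taft_g ^+ n = 1.
Proof. by rewrite -pres_classX; apply: pres_rel; exact: TaftGn. Qed.
Lemma taft_hd : taft_h ^+ d = 0.
Proof. by rewrite -pres_classX; apply: pres_rel; exact: TaftHd. Qed.
Lemma taft_hg : taft_h * taft_g = algin q * (taft_g * taft_h).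
Proof.
by have := pres_rel TaftHG; rewrite !pres_classM.
Qed.

Section Lift.
Variables (A : pzAlgType K) (a b : A).

Definition taft_lift_gen x := match x with TaftG => a | TaftH => b end.

Hypothesis an : a ^+ n = 1.
Hypothesis bd : b ^+ d = 0.
Hypothesis ba : b * a = algin q * (a * b).

Lemma taft_lift_rel s t :
  taft_rel s t -> nceval taft_lift_gen s = nceval taft_lift_gen t.
Proof.
by case; rewrite ?nceval_exp /= ?rmorph1 ?rmorph0 ?an ?bd ?ba.
Qed.

Definition taft_lift : alghom taft A := pres_lift taft_lift_rel.

Lemma taft_lift_g : taft_lift taft_g = a.
Proof. exact: (pres_liftE taft_lift_rel TaftG). Qed.
Lemma taft_lift_h : taft_lift taft_h = b.
Proof. exact: (pres_liftE taft_lift_rel TaftH). Qed.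
End Lift.

Lemma taft_ext (A : pzAlgType K) (f f' : alghom taft A) :
  f taft_g = f' taft_g -> f taft_h = f' taft_h -> f =1 f'.
Proof. by move=> fg fh; apply: pres_ext; case. Qed.

Hypothesis q_prim : d.-primitive_root q.

Let Dg : tensalg taft taft := tens taft_g taft_g.
Let Dh : tensalg taft taft := tens 1 taft_h + tens taft_h taft_g.

Lemma tensM (A B : pzAlgType K) (x x' : A) (y y' : B) :
  tens x y * tens x' y' = tens (x * x') (y * y').
Proof.
rewrite /tens !rmorphM !mulrA; congr (_ * _); rewrite -!mulrA.
by congr (_ * _); rewrite tinlr_comm.
Qed.
Lemma tens1 (A B : pzAlgType K) : tens 1 1 = 1 :> tensalg A B.
Proof. by rewrite /tens !rmorph1 mulr1. Qed.
Lemma tensX (A B : pzAlgType K) (x : A) (y : B) k :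
  tens x y ^+ k = tens (x ^+ k) (y ^+ k).
Proof.
by elim: k => [|k IHk]; rewrite ?tens1 // !exprS IHk tensM.
Qed.
Lemma tens_al (A B : pzAlgType K) (x : A) (y : B) k :
  tens (algin k * x) y = algin k * tens x y.
Proof. by rewrite /tens rmorphM alghomC mulrA. Qed.
Lemma tens_ar (A B : pzAlgType K) (x : A) (y : B) k :
  tens x (algin k * y) = algin k * tens x y.
Proof. by rewrite /tens rmorphM alghomC mulrA -algin_central -mulrA. Qed.

Lemma taft_Dgn : Dg ^+ n = 1.
Proof. by rewrite tensX taft_gn tens1. Qed.
Lemma taft_Dhd : Dh ^+ d = 0.
Proof.
apply: (@qbinomial_prim _ q) => //.
- by rewrite !tensM mul1r mulr1 taft_hg tens_ar.
- by rewrite tensX taft_hd /tens rmorph0 mulr0.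
- by rewrite tensX taft_hd /tens rmorph0 mul0r.
Qed.
Lemma taft_Dhg : Dh * Dg = algin q * (Dg * Dh).
Proof.
rewrite mulrDl mulrDr !tensM mul1r mulr1 taft_hg tens_ar tens_al.
by rewrite mulrDr.
Qed.
Definition taft_comul : alghom taft (tensalg taft taft) :=
  taft_lift taft_Dgn taft_Dhd taft_Dhg.

Lemma taft_eps_g : (1 : K^o) ^+ n = 1. Proof. exact: expr1n. Qed.
Lemma taft_eps_h : (0 : K^o) ^+ d = 0.
Proof. by rewrite expr0n gtn_eqF // (prim_order_gt0 q_prim). Qed.
Lemma taft_eps_hg : (0 : K^o) * 1 = algin q * (1 * 0).
Proof. by rewrite mul0r !mulr0. Qed.
Definition taft_counit : alghom taft K^o :=
  taft_lift taft_eps_g taft_eps_h taft_eps_hg.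

Lemma tensDl (A B : pzAlgType K) (x x' : A) (y : B) :
  tens (x + x') y = tens x y + tens x' y.
Proof. by rewrite /tens rmorphD mulrDl. Qed.
Lemma tensDr (A B : pzAlgType K) (x : A) (y y' : B) :
  tens x (y + y') = tens x y + tens x y'.
Proof. by rewrite /tens rmorphD mulrDr. Qed.
Lemma tensmap_tens (A B A' B' : pzAlgType K) (f : alghom A A')
    (f' : alghom B B') x y : tensmap f f' (tens x y) = tens (f x) (f' y).
Proof. by rewrite rmorphM tensmap_inl tensmap_inr. Qed.
Lemma tens_assoc_tens (A B C : pzAlgType K) (x : A) (y : B) (z : C) :
  tens_assoc A B C (tens (tens x y) z) = tens x (tens y z).
Proof.
by rewrite /tens !rmorphM tens_assoc_ll tens_assoc_lr tens_assoc_r mulrA.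
Qed.
Lemma tens_unitl_tens (A : pzAlgType K) (k : K^o) (x : A) :
  tens_unitl A (tens k x) = @algin K A k * x.
Proof. by rewrite rmorphM tens_unitl_l tens_unitl_r. Qed.
Lemma tens_unitr_tens (A : pzAlgType K) (x : A) (k : K^o) :
  tens_unitr A (tens x k) = x * @algin K A k.
Proof. by rewrite rmorphM tens_unitr_l tens_unitr_r. Qed.

Lemma taft_comul_g : taft_comul taft_g = tens taft_g taft_g.
Proof. exact: taft_lift_g. Qed.
Lemma taft_comul_h : taft_comul taft_h = tens 1 taft_h + tens taft_h taft_g.
Proof. exact: taft_lift_h. Qed.
Lemma taft_counit_g : taft_counit taft_g = 1.
Proof. exact: taft_lift_g. Qed.
Lemma taft_counit_h : taft_counit taft_h = 0.
Proof. exact: taft_lift_h. Qed.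

Lemma taft_comulA x : tens_assoc taft taft taft
    (tensmap taft_comul (idalg taft) (taft_comul x)) =
  tensmap (idalg taft) taft_comul (taft_comul x).
Proof.
pose f := compalg (tens_assoc taft taft taft)
            (compalg (tensmap taft_comul (idalg taft)) taft_comul).
apply: (taft_ext (f := f)
  (f' := compalg (tensmap (idalg taft) taft_comul) taft_comul)).
  change (tens_assoc taft taft taft
      (tensmap taft_comul (idalg taft) (taft_comul taft_g)) =
    tensmap (idalg taft) taft_comul (taft_comul taft_g)).
  rewrite taft_comul_g !tensmap_tens [X in tens X _]taft_comul_g.
  by rewrite tens_assoc_tens [X in _ = tens _ X]taft_comul_g.
change (tens_assoc taft taft taft
    (tensmap taft_comul (idalg taft) (taft_comul taft_h)) =
  tensmap (idalg taft) taft_comul (taft_comul taft_h)).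
rewrite taft_comul_h [in LHS]rmorphD [in RHS]rmorphD !tensmap_tens.
rewrite [X in tens X _]rmorph1 -[X in tens X _ + _]tens1.
rewrite [X in tens X (idalg taft taft_g)]taft_comul_h tensDl !rmorphD.
rewrite !tens_assoc_tens [X in tens (idalg taft 1) X]taft_comul_h.
by rewrite [X in tens (idalg taft taft_h) X]taft_comul_g tensDr !addrA.
Qed.

Lemma taft_counitl x :
  tens_unitl taft (tensmap taft_counit (idalg taft) (taft_comul x)) = x.
Proof.
pose f := compalg (tens_unitl taft)
            (compalg (tensmap taft_counit (idalg taft)) taft_comul).
apply: (taft_ext (f := f) (f' := idalg taft)).
  change (tens_unitl taft
    (tensmap taft_counit (idalg taft) (taft_comul taft_g)) = taft_g).
  rewrite taft_comul_g tensmap_tens tens_unitl_tens.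
  by rewrite [X in algin X]taft_counit_g rmorph1 mul1r.
change (tens_unitl taft
  (tensmap taft_counit (idalg taft) (taft_comul taft_h)) = taft_h).
rewrite taft_comul_h !rmorphD !tensmap_tens !tens_unitl_tens.
rewrite [X in algin X * _ + _]rmorph1 [X in _ + algin X * _]taft_counit_h.
by rewrite rmorph1 mul1r rmorph0 mul0r addr0.
Qed.

Lemma taft_counitr x :
  tens_unitr taft (tensmap (idalg taft) taft_counit (taft_comul x)) = x.
Proof.
pose f := compalg (tens_unitr taft)
            (compalg (tensmap (idalg taft) taft_counit) taft_comul).
apply: (taft_ext (f := f) (f' := idalg taft)).
  change (tens_unitr taft
    (tensmap (idalg taft) taft_counit (taft_comul taft_g)) = taft_g).
  rewrite taft_comul_g tensmap_tens tens_unitr_tens.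
  by rewrite [X in algin X]taft_counit_g rmorph1 mulr1.
change (tens_unitr taft
  (tensmap (idalg taft) taft_counit (taft_comul taft_h)) = taft_h).
rewrite taft_comul_h !rmorphD !tensmap_tens !tens_unitr_tens.
rewrite [X in _ * algin X + _]taft_counit_h [X in _ + _ * algin X]taft_counit_g.
by rewrite rmorph1 mulr1 rmorph0 mulr0 add0r.
Qed.

Definition taft_bialg : bialgebra K :=
  Bialgebra taft_comulA taft_counitl taft_counitr.

Section Indecomposable.
Variables (w : K) (l : nat) (i : 'Z_n).

(* The module M(l, i): column b is the image of the basis vector v_b. *)
Definition taftM_g : 'M[K]_l := \matrix_(a, b) ((w ^+ i * q ^- b) *+ (a == b)).
Definition taftM_h : 'M[K]_l := \matrix_(a, b) (a == b.+1 :> nat)%:R.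

Hypothesis d_dvd_n : (d %| n)%N.
Hypothesis w_prim : n.-primitive_root w.
Hypothesis l_le_d : (l <= d)%N.

Lemma taftM_gn : taftM_g ^+ n = 1.
Proof.
have -> : taftM_g = diag_mx (\row_b (w ^+ i * q ^- b)).
  by apply/matrixP => a b; rewrite !mxE; case: eqP => [->|].
have diagX (D : 'rV[K]_l) k : diag_mx D ^+ k = diag_mx (\row_b D 0 b ^+ k).
  elim: k => [|k IHk]; first by apply/matrixP => a b; rewrite !mxE expr0.
  rewrite exprS IHk [LHS]mulmx_diag; apply/matrixP => a b.
  by rewrite !mxE exprS.
rewrite diagX; apply/matrixP => a b; rewrite !mxE exprMn exprAC.
rewrite (prim_expr_order w_prim) expr1n mul1r exprVn exprAC.
by rewrite (eqP (_ : q ^+ n == 1)) ?expr1n ?invr1 // -(prim_order_dvd q_prim).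
Qed.

Lemma taftM_hd : taftM_h ^+ d = 0.
Proof.
have hX k : taftM_h ^+ k = \matrix_(a, b) (a == b + k :> nat)%N%:R.
  elim: k => [|k IHk].
    by apply/matrixP => a b; rewrite !mxE addn0.
  rewrite exprSr IHk; apply/matrixP => a b; rewrite !mxE.
  have [bl|lb] := ltnP b.+1 l.
    rewrite (bigD1 (Ordinal bl)) //= !mxE /= eqxx mulr1 addSnnS big1 ?addr0 //.
    move=> c cb; rewrite !mxE (_ : nat_of_ord c == b.+1 = false) ?mulr0 //.
    by apply: contraNF cb => /eqP cb; apply/eqP/val_inj.
  rewrite big1 => [|c _]; last first.
    rewrite !mxE (_ : nat_of_ord c == b.+1 = false) ?mulr0 //.
    by apply: ltn_eqF; exact: leq_trans (ltn_ord c) lb.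
  rewrite [_ == _](_ : _ = false) //; apply: ltn_eqF.
  by rewrite -addSnnS; apply: leq_trans (ltn_ord a) (leq_trans lb (leq_addr _ _)).
rewrite hX; apply/matrixP => a b; rewrite !mxE.
rewrite [_ == _](_ : _ = false) //; apply: ltn_eqF.
exact: leq_trans (ltn_ord a) (leq_trans l_le_d (leq_addl _ _)).
Qed.

Lemma taftM_hg : taftM_h * taftM_g = algin q * (taftM_g * taftM_h).
Proof.
have q0 : q != 0.
  by rewrite (prim_root_eq0 q_prim) -lt0n (prim_order_gt0 q_prim).
have -> : algin q * (taftM_g * taftM_h) = q *: (taftM_g *m taftM_h).
  exact: mul_scalar_mx.
apply/matrixP => a b; rewrite !mxE.
rewrite (bigD1 b) //= !mxE eqxx mulr1n big1 ?addr0; last first.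
  by move=> c cb; rewrite !mxE (negPf cb) mulr0n mulr0.
rewrite (bigD1 a) //= !mxE eqxx mulr1n big1 ?addr0; last first.
  by move=> c cb; rewrite !mxE eq_sym (negPf cb) mulr0n mul0r.
case: eqP => [->|]; last by rewrite mul0r !mulr0.
by rewrite mul1r mulr1 exprS invfM mulrCA mulVKf.
Qed.

Definition taftM : fdmod taft_bialg :=
  FdMod (taft_lift taftM_gn taftM_hd taftM_hg).
End Indecomposable.
End Taft.

(* Main.v *)
From HB Require Import structures.
Require Import Defs.
From mathcomp Require Import all_boot all_order all_algebra.
From mathcomp Require Import boolp classical_sets.
From mathcomp Require Import mxtens zify.

Set Implicit Arguments.
Unset Strict Implicit.
Unset Printing Implicit Defensive.

Import Order.TTheory GRing.Theory Num.Theory.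
Local Open Scope classical_set_scope.
Local Open Scope ring_scope.

(** The Green ring is generated by a = [M(1,1)] and x = [M(2,0)], because
    x [M(l,j)] = [M(l+1,j)] + [M(l-1,j-m)] for 0 < l < d, and
    x [M(d,j)] = [M(d,j)] + [M(d,j-m)].  Let <u, v> be the sum of the products
    of the coefficients of u and v at the [M(l,i)] with l < d, plus the sum of
    the products of the dimensions of their weight spaces.  This integral form
    is positive semidefinite, and the multiplications by a and x have as
    adjoints the multiplications by a^-1 and a^m x.  Hence if z is nilpotent
    with adjoint z', then z' z is nilpotent and self-adjoint, so z lies in the
    radical of the form.  The radical consists of the combinations of the
    [M(d,i)] whose weight spaces have virtual dimension 0; since [M(d,j)] u
    only depends on the weight spaces of u, it is an ideal of square zero.

    As the Green ring is free of finite rank over Z, an element u of its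
    Jacobson radical satisfies det(1 - k u) = 1 or -1 for all integers k, so
    that det(1 - X u) is constant, and u is nilpotent. *)

(** * Direct summands of modules *)

Section Splitting.
Variables (K : fieldType) (A : pzAlgType K).

Section Summand.
Variables (v r : nat) (f : alghom A 'M[K]_v).
Variables (R : 'M[K]_(r, v)) (S : 'M[K]_(v, r)).
Hypothesis RS1 : R *m S = 1%:M.
Hypothesis SR_comm : forall x, S *m R *m f x = f x *m (S *m R).

(** The action on the image of the idempotent [S *m R]; it is multiplicative because this idempotent
    commutes with the action. *)
Definition summand_fun (x : A) : 'M[K]_r := R *m f x *m S.

Lemma summand_zmod : zmod_morphism summand_fun.
Proof. by move=> x y; rewrite /summand_fun rmorphB mulmxBr mulmxBl. Qed.
Lemma summand_monoid : monoid_morphism summand_fun.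
Proof.
split=> [|x y]; rewrite /summand_fun; first by rewrite rmorph1 mulmx1 RS1.
rewrite rmorphM /= -[RHS]/(_ *m _) -[f x * f y]/(_ *m _).
have -> : R *m f x *m S *m (R *m f y *m S) = R *m f x *m (S *m R *m f y) *m S.
  by rewrite !mulmxA.
by rewrite SR_comm -!mulmxA RS1 mulmx1.
Qed.
HB.instance Definition _ :=
  GRing.isZmodMorphism.Build A 'M[K]_r summand_fun summand_zmod.
HB.instance Definition _ :=
  GRing.isMonoidMorphism.Build A 'M[K]_r summand_fun summand_monoid.
Lemma summandC k : summand_fun (algin k) = algin k.
Proof.
by rewrite /summand_fun alghomC mul_mx_scalar -scalemxAl RS1 scalemx1.
Qed.
Definition summand_action : alghom A 'M[K]_r :=
  @AlgHom K A 'M[K]_r summand_fun summandC.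
End Summand.

(** In a full rank factorization [E = S R], the factor [S] cancels on the left and [R] on the right
    of [S R S R = S R]. *)
Lemma idempotent_factor (v : nat) (E : 'M[K]_v) : E *m E = E ->
  exists (S : 'M[K]_(v, \rank E)) (R : 'M[K]_(\rank E, v)),
    S *m R = E /\ R *m S = 1%:M.
Proof.
move=> EE; have := mulmx_base E.
have /row_fullP[T] := col_base_full E; have /row_freeP[T'] := row_base_free E.
move: (col_base E) (row_base E) => S R RT TS SR; exists S, R; split=> //.
have : T *m (S *m R *m (S *m R)) *m T' = T *m (S *m R) *m T' by rewrite SR EE.
by rewrite !mulmxA TS !mul1mx -!mulmxA RT mulmx1.
Qed.

(** [Q *m P] is an equivariant idempotent of [V] with image isomorphic to [U], and [W] is the image
    of the complementary idempotent. The equality of dimensions serves a later induction. *)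
Lemma mod_split (U V : fdmod A)
    (P : 'M[K]_(mdim U, mdim V)) (Q : 'M[K]_(mdim V, mdim U)) :
  P *m Q = 1%:M -> (forall x, P *m V x = U x *m P) ->
  (forall x, Q *m U x = V x *m Q) ->
  exists2 W : fdmod A, mod_iso V (mod_sum U W) &
                       mdim V = (mdim U + mdim W)%N.
Proof.
move=> PQ1 PV QU; pose E : 'M[K]_(mdim V) := 1%:M - Q *m P.
have PE : P *m E = 0 by rewrite mulmxBr mulmx1 mulmxA PQ1 mul1mx subrr.
have EQ : E *m Q = 0 by rewrite mulmxBl mul1mx -mulmxA PQ1 mulmx1 subrr.
have EE : E *m E = E by rewrite {1}/E mulmxBl mul1mx -mulmxA PE mulmx0 subr0.
have [S [R [SR RS1]]] := idempotent_factor EE.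
have PS : P *m S = 0 by rewrite -[S]mulmx1 -RS1 !mulmxA -(mulmxA P) SR PE mul0mx.
have RQ : R *m Q = 0 by rewrite -[R]mul1mx -RS1 -!mulmxA (mulmxA S) SR EQ mulmx0.
have Ecomm x : S *m R *m V x = V x *m (S *m R).
  by rewrite SR mulmxBl mul1mx mulmxBr mulmx1 -mulmxA PV mulmxA QU mulmxA.
pose W := FdMod (summand_action RS1 Ecomm).
have inv1 : col_mx P R *m row_mx Q S = 1%:M.
  by rewrite mul_col_row PQ1 PS RQ RS1 -scalar_mx_block.
have inv2 : row_mx Q S *m col_mx P R = 1%:M.
  by rewrite mul_row_col SR /E addrC subrK.
exists W; last first.
  have mxle m' n' (X : 'M[K]_(m', n')) (Y : 'M[K]_(n', m')) :
      X *m Y = 1%:M -> (m' <= n')%N.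
    move=> XY; rewrite -(mxrank1 K m') -XY.
    exact: leq_trans (mxrankM_maxl _ _) (rank_leq_col _).
  by apply/eqP; rewrite eqn_leq (mxle _ _ _ _ inv1) (mxle _ _ _ _ inv2).
exists (col_mx P R), (row_mx Q S); split=> // x.
rewrite mul_col_mx /= /dsum_fun mul_block_col !mul0mx addr0 add0r PV.
congr col_mx; rewrite /summand_fun -[RHS]mulmxA -[RHS]mulmxA -Ecomm.
by rewrite !mulmxA RS1 mul1mx.
Qed.

End Splitting.

(** * The Jacobson radical of a ring free of finite rank over Z *)

Section Jacobson.
Variable R : pzRingType.
Local Open Scope classical_set_scope.

Lemma left_idealD (I : set R) : left_ideal I -> forall x y, I x -> I y -> I (x + y).
Proof.
case=> I0 IB _ x y Ix Iy; rewrite -[y]opprK; apply: (IB) => //.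
by rewrite -sub0r; exact: IB.
Qed.

Lemma maximal_left_ideal_exists (I : set R) : left_ideal I -> ~ I 1 ->
  exists2 M, maximal_left_ideal M & I `<=` M.
Proof.
(* The union with [I] lets the empty chain through: its union is empty and stands for [I] itself. *)
move=> idI I1; pose P (S : set R) := left_ideal (S `|` I) /\ ~ (S `|` I) 1.
have [F FP Ftot|A [[idA A1] Amax]] := @Zorn_bigcup R P.
  split; last by case=> [[S FS S1]|//]; case: (FP _ FS) => _; apply; left.
  have chain x y : (\bigcup_(X in F) X `|` I) x -> (\bigcup_(X in F) X `|` I) y ->
      exists2 S, left_ideal (S `|` I) & [/\ (S `|` I) x, (S `|` I) y &
        S `<=` \bigcup_(X in F) X].
    case=> [[S FS Sx]|Ix] [[T FT Ty]|Iy].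
    - case: (Ftot _ _ FS FT) => [ST|TS].
        exists T; first by case: (FP _ FT).
        by split; [left; exact: ST|left|move=> z Tz; exists T].
      exists S; first by case: (FP _ FS).
      by split; [left|left; exact: TS|move=> z Sz; exists S].
    - exists S; first by case: (FP _ FS).
      by split; [left|right|move=> z Sz; exists S].
    - exists T; first by case: (FP _ FT).
      by split; [right|left|move=> z Tz; exists T].
    - exists set0; first by rewrite set0U.
      by split; [right|right|].
  have sub S z : S `<=` \bigcup_(X in F) X -> (S `|` I) z ->
      (\bigcup_(X in F) X `|` I) z.
    by move=> SF [/SF|]; [left|right].
  split=> [|x y Ux Uy|a x Ux]; first by right; case: idI.
    have [S [_ SB _] [Sx Sy SF]] := chain _ _ Ux Uy.
    by apply: sub SF _; exact: SB.
  have [S [_ _ SM] [Sx _ SF]] := chain _ _ Ux Ux.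
  by apply: sub SF _; exact: SM.
exists (A `|` I); last by move=> z; right.
split=> // [AT|J idJ AIJ JT]; first by apply: A1; rewrite AT.
have J1 : ~ J 1.
  move=> J1; apply: JT; apply/seteqP; split=> // z _.
  by case: idJ => _ _ /(_ z 1 J1); rewrite mulr1.
have JI : J `|` I = J by apply/setUidPl => z Iz; apply: AIJ; right.
have AJ : A `<=` J by move=> z Az; apply: AIJ; left.
apply/seteqP; split=> // z Jz; left.
apply: contrapT => Az; apply: (Amax J); last by split; rewrite JI.
by split=> // /(_ z Jz).
Qed.

Lemma jacobson_mul (a x : R) : jacobson_radical R x -> jacobson_radical R (a * x).
Proof. by move=> Jx I maxI; case: (maxI) => -[_ _ IM] _ _; apply: IM; exact: Jx. Qed.

(** Otherwise the left ideal generated by [1 - x] lies in a maximal left ideal, which also contains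
    [x] and hence 1. *)
Lemma jacobson_left_inverse (x : R) : jacobson_radical R x ->
  exists y, y * (1 - x) = 1.
Proof.
move=> Jx; pose I : set R := [set z | exists y, z = y * (1 - x)].
have idI : left_ideal I.
  split=> [|_ _ [y ->] [z ->]|a _ [y ->]]; first by exists 0; rewrite mul0r.
    by exists (y - z); rewrite mulrBl.
  by exists (a * y); rewrite mulrA.
apply: contrapT => nI.
have [|M maxM IM] := maximal_left_ideal_exists idI.
  by case=> y y1; apply: nI; exists y.
case: (maxM) => idM MT _; apply: MT; apply/seteqP; split=> // z _.
have M1 : M 1.
  rewrite -(subrK x 1); apply: left_idealD => //; last exact: Jx.
  by apply: IM; exists 1; rewrite mul1r.
by case: idM => _ _ /(_ z 1 M1); rewrite mulr1.
Qed.

(** If a maximal left ideal [I] misses [u], then [1 = y + a u] with [y] in [I]. As [(a u)^2 = 0],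
    [1 + a u] is a left inverse of [y], so [I] contains 1. *)
Lemma sq0_ideal_jacobson (N : set R) : (forall a x, N x -> N (a * x)) ->
  (forall x, N x -> x * x = 0) -> N `<=` jacobson_radical R.
Proof.
move=> NM N2 u Nu I [idI IT Imax].
pose J : set R := [set z | exists y a, I y /\ z = y + a * u].
case: (idI) => I0 IB IM.
have idJ : left_ideal J.
  split=> [|_ _ [y [a [Iy ->]]] [z [b [Iz ->]]]|c _ [y [a [Iy ->]]]].
  - by exists 0, 0; split=> //; rewrite mul0r addr0.
  - by exists (y - z), (a - b); split; [exact: IB|rewrite mulrBl opprD addrACA].
  - by exists (c * y), (c * a); split; [exact: IM|rewrite mulrDr mulrA].
have IJ : I `<=` J by move=> y Iy; exists y, 0; rewrite mul0r addr0.
have Ju : J u by exists 0, 1; rewrite mul1r add0r.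
have [JT|JT] := pselect (J = setT); last by rewrite -(Imax J idJ IJ JT).
case: IT; apply/seteqP; split=> // z _.
have : J 1 by rewrite JT.
case=> y [a [Iy y1]].
have I1 : I 1.
  have <- : (1 + a * u) * y = 1.
    have -> : y = 1 - a * u by rewrite y1 addrK.
    by rewrite mulrBr mulr1 mulrDl mul1r (N2 (a * u) (NM _ _ Nu)) addr0 addrK.
  exact: IM.
by rewrite -[z]mulr1; exact: IM.
Qed.
End Jacobson.

Lemma poly_int_eq0 (p : {poly int}) : (forall k : int, p.[k] = 0) -> p = 0.
Proof.
move=> p0; apply/eqP/negP => /negP /max_poly_roots.
move=> /(_ [seq Posz i | i <- iota 0 (size p)]).
rewrite size_map size_iota ltnn => F; apply: notF; apply: F.
  by apply/allP => x _; apply/rootP.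
by rewrite map_inj_uniq ?iota_uniq // => i j [].
Qed.

(* The determinant of 1 - XA takes the values 1 and -1 only, hence is a
   constant unit; then 1 - XA has a polynomial inverse, whose coefficients
   can only be the powers of A. *)
Lemma int_mx_nilpotent N (A : 'M[int]_N) :
  (forall k : int, exists B, B *m (1%:M - k *: A) = 1%:M) ->
  exists k, A ^+ k = 0.
Proof.
move=> unitA; pose C : 'M[{poly int}]_N := 1%:M - 'X *: map_mx polyC A.
have pp : \det C * \det C = 1.
  apply/eqP; rewrite -subr_eq0; apply/eqP/poly_int_eq0 => k.
  rewrite hornerD hornerN hornerM hornerC.
  have -> : (\det C).[k] = \det (1%:M - k *: A).
    rewrite -[LHS]/(horner_eval k (\det C)) -det_map_mx; congr (\det _).
    apply/matrixP => i j; rewrite !mxE /= /horner_eval.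
    rewrite hornerD hornerN hornerM hornerX hornerC.
    by rewrite hornerMn hornerC.
  have [B /(congr1 determinant)] := unitA k; rewrite det_mulmx det1.
  move: (\det (1%:M - k *: A)) (\det B) => c b bc.
  have : absz (b * c) = 1%N by rewrite bc.
  rewrite abszM => /eqP; rewrite muln_eq1 => /andP[_ /eqP c1].
  have [->|->] : c = 1 \/ c = -1 by case: (c) c1 => [[|[]]|[]] // _; [left|right].
    by rewrite mulr1 subrr.
  by rewrite mulrNN mulr1 subrr.
pose B := \det C *: \adj C.
have CB : C *m B = 1%:M by rewrite -scalemxAr mul_mx_adj scale_scalar_mx pp.
have Bk k : map_mx (coefp k) B = A ^+ k.
  elim: k => [|k IHk].
    apply/matrixP => i j; have := CB; rewrite mulmxBl mul1mx -scalemxAl.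
    move/matrixP/(_ i j); rewrite !mxE => /(congr1 (coefp 0)) /=.
    by rewrite coefB coefXM subr0 coefMn coefC eqxx => ->.
  rewrite exprS -IHk; apply/matrixP => i j; have := CB.
  rewrite mulmxBl mul1mx -scalemxAl.
  move/matrixP/(_ i j); rewrite !mxE => /(congr1 (coefp k.+1)) /=.
  rewrite coefB coefXM coefMn coefC mul0rn => /eqP; rewrite subr_eq0 => /eqP ->.
  by rewrite coef_sum; apply: eq_bigr => l _; rewrite !mxE coefCM.
(* An exponent exceeding the degrees of all entries of [B]. *)
exists (\sum_i \sum_j size (B i j))%N; rewrite -Bk; apply/matrixP => i j.
rewrite mxE [RHS]mxE /= nth_default // (bigD1 i) //= (bigD1 j) //= -addnA.
exact: leq_addr.
Qed.

Section DualBasis.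
Variables (R : pzRingType) (T : finType) (b : T -> R).
Variable c : T -> {additive R -> int}.
Hypothesis c_b : forall s t, c s (b t) = (s == t)%:R.
Hypothesis b_c : forall u, u = \sum_t b t *~ c t u.

Let mulop (z : R) : 'M[int]_#|T| :=
  \matrix_(s, t) c (enum_val s) (z * b (enum_val t)).

Let mulopM z v : mulop (z * v) = mulop z *m mulop v.
Proof.
apply/matrixP => s t; rewrite !mxE -mulrA [v * _]b_c mulr_sumr raddf_sum.
rewrite (reindex _ (onW_bij _ (enum_val_bij _))); apply: eq_bigr => k _.
by rewrite !mxE mulrzAr raddfMz mulrzz.
Qed.

(** Every integer multiple of [x] lies in the radical, so each [1 - k x] has a left inverse. Through
    the regular representation [mulop], which is faithful, [int_mx_nilpotent] applies. *)
Lemma jacobson_nilpotent x : jacobson_radical R x -> exists k, x ^+ k = 0.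
Proof.
move=> Jx; have [k|k Ak] := @int_mx_nilpotent _ (mulop x).
  have [y y1] := jacobson_left_inverse (jacobson_mul k%:~R Jx).
  exists (mulop y); transitivity (mulop (y * (1 - k%:~R * x))); last first.
    by rewrite y1; apply/matrixP => s t; rewrite !mxE mul1r c_b (inj_eq enum_val_inj).
  rewrite mulopM; congr (_ *m _); apply/matrixP => s t; rewrite !mxE.
  rewrite mulrBl mul1r raddfB /= c_b (inj_eq enum_val_inj).
  by rewrite -mulrA mulrzl raddfMz mulrzz mulrC.
exists k; have xk j : mulop (x ^+ j) = mulop x ^+ j.
  elim: j => [|j IHj]; last by rewrite !exprS mulopM IHj.
  by apply/matrixP => s t; rewrite !mxE mul1r c_b (inj_eq enum_val_inj).
rewrite -[x ^+ k]mulr1 [1]b_c mulr_sumr big1 // => t _.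
rewrite mulrzAr [_ * b t]b_c big1 ?mul0rz // => s _.
have /matrixP/(_ (enum_rank s) (enum_rank t)) := xk k.
by rewrite Ak !mxE !enum_rankK => ->.
Qed.
End DualBasis.

(** * Kronecker products and finite sums *)

Lemma tensmxZl (K : pzRingType) (a : K) r s p t
    (A : 'M[K]_(r, s)) (B : 'M[K]_(p, t)) :
  (a *: A) *t B = a *: (A *t B).
Proof. by apply/matrixP => i j; rewrite !mxE mulrA. Qed.

Lemma tensmxZr (K : comPzRingType) (a : K) r s p t
    (A : 'M[K]_(r, s)) (B : 'M[K]_(p, t)) :
  A *t (a *: B) = a *: (A *t B).
Proof. by apply/matrixP => i j; rewrite !mxE mulrCA. Qed.

(** The truncated shifts up and down on sequences of length [D] are adjoint; [adjoint_x] rests on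
    this. *)
Lemma sum_shift (D : nat) (F G : nat -> int) :
  \sum_(k < D) (if nat_of_ord k is k'.+1 then F k' else 0) * G k =
  \sum_(k < D) (if (k.+1 < D)%N then F k else 0) * G k.+1.
Proof.
case: D => [|D]; first by rewrite !big_ord0.
rewrite big_ord_recl big_ord_recr /= ltnn !mul0r add0r addr0.
by apply: eq_bigr => k _; rewrite ltnS ltn_ord.
Qed.

Lemma sum_rotate (F : nat -> nat) D : F 0%N = F D ->
  (\sum_(b < D) F b.+1 = \sum_(b < D) F b)%N.
Proof.
case: D => [|D] F0; first by rewrite !big_ord0.
by rewrite big_ord_recr [RHS]big_ord_recl /= -F0 addnC.
Qed.

(** [F r - F 0] telescopes, and the constant [F 0] drops out because the coefficients sum to 0. *)
Lemma abel_summation (V : zmodType) (F : nat -> V) (c : nat -> int) D :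
  \sum_(r < D.+1) c r = 0 ->
  \sum_(r < D.+1) F r *~ c r =
  \sum_(s < D) (F s.+1 - F s) *~ \sum_(r < D.+1 | (s < r)%N) c r.
Proof.
move=> c0; under [RHS]eq_bigr do rewrite mulrz_sumr.
rewrite (exchange_big_dep xpredT) //=.
transitivity (\sum_(r < D.+1) (F r - F 0%N) *~ c r).
  under [RHS]eq_bigr do rewrite mulrzBl.
  by rewrite sumrB -mulrz_sumr c0 subr0.
apply: eq_bigr => r _; rewrite -mulrz_suml; congr (_ *~ _).
rewrite -(big_ord_widen D (fun s => F s.+1 - F s) (leq_ord r)).
by rewrite -(big_mkord xpredT (fun s => F s.+1 - F s)) telescope_sumr.
Qed.

(** * Modules over the generalized Taft algebra *)

Section TaftGreenRing.
Variables (K : fieldType) (n d : nat) (q w : K).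
Hypothesis charK0 : [pchar K] =i pred0.
Hypothesis n_ge2 : (2 <= n)%N.
Hypothesis d_ge2 : (2 <= d)%N.
Hypothesis d_dvd_n : (d %| n)%N.
Hypothesis q_prim : d.-primitive_root q.
Hypothesis w_prim : n.-primitive_root w.
Hypothesis wm_q : w ^+ (n %/ d) = q.

Local Notation m := (n %/ d)%N.
Local Notation H := (taft_bialg n q_prim).
Local Notation R := (green H).
Local Notation M Hl i := (taftM q_prim i d_dvd_n w_prim Hl).
Local Notation g := (taft_g n d q).
Local Notation h := (taft_h n d q).

Lemma q_neq0 : q != 0.
Proof. by rewrite (prim_root_eq0 q_prim) -lt0n (prim_order_gt0 q_prim). Qed.

Lemma mod_gh (V : fdmod H) : V g *m V h = q^-1 *: (V h *m V g).
Proof.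
rewrite -[V h *m V g]/(V h * V g) -rmorphM taft_hg !rmorphM alghomC.
by rewrite -[_ * (_ * _)]/(_ *m _) mul_scalar_mx scalerA mulVf ?q_neq0 // scale1r.
Qed.

Lemma mod_hd (V : fdmod H) : V h ^+ d = 0.
Proof. by rewrite -rmorphXn taft_hd rmorph0. Qed.

Lemma mod_weightX (V : fdmod H) (p : nat) (u : 'M[K]_(mdim V, p)) c k :
  V g *m u = c *: u -> V g *m (V h ^+ k *m u) = (c * q ^- k) *: (V h ^+ k *m u).
Proof.
move=> gu; elim: k => [|k IHk]; first by rewrite expr0 invr1 mulr1 !mul1mx.
rewrite exprS -[_ * _]/(_ *m _) -[V h *m _ *m u]mulmxA mulmxA mod_gh -scalemxAl.
rewrite -mulmxA IHk -scalemxAr scalerA exprS invfM.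
by congr (_ *: _); rewrite mulrCA.
Qed.

(** * Homomorphisms from and to the modules [M(l,i)] *)

(** The linear map from [M(l,i)] to [V] that sends [v_k] to [h^k u]. *)
Definition cyclic_mx (V : fdmod H) (u : 'cV[K]_(mdim V)) l : 'M_(mdim V, l) :=
  \matrix_(r, k) (V h ^+ k *m u) r 0.

Lemma mul_cyclic_mx (V : fdmod H) (u : 'cV[K]_(mdim V)) l p
    (B : 'M_(p, mdim V)) r (k : 'I_l) :
  (B *m cyclic_mx u l) r k = (B *m (V h ^+ k *m u)) r 0.
Proof. by rewrite !mxE; apply: eq_bigr => s _; rewrite mxE. Qed.

Lemma cyclic_intertw (V : fdmod H) (u : 'cV[K]_(mdim V)) l (Hl : (l <= d)%N)
    (i : 'Z_n) :
  V g *m u = w ^+ i *: u -> V h ^+ l *m u = 0 ->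
  forall x, cyclic_mx u l *m M Hl i x = V x *m cyclic_mx u l.
Proof.
move=> gu hu; apply: pres_intertw => -[].
  have -> : M Hl i (pres_gen (taft_rel n d q) TaftG) = taftM_g q w l i.
    exact: taft_lift_g.
  apply/matrixP => r k; rewrite mul_cyclic_mx (mod_weightX _ gu) mxE.
  rewrite (bigD1 k) //= big1 ?addr0 => [|b /negPf bk]; last first.
    by rewrite [X in _ * X]mxE bk mulr0.
  by rewrite [X in _ * X]mxE eqxx [RHS]mxE mulrC [X in _ * X]mxE.
have -> : M Hl i (pres_gen (taft_rel n d q) TaftH) = taftM_h K l.
  exact: taft_lift_h.
apply/matrixP => r k; rewrite mul_cyclic_mx mulmxA -[_ *m _ ^+ _]/(_ * _) -exprS.
rewrite mxE; have [kl|] := ltnP k.+1 l.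
  rewrite (bigD1 (Ordinal kl)) //= big1 ?addr0 => [|b /negPf bk]; last first.
    by rewrite [X in _ * X]mxE -val_eqE /= in bk *; rewrite bk mulr0.
  by rewrite [X in _ * X]mxE eqxx mulr1 mxE.
move=> lk; have -> : k.+1 = l by apply/eqP; rewrite eqn_leq lk ltn_ord.
rewrite hu mxE big1 // => b _; rewrite [X in _ * X]mxE.
by rewrite (ltn_eqF (leq_trans (ltn_ord b) lk)) mulr0.
Qed.

Lemma mod_weightXr (V : fdmod H) (p : nat) (phi : 'M[K]_(p, mdim V)) c k :
  phi *m V g = c *: phi -> phi *m V h ^+ k *m V g = (c * q ^+ k) *: (phi *m V h ^+ k).
Proof.
have hg : V h *m V g = q *: (V g *m V h).
  by rewrite mod_gh scalerA divff ?q_neq0 // scale1r.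
move=> phig; elim: k => [|k IHk]; first by rewrite !expr0 mulr1 mulmx1.
rewrite exprSr -[_ * _]/(_ *m _) (mulmxA phi) -mulmxA hg -scalemxAr (mulmxA _ (V g)).
by rewrite IHk -scalemxAl scalerA exprS mulrCA.
Qed.

(** The map from [V] to [M(l,i)] with last coordinate [phi]; compatibility with [h] forces the
    coordinate at [v_k] to be [phi] composed with [h^(l-1-k)]. *)
Definition cocyclic_mx (V : fdmod H) (phi : 'rV[K]_(mdim V)) l : 'M_(l, mdim V) :=
  \matrix_(k, r) (phi *m V h ^+ (l.-1 - k)) 0 r.

Lemma mul_cocyclic_mx (V : fdmod H) (phi : 'rV[K]_(mdim V)) l p
    (B : 'M_(mdim V, p)) (k : 'I_l) r :
  (cocyclic_mx phi l *m B) k r = (phi *m V h ^+ (l.-1 - k) *m B) 0 r.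
Proof. by rewrite !mxE; apply: eq_bigr => s _; rewrite mxE. Qed.

(** [phi] becomes the coordinate at [v_(l-1)], which explains the weight required of it. *)
Lemma cocyclic_intertw (V : fdmod H) (phi : 'rV[K]_(mdim V)) l
    (Hl : (l <= d)%N) (i : 'Z_n) :
  phi *m V g = (w ^+ i * q ^- l.-1) *: phi -> phi *m V h ^+ l = 0 ->
  forall x, cocyclic_mx phi l *m V x = M Hl i x *m cocyclic_mx phi l.
Proof.
move=> phig phih; apply: pres_intertw => -[].
  have -> : M Hl i (pres_gen (taft_rel n d q) TaftG) = taftM_g q w l i.
    exact: taft_lift_g.
  apply/matrixP => k r; rewrite mul_cocyclic_mx (mod_weightXr _ phig) [RHS]mxE.
  rewrite (bigD1 k) //= big1 ?addr0 => [|b /negPf bk]; last first.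
    by rewrite mxE eq_sym bk mul0r.
  rewrite [taftM_g _ _ _ _ _ _]mxE eqxx [LHS]mxE.
  congr (_ * _); last by rewrite [RHS]mxE.
  rewrite -mulrA; congr (_ * _).
  have kl : (k <= l.-1)%N by rewrite -ltnS (ltn_predK (ltn_ord k)).
  by rewrite -{1}(subnK kl) exprD invfM mulrAC mulVf ?mul1r ?expf_neq0 ?q_neq0.
have -> : M Hl i (pres_gen (taft_rel n d q) TaftH) = taftM_h K l.
  exact: taft_lift_h.
apply/matrixP => k r; rewrite mul_cocyclic_mx -mulmxA -[_ ^+ _ *m _]/(_ * _) -exprSr.
rewrite [RHS]mxE; case: k => [[|k] kl].
  rewrite subn0 (ltn_predK kl) phih mxE big1 // => b _.
  by rewrite [X in X * _]mxE mul0r.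
rewrite (bigD1 (Ordinal (ltnW kl))) //= big1 ?addr0 => [|b bk]; last first.
  rewrite [X in X * _]mxE /= eqSS eq_sym; rewrite -val_eqE /= in bk.
  by rewrite (negPf bk) mul0r.
rewrite [X in _ = X * _]mxE eqxx mul1r [RHS]mxE /=; congr ((phi *m _ ^+ _) 0 r).
by rewrite -subSn ?subSS // -ltnS (ltn_predK kl).
Qed.

(** The entry [(k, j)] is [phi(h^(l-1-k+j) u)]. For [k < j] the power of [h] vanishes; for [k = j]
    this is the normalization of [phi]; for [j < k] the weights of [phi] and of [h^t u] differ,
    since [t < l-1 < d]. *)
Lemma cocyclic_mul_cyclic (V : fdmod H) (u : 'cV[K]_(mdim V))
    (phi : 'rV[K]_(mdim V)) l (Hl : (l <= d)%N) (i : 'Z_n) :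
  V g *m u = w ^+ i *: u -> phi *m V g = (w ^+ i * q ^- l.-1) *: phi ->
  V h ^+ l = 0 -> phi *m V h ^+ l.-1 *m u = 1%:M ->
  cocyclic_mx phi l *m cyclic_mx u l = 1%:M.
Proof.
move=> gu phig hl phiu; apply/matrixP => k j.
rewrite mul_cocyclic_mx mul_cyclic_mx mulmxA -(mulmxA phi).
rewrite -[_ ^+ _ *m _]/(_ * _) -exprD.
have kl : (k <= l.-1)%N by rewrite -ltnS (ltn_predK (ltn_ord k)).
rewrite [RHS]mxE; have [kj|jk|kj] := ltngtP k j.
- have lt : (l <= l.-1 - k + j)%N by move: kj (ltn_ord j); clear; lia.
  by rewrite -(subnK lt) exprD hl mulr0 mulmx0 mul0mx mxE -val_eqE /= ltn_eqF.
- rewrite -val_eqE /= gtn_eqF //.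
  set t := (l.-1 - k + j)%N.
  have tl : (t < l.-1)%N by move: jk kl; rewrite /t; clear; lia.
  (* Both sides compute [phi(g h^t u)], with [g] acting on [phi] or on [h^t u]. *)
  have E : (w ^+ i * q ^- l.-1) *: (phi *m V h ^+ t *m u) =
      (w ^+ i * q ^- t) *: (phi *m V h ^+ t *m u).
    by rewrite -!mulmxA scalemxAl -phig -mulmxA (mod_weightX _ gu) -scalemxAr.
  suff -> : phi *m V h ^+ t *m u = 0 by rewrite mxE.
  apply/eqP; move/eqP: E; rewrite -subr_eq0 -scalerBl scaler_eq0 -mulrBr mulf_eq0.
  rewrite expf_eq0 (prim_root_eq0 w_prim) (gtn_eqF (prim_order_gt0 w_prim)) andbF /=.
  rewrite subr_eq0 (inj_eq invr_inj) (eq_prim_root_expr q_prim).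
  by rewrite !modn_small ?gtn_eqF //; move: tl (ltn_ord k) Hl; clear; lia.
- have {j kj} <- : k = j by exact: val_inj.
  by rewrite subnK // phiu mxE !eqxx.
Qed.

(** * Weights and weight projections *)

Lemma expr_Zn_eq (i j : 'Z_n) : (w ^+ i == w ^+ j) = (i == j).
Proof.
have lt (k : 'Z_n) : (k < n)%N by rewrite -[X in (_ < X)%N](Zp_cast n_ge2).
by rewrite (eq_prim_root_expr w_prim) !modn_small.
Qed.

Lemma expr_Zn_nat k : w ^+ (k%:R : 'Z_n) = w ^+ k.
Proof. by rewrite val_Zp_nat // (prim_expr_mod w_prim). Qed.

Lemma expr_ZnD (i j : 'Z_n) : w ^+ (i + j)%R = w ^+ i * w ^+ j.
Proof. by rewrite -exprD -[RHS]expr_Zn_nat natrD !natr_Zp. Qed.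

(** Since [q = w^m], weights can be recorded by exponents in ['Z_n], and [h] lowers the exponent by
    [m]. *)
Lemma weight_eq (i j : 'Z_n) b :
  (w ^+ j * q ^- b == w ^+ i) = (j == i + (b * m)%:R).
Proof.
rewrite -expr_Zn_eq expr_ZnD expr_Zn_nat mulnC exprM wm_q.
by rewrite -(inj_eq (mulIf (expf_neq0 b (q_neq0)))) mulfVK // expf_neq0 // (q_neq0).
Qed.

Lemma sum_expr_Zn (c : K) : \sum_(i : 'Z_n) c ^+ i = \sum_(i < n) c ^+ i.
Proof. by case: n n_ge2 => [|[|]]. Qed.

Lemma sum_root_of_unity (c : K) : c ^+ n = 1 ->
  \sum_(i < n) c ^+ i = n%:R * (c == 1)%:R.
Proof.
move=> cn; have [->|c1] := eqVneq c 1.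
  by under eq_bigr do rewrite expr1n; rewrite sumr_const card_ord mulr1.
apply/eqP; rewrite mulr0 -(mulrI_eq0 _ (@mulfI _ (c - 1) _)) ?subr_eq0 //.
by rewrite -subrX1 cn subrr.
Qed.

Lemma natn_neq0 : n%:R != 0 :> K.
Proof. by rewrite (iffLR (pcharf0P K)) // -lt0n ltnW. Qed.

(** The idempotent of the group algebra of [g] for the character [g -> w^i]; on a module it projects
    onto the [w^i]-eigenspace of [g]. *)
Definition weight_proj (i : 'Z_n) : taft n d q :=
  algin n%:R^-1 * \sum_(j < n) algin (w ^- (i * j)) * g ^+ j.

Lemma mod_gX (V : fdmod H) p (u : 'M[K]_(mdim V, p)) c k :
  V g *m u = c *: u -> V g ^+ k *m u = c ^+ k *: u.
Proof.
move=> gu; elim: k => [|k IHk]; first by rewrite mul1mx scale1r.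
by rewrite exprS -[_ * _]/(_ *m _) -mulmxA IHk -scalemxAr gu scalerA -exprSr.
Qed.

Lemma weight_projE (V : fdmod H) i :
  V (weight_proj i) = n%:R^-1 *: \sum_(j < n) (w ^- i) ^+ j *: V g ^+ j.
Proof.
rewrite rmorphM alghomC rmorph_sum -[_ * _]/(_ *m _) mul_scalar_mx.
congr (_ *: _); apply: eq_bigr => j _; rewrite rmorphM alghomC rmorphXn.
by rewrite -[_ * _]/(_ *m _) mul_scalar_mx exprM exprVn.
Qed.

Lemma weight_proj_weight (V : fdmod H) p (u : 'M[K]_(mdim V, p)) c i :
  V g *m u = c *: u -> c ^+ n = 1 ->
  V (weight_proj i) *m u = (c == w ^+ i)%:R *: u.
Proof.
move=> gu cn; rewrite weight_projE -scalemxAl mulmx_suml.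
under eq_bigr do rewrite -scalemxAl (mod_gX _ gu) scalerA -exprMn.
rewrite -scaler_suml scalerA sum_root_of_unity; last first.
  by rewrite exprMn cn exprVn exprAC (prim_expr_order w_prim) expr1n invr1 mulr1.
rewrite mulKf ?natn_neq0 //; congr (_%:R *: _); congr nat_of_bool.
have wi : w ^+ i != 0.
  by rewrite expf_neq0 // (prim_root_eq0 w_prim) -lt0n (prim_order_gt0 w_prim).
by rewrite -(inj_eq (mulfI wi)) mulVKf // mulr1.
Qed.

(** For [b = w^-i g] one has [b^n = 1], so [b] fixes the sum of its first [n] powers. *)
Lemma weight_proj_gl (V : fdmod H) i :
  V g *m V (weight_proj i) = w ^+ i *: V (weight_proj i).
Proof.
have wi : w ^+ i != 0.
  by rewrite expf_neq0 // (prim_root_eq0 w_prim) -lt0n (prim_order_gt0 w_prim).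
pose b : 'M[K]_(mdim V) := (w ^- i) *: V g.
have bX k : b ^+ k = (w ^- i) ^+ k *: V g ^+ k.
  elim: k => [|k IHk]; first by rewrite scale1r.
  by rewrite !exprS IHk -[_ * _]/(_ *m _) -scalemxAl -scalemxAr scalerA.
have bn : b ^+ n = 1.
  rewrite bX -rmorphXn taft_gn rmorph1 exprVn exprAC (prim_expr_order w_prim).
  by rewrite expr1n invr1 scale1r.
rewrite weight_projE; under eq_bigr do rewrite -bX.
have /eqP := subrX1 b n; rewrite bn subrr eq_sym mulrBl mul1r subr_eq0 => /eqP.
rewrite -[b * _]/(_ *m _) -[b in b *m _]/(_ *: _) -scalemxAl => bS.
rewrite -scalemxAr scalerA mulrC -scalerA; congr (_ *: _).
by rewrite -{2}bS scalerA divff // scale1r.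
Qed.

Lemma weight_proj_gr (V : fdmod H) i :
  V (weight_proj i) *m V g = w ^+ i *: V (weight_proj i).
Proof.
rewrite -weight_proj_gl !weight_projE -scalemxAl -scalemxAr mulmx_suml mulmx_sumr.
congr (_ *: _); apply: eq_bigr => j _; rewrite -scalemxAl -scalemxAr.
by congr (_ *: _); rewrite -[LHS]/(_ * _) -exprSr exprS.
Qed.

(** Summing over [i] first, orthogonality of characters leaves only the term [j = 0]. *)
Lemma sum_weight_proj (V : fdmod H) : \sum_(i : 'Z_n) V (weight_proj i) = 1%:M.
Proof.
under eq_bigr do rewrite weight_projE.
rewrite -scaler_sumr exchange_big /=.
under eq_bigr => j _.
  rewrite -scaler_suml; under eq_bigr do rewrite -exprVn exprAC.
  rewrite sum_expr_Zn sum_root_of_unity; last first.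
    by rewrite exprAC exprVn (prim_expr_order w_prim) invr1 expr1n.
  over.
have n0 : (0 < n)%N by rewrite ltnW.
rewrite (bigD1 (Ordinal n0)) //= big1 ?addr0.
  by rewrite !expr0 eqxx mulr1 scalerA mulVf ?natn_neq0 // scale1r.
move=> j j0; rewrite exprVn invr_eq1 -(expr0 w) (eq_prim_root_expr w_prim).
by rewrite mod0n modn_small // -val_eqE /= in j0 *; rewrite (negPf j0) mulr0 scale0r.
Qed.

(* If h^(l-1) is nonzero on V and h^l = 0, choose weight vectors u in V and
   phi in the dual with phi(h^(l-1) u) = 1: the submodule generated by u is
   split off by the map sending v to the tuple of the phi(h^k v). *)
Lemma jordan_summand (V : fdmod H) : (0 < mdim V)%N ->
  exists l (Hl : (l <= d)%N) (i : 'Z_n) (W : fdmod H),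
    [/\ (0 < l)%N, mod_iso V (mod_sum (M Hl i) W) & mdim V = (l + mdim W)%N].
Proof.
move=> V0; have exl : exists l, V h ^+ l == 0 by exists d; rewrite mod_hd.
have Hl : (ex_minn exl <= d)%N.
  by case: ex_minnP => l _; apply; rewrite mod_hd.
case: ex_minnP Hl => l /eqP hl lmin Hl.
have l0 : (0 < l)%N.
  case: l hl {lmin Hl} => // /matrixP/(_ (Ordinal V0) (Ordinal V0)) /eqP.
  by rewrite !mxE eqxx oner_eq0.
have {lmin} hl1 : V h ^+ l.-1 != 0.
  by apply/negP => /lmin; rewrite leqNgt ltn_predL l0.
pose e i := V (weight_proj i).
(* The weight projections sum to 1, so some weight block of [h^(l-1)] is nonzero. *)
have [i [i' eie]] : exists i i', e i' *m V h ^+ l.-1 *m e i != 0.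
  apply/not_existsP => ne; case/negP: hl1; apply/eqP.
  rewrite -[LHS]mulmx1 -[LHS]mul1mx -(sum_weight_proj V).
  rewrite mulmx_suml big1 // => i' _; rewrite !mulmx_sumr big1 // => i _.
  by apply/eqP/negPn/negP => ?; case: (ne i); exists i'; rewrite -mulmxA.
have [r [c rc]] : exists r c, (e i' *m V h ^+ l.-1 *m e i) r c != 0.
  apply/not_existsP => ne; case/negP: eie; apply/eqP/matrixP => r c.
  by rewrite [RHS]mxE; apply/eqP/negPn/negP => ?; case: (ne r); exists c.
pose u := col c (e i).
pose phi := ((e i' *m V h ^+ l.-1 *m e i) r c)^-1 *: row r (e i').
have phiu : phi *m V h ^+ l.-1 *m u = 1%:M.
  rewrite -!scalemxAl -!row_mul.
  have -> : e i' *m V h ^+ l.-1 *m u = col c (e i' *m V h ^+ l.-1 *m e i).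
    by rewrite /u !colE mulmxA.
  apply/matrixP => x y; rewrite !ord1 [LHS]mxE [X in _ * X]mxE [X in _ * X]mxE.
  by rewrite mulVf // [RHS]mxE eqxx.
have gu : V g *m u = w ^+ i *: u.
  by rewrite /u colE mulmxA weight_proj_gl // -scalemxAl.
have phig : phi *m V g = w ^+ i' *: phi.
  by rewrite -scalemxAl -row_mul weight_proj_gr // linearZ /= scalerA mulrC -scalerA.
clearbody u phi.
(* Evaluating [phi(g h^(l-1) u)] from both sides ties the weight of [phi] to that of [u]. *)
have wE : w ^+ i' = w ^+ i * q ^- l.-1.
  have : phi *m V g *m V h ^+ l.-1 *m u = w ^+ i' *: 1%:M.
    by rewrite phig -!scalemxAl phiu.
  rewrite -(mulmxA (phi *m V g)) -(mulmxA phi) (mod_weightX _ gu).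
  rewrite -scalemxAr mulmxA phiu => /matrixP/(_ 0 0).
  by rewrite !mxE !mulr1.
rewrite wE in phig.
have phil : phi *m V h ^+ l = 0 by rewrite hl mulmx0.
have hlu : V h ^+ l *m u = 0 by rewrite hl mul0mx.
have [W VW dimW] := @mod_split _ _ (M Hl i) V (cocyclic_mx phi l) (cyclic_mx u l)
  (cocyclic_mul_cyclic Hl gu phig hl phiu)
  (cocyclic_intertw Hl phig phil) (cyclic_intertw Hl gu hlu).
by exists l, Hl, i, W.
Qed.

(** * Generation of the Green ring by the classes of the [M(l,i)] *)

Lemma mod_iso0 (V : fdmod H) : mdim V = 0%N -> mod_iso V (mod_zero H).
Proof.
by case: V => r f /= r0; subst r; exists 0, 0; split=> *; apply/matrixP; case.
Qed.

(** Strong induction on the dimension, splitting off one [M(l,i)] at a time; closure under sums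
    comes from [x + y = x - (0 - y)]. *)
Lemma green_taft_ind (P : green H -> Prop) :
  P 0 -> (forall x y, P x -> P y -> P (x - y)) ->
  (forall l (Hl : (l <= d)%N) i, (0 < l)%N -> P (green_cls (M Hl i))) -> forall x, P x.
Proof.
move=> P0 PB PM x; have [V [W ->]] := green_ind x.
suff PV U : P (green_cls U) by apply: PB.
have [k] := ubnP (mdim U); elim: k U => // k IHk U.
have [U0 _|U0 Uk] := posnP (mdim U).
  by rewrite (green_cls_iso (mod_iso0 U0)).
have [l [Hl [i [X [l0 UX dimU]]]]] := jordan_summand U0.
rewrite (green_cls_iso UX) green_clsD -[green_cls X]opprK -[- green_cls X]sub0r.
apply: (PB); [exact: PM|apply: (PB) => //; apply: IHk].
by rewrite -ltnS (leq_trans _ Uk) // ltnS dimU -[X in (X < _)%N]add0n ltn_add2r.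
Qed.

(** * Ranks of operators on [M(l,i)] *)

(** For [k >= l] this is 0, so that [h] moves [k] to [k.+1] with no exception at the last vector. *)
Definition basis_cv l k : 'cV[K]_l := \col_a (nat_of_ord a == k)%:R.

Lemma delta_basis_cv l (b : 'I_l) : delta_mx b 0 = basis_cv l b.
Proof. by apply/colP => a; rewrite !mxE eqxx andbT. Qed.

Lemma basis_cv_out l k : (l <= k)%N -> basis_cv l k = 0.
Proof.
by move=> lk; apply/colP => a; rewrite !mxE ltn_eqF // (leq_trans (ltn_ord a)).
Qed.

Lemma basis_cv_ext l p (A B : 'M[K]_(p, l)) :
  (forall b : 'I_l, A *m basis_cv l b = B *m basis_cv l b) -> A = B.
Proof.
move=> AB; apply/matrixP => a b; have := AB b.
by rewrite -delta_basis_cv -!colE => /colP/(_ a); rewrite !mxE.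
Qed.

Lemma taftM_g_basis l (Hl : (l <= d)%N) (i : 'Z_n) k :
  M Hl i g *m basis_cv l k = (w ^+ i * q ^- k) *: basis_cv l k.
Proof.
have -> : M Hl i g = taftM_g q w l i by exact: taft_lift_g.
have [kl|lk] := ltnP k l; last by rewrite basis_cv_out // scaler0 mulmx0.
rewrite -(delta_basis_cv (Ordinal kl)); apply/colP => a.
rewrite -colE !mxE andbT /=; case: (eqVneq a (Ordinal kl)) => [_|_] /=.
  by rewrite mulr1n mulr1.
by rewrite mulr0n mulr0.
Qed.

Lemma taftM_h_basis l (Hl : (l <= d)%N) (i : 'Z_n) k :
  M Hl i h *m basis_cv l k = basis_cv l k.+1.
Proof.
have -> : M Hl i h = taftM_h K l by exact: taft_lift_h.
have [kl|lk] := ltnP k l; last by rewrite !basis_cv_out ?mulmx0 // ltnW.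
by rewrite -(delta_basis_cv (Ordinal kl)); apply/colP => a; rewrite -colE !mxE.
Qed.

Lemma taftM_hX_basis l (Hl : (l <= d)%N) (i : 'Z_n) k t :
  M Hl i h ^+ t *m basis_cv l k = basis_cv l (k + t)%N.
Proof.
elim: t => [|t IHt]; first by rewrite mul1mx addn0.
by rewrite exprS -[_ * _]/(_ *m _) -mulmxA IHt taftM_h_basis addnS.
Qed.

Lemma weight_root (i : 'Z_n) b : (w ^+ i * q ^- b) ^+ n = 1.
Proof.
rewrite exprMn exprAC (prim_expr_order w_prim) expr1n mul1r exprVn exprAC.
by rewrite (eqP (_ : q ^+ n == 1)) ?expr1n ?invr1 // -(prim_order_dvd q_prim).
Qed.

Lemma weight_inj (i j : 'Z_n) b b' : (b < d)%N -> (b' < d)%N ->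
  j = i + (b * m)%:R -> j = i + (b' * m)%:R -> b = b'.
Proof.
move=> bd bd' /eqP + /eqP; rewrite -!(weight_eq) => /eqP <-.
have wj : w ^+ j != 0.
  by rewrite expf_neq0 // (prim_root_eq0 w_prim) -lt0n (prim_order_gt0 w_prim).
rewrite (inj_eq (mulfI wj)) (inj_eq invr_inj) (eq_prim_root_expr q_prim).
by rewrite !modn_small // => /eqP.
Qed.

(** On [v_b] the operator gives [v_(b+k)] if [v_b] has weight [w^i], and 0 otherwise. As [l <= d],
    the weights of the [v_b] are distinct, so the matrix is an elementary matrix or 0. *)
Lemma taftM_rank l (Hl : (l <= d)%N) (i j : 'Z_n) k :
  \rank (M Hl j (h ^+ k * weight_proj i)) =
  (\sum_(b < l - k) (j == i + (b * m)%:R)%R)%N.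
Proof.
have E b : M Hl j (h ^+ k * weight_proj i) *m basis_cv l b =
    (j == i + (b * m)%:R)%:R *: basis_cv l (b + k)%N.
  rewrite rmorphM rmorphXn -[_ * _]/(_ *m _) -mulmxA.
  rewrite (weight_proj_weight i (taftM_g_basis Hl j b) (weight_root _ _)).
  by rewrite -(weight_eq) -scalemxAr taftM_hX_basis.
case: (pickP (fun b : 'I_(l - k)%N => j == i + (b * m)%:R)) => [b /eqP jb|nob].
  have bk : (b + k < l)%N by have := ltn_ord b; rewrite ltn_subRL addnC.
  have bl : (b < l)%N by apply: leq_trans bk; rewrite ltnS leq_addr.
  rewrite (bigD1 b) //= (introT eqP jb) big1 ?addn0 => [|b' b'b]; last first.
    apply/eqP; rewrite eqb0; apply: contra_neqN b'b => /eqP jb'.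
    have ld (c : 'I_(l - k)%N) : (c < d)%N.
      by apply: leq_trans (leq_trans (leq_subr k l) Hl).
    exact/val_inj/(weight_inj (ld _) (ld _) jb' jb).
  transitivity (\rank (delta_mx (Ordinal bk) (Ordinal bl) : 'M[K]_l)).
    congr mxrank; apply: (@basis_cv_ext l l) => c; apply: (etrans (E c)).
    have [->|cb] := eqVneq c (Ordinal bl).
      by rewrite -delta_basis_cv mul_delta_mx delta_basis_cv -jb eqxx scale1r.
    rewrite -delta_basis_cv mul_delta_mx_0; last by rewrite eq_sym.
    case: eqP => [jc|_]; last by rewrite scale0r.
    case/eqP: cb; apply/val_inj/(weight_inj _ _ jc jb).
      exact: leq_trans (ltn_ord c) Hl.
    exact: leq_trans bl Hl.
  by rewrite mxrank_delta.
rewrite big1 => [|b _]; last by rewrite nob.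
apply/eqP; rewrite mxrank_eq0; apply/eqP/(@basis_cv_ext l l) => c.
apply: (etrans (E c)); rewrite mul0mx; have [ck|kc] := ltnP (c + k) l; last first.
  by rewrite basis_cv_out // scaler0.
have ckl : (c < l - k)%N by rewrite ltn_subRL addnC.
by have /= -> := nob (Ordinal ckl); rewrite scale0r.
Qed.

Lemma mod_rank_iso (A : pzAlgType K) (V W : fdmod A) x :
  mod_iso V W -> \rank (V x) = \rank (W x).
Proof.
suff le (V1 W1 : fdmod A) : mod_iso V1 W1 -> (\rank (W1 x) <= \rank (V1 x))%N.
  by move=> VW; apply/eqP; rewrite eqn_leq !le //; exact: mod_iso_sym.
case=> P [Q [PQ _ PV]]; rewrite -[W1 x]mulmx1 -PQ mulmxA -PV.
exact: leq_trans (mxrankM_maxl _ _) (mxrankM_maxr _ _).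
Qed.

Definition green_rank (x : H) : green H -> int :=
  green_lift (fun V => Posz (\rank (V x))).

Lemma green_rank_iso x (V W : fdmod H) :
  mod_iso V W -> Posz (\rank (V x)) = Posz (\rank (W x)).
Proof. by move=> VW; rewrite (mod_rank_iso x VW). Qed.
Lemma green_rank_sum x (V W : fdmod H) :
  Posz (\rank (mod_sum V W x)) = Posz (\rank (V x)) + Posz (\rank (W x)).
Proof. by rewrite [mod_sum V W x]/= rank_diag_block_mx PoszD. Qed.

Lemma green_rank_zmod x : zmod_morphism (green_rank x).
Proof. exact: green_lift_zmod (@green_rank_iso x) (green_rank_sum x). Qed.
HB.instance Definition _ x :=
  GRing.isZmodMorphism.Build (green H) int (green_rank x) (green_rank_zmod x).

Lemma green_rankE x V : green_rank x (green_cls V) = \rank (V x).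
Proof. exact: (green_liftE (@green_rank_iso x) (green_rank_sum x)). Qed.

(** * Recognizing modules from generators *)

Lemma mod_iso_square (V W : fdmod H) (P : 'M[K]_(mdim V, mdim W)) :
  mdim V = mdim W -> row_free P -> (forall x, P *m W x = V x *m P) ->
  mod_iso V W.
Proof.
move=> dVW /row_freeP[Q PQ] PV; apply: mod_iso_sym; exists P, Q; split=> //.
case: V W dVW P Q PQ {PV} => r f [s f'] /= rs; subst s => P Q PQ.
exact: mulmx1C.
Qed.

(** Generation is stated dually: only the zero functional kills all [h^k u1] and [h^k u2]. By the
    dimension count, the resulting surjection from the direct sum is an isomorphism. *)
Lemma two_generators (V : fdmod H) (u1 u2 : 'cV[K]_(mdim V)) l1 l2
    (Hl1 : (l1 <= d)%N) (Hl2 : (l2 <= d)%N) (i1 i2 : 'Z_n) :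
  mdim V = (l1 + l2)%N ->
  V g *m u1 = w ^+ i1 *: u1 -> V h ^+ l1 *m u1 = 0 ->
  V g *m u2 = w ^+ i2 *: u2 -> V h ^+ l2 *m u2 = 0 ->
  (forall phi : 'rV_(mdim V),
     (forall k, (k < l1)%N -> phi *m (V h ^+ k *m u1) = 0) ->
     (forall k, (k < l2)%N -> phi *m (V h ^+ k *m u2) = 0) -> phi = 0) ->
  green_cls V = green_cls (M Hl1 i1) + green_cls (M Hl2 i2).
Proof.
move=> dV gu1 hu1 gu2 hu2 gen; rewrite -green_clsD; apply: green_cls_iso.
apply: (@mod_iso_square V (mod_sum (M Hl1 i1) (M Hl2 i2))
         (row_mx (cyclic_mx u1 l1) (cyclic_mx u2 l2))) => //.
  apply: inj_row_free => phi; rewrite mul_mx_row => /eqP.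
  rewrite row_mx_eq0 => /andP[/eqP phi1 /eqP phi2].
  apply: gen => k kl.
    have /matrixP/(_ 0 (Ordinal kl)) := phi1; rewrite mul_cyclic_mx [RHS]mxE => E.
    by apply/matrixP => a b; rewrite !ord1 [RHS]mxE.
  have /matrixP/(_ 0 (Ordinal kl)) := phi2; rewrite mul_cyclic_mx [RHS]mxE => E.
  by apply/matrixP => a b; rewrite !ord1 [RHS]mxE.
move=> x; rewrite /= /dsum_fun mul_row_block !mulmx0 addr0 add0r mul_mx_row.
by congr row_mx; apply: cyclic_intertw.
Qed.

Lemma one_generator (V : fdmod H) (u : 'cV[K]_(mdim V)) l
    (Hl : (l <= d)%N) (i : 'Z_n) :
  mdim V = l -> V g *m u = w ^+ i *: u -> V h ^+ l *m u = 0 ->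
  (forall phi : 'rV_(mdim V),
     (forall k, (k < l)%N -> phi *m (V h ^+ k *m u) = 0) -> phi = 0) ->
  green_cls V = green_cls (M Hl i).
Proof.
move=> dV gu hu gen.
apply: green_cls_iso; apply: (@mod_iso_square V (M Hl i) (cyclic_mx u l)) => //.
  apply: inj_row_free => phi /matrixP phi1; apply: gen => k kl.
  have := phi1 0 (Ordinal kl); rewrite mul_cyclic_mx [RHS]mxE => E.
  by apply/matrixP => a b; rewrite !ord1 [RHS]mxE.
exact: cyclic_intertw.
Qed.

(** * Products in the Green ring *)

(* For l > d this is the class of M(d,i). *)
Definition Mcls l (i : 'Z_n) : green H := green_cls (M (geq_minr l d) i).

Lemma MclsE l (Hl : (l <= d)%N) i : green_cls (M Hl i) = Mcls l i.
Proof.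
rewrite /Mcls; move: (geq_minr l d); rewrite (minn_idPl Hl) => Hl'.
by rewrite (bool_irrelevance Hl Hl').
Qed.

Lemma Mcls0 i : Mcls 0 i = 0.
Proof. by rewrite -(MclsE (leq0n d)) (green_cls_iso (mod_iso0 _)). Qed.

Lemma tens_g (V W : fdmod H) : mod_tens V W g = V g *t W g.
Proof. by rewrite mod_tensE taft_comul_g kron_tens. Qed.
Lemma tens_h (V W : fdmod H) : mod_tens V W h = 1%:M *t W h + V h *t W g.
Proof.
by rewrite mod_tensE taft_comul_h rmorphD !kron_tens [V 1]rmorph1.
Qed.

Definition basis_tens r s a b : 'cV[K]_(r * s) :=
  basis_cv r a *t basis_cv s b.

Lemma basis_tens_outl r s a b : (r <= a)%N -> basis_tens r s a b = 0.
Proof. by move=> ra; rewrite /basis_tens basis_cv_out // tens0mx. Qed.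
Lemma basis_tens_outr r s a b : (s <= b)%N -> basis_tens r s a b = 0.
Proof. by move=> sb; rewrite /basis_tens [X in _ *t X]basis_cv_out // tensmx0. Qed.

Lemma basis_tens_ext r s (phi : 'rV[K]_(r * s)) :
  (forall a b, (a < r)%N -> (b < s)%N -> phi *m basis_tens r s a b = 0) -> phi = 0.
Proof.
move=> phi0; apply/rowP => i; case: (mxtens_indexP i) => a b.
have := phi0 a b (ltn_ord a) (ltn_ord b).
have -> : basis_tens r s a b = delta_mx (mxtens_index (a, b)) 0.
  apply/colP => k; case: (mxtens_indexP k) => a' b'.
  rewrite /basis_tens -!delta_basis_cv.
  transitivity ((delta_mx a 0 *t delta_mx b 0 : 'M[K]_(r * s, 1 * 1))
      (mxtens_index (a', b')) (mxtens_index (0, 0))).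
    by congr (_ _ _); apply/ord_inj.
  by rewrite tensmxE !mxE !index_eq !eqxx !andbT -natrM mulnb.
by rewrite -colE => /colP/(_ 0); rewrite !mxE.
Qed.

Lemma tensmx_basis r s (A : 'M[K]_r) (B : 'M[K]_s) a b :
  (A *t B) *m basis_tens r s a b =
  (A *m basis_cv r a) *t (B *m basis_cv s b) :> 'cV[K]_(r * s).
Proof. exact: (@tensmx_mul _ _ _ _ _ 1 1). Qed.

Section TensBasis.
Variables (l l' : nat) (Hl : (l <= d)%N) (Hl' : (l' <= d)%N) (i j : 'Z_n).
Let V := mod_tens (M Hl i) (M Hl' j).
Local Notation T := (basis_tens l l').

Lemma tens_g_basis a b :
  V g *m T a b = (w ^+ (i + j)%R * q ^- (a + b)%N) *: T a b.
Proof.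
rewrite tens_g [LHS]tensmx_basis !taftM_g_basis tensmxZl tensmxZr scalerA.
by rewrite (expr_ZnD) exprD invfM mulrACA.
Qed.

Lemma tens_h_basis a b :
  V h *m T a b = T a b.+1 + (w ^+ j * q ^- b) *: T a.+1 b.
Proof.
rewrite tens_h mulmxDl; congr (_ + _).
  by rewrite [LHS]tensmx_basis mul1mx taftM_h_basis.
by rewrite [LHS]tensmx_basis taftM_h_basis taftM_g_basis tensmxZr.
Qed.
End TensBasis.

Lemma expr_Zn0 : w ^+ (0%R : 'Z_n) = 1.
Proof. by rewrite expr0. Qed.

(** The tensor of the two vectors [v_0] generates, since powers of [h] act on it through the second
    factor alone. *)
Lemma Mcls1M l i j : (l <= d)%N -> Mcls 1 i * Mcls l j = Mcls l (i + j).
Proof.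
move=> Hl; have d1 : (1 <= d)%N by exact: prim_order_gt0 q_prim.
rewrite -(MclsE d1) -!(MclsE Hl) -green_clsM.
set V := mod_tens _ _.
have hX k : V h ^+ k *m basis_tens 1 l 0 0 = basis_tens 1 l 0 k.
  elim: k => [|k IHk]; first by rewrite mul1mx.
  rewrite exprS -[_ * _]/(_ *m _) -mulmxA IHk tens_h_basis.
  by rewrite [X in _ + _ *: X]basis_tens_outl // scaler0 addr0.
apply: (@one_generator V (basis_tens 1 l 0 0)).
- exact: mul1n.
- by rewrite tens_g_basis invr1 mulr1.
- by rewrite hX basis_tens_outr.
move=> phi phi0; apply: basis_tens_ext => -[|//] b _ bl.
by rewrite -hX; exact: phi0.
Qed.

(** The order of the factors still matters here: commutativity of the Green ring is deduced from
    this rule and the previous one. *)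
Lemma MclsM1 l i j : (l <= d)%N -> Mcls l j * Mcls 1 i = Mcls l (i + j).
Proof.
move=> Hl; have d1 : (1 <= d)%N by exact: prim_order_gt0 q_prim.
rewrite -(MclsE d1) -!(MclsE Hl) -green_clsM.
set V := mod_tens _ _.
have hX k : V h ^+ k *m basis_tens l 1 0 0 = (w ^+ i) ^+ k *: basis_tens l 1 k 0.
  elim: k => [|k IHk]; first by rewrite mul1mx scale1r.
  rewrite exprS -[_ * _]/(_ *m _) -mulmxA IHk -scalemxAr tens_h_basis.
  by rewrite basis_tens_outr // add0r scalerA invr1 mulr1 -exprSr.
apply: (@one_generator V (basis_tens l 1 0 0)).
- exact: muln1.
- by rewrite tens_g_basis invr1 mulr1 addrC.
- by rewrite hX basis_tens_outl // scaler0.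
move=> phi phi0; apply: basis_tens_ext => a [|//] al _.
have := phi0 a al; rewrite hX -scalemxAr => /eqP; rewrite scaler_eq0.
rewrite !expf_eq0 (prim_root_eq0 w_prim) (gtn_eqF (prim_order_gt0 w_prim)) !andbF /=.
by move/eqP.
Qed.

Lemma Mcls10 : Mcls 1 0 = 1.
Proof.
have d1 : (1 <= d)%N by exact: prim_order_gt0 q_prim.
rewrite -(MclsE d1) -green_cls1; apply/esym.
apply: (@one_generator (mod_unit H) 1%:M) => //.
- rewrite expr_Zn0 scale1r; have -> : mod_unit H g = 1%:M.
    by rewrite [LHS](_ : _ = algin (taft_counit n q_prim g)) // taft_counit_g.
  by rewrite mul1mx.
- have -> : mod_unit H h = 0; last by rewrite mul0mx.
  rewrite [LHS](_ : _ = algin (taft_counit n q_prim h)) // taft_counit_h.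
  exact: rmorph0.
- by move=> phi /(_ 0%N isT); rewrite mul1mx mulmx1.
Qed.

Lemma weight_shift (j : 'Z_n) : w ^+ (j - m%:R)%R = w ^+ j * q ^-1.
Proof.
apply/esym/eqP; rewrite -[q]expr1 (weight_eq) mul1n.
by rewrite subrK.
Qed.

(** * The tensor product of [M(2,0)] and [M(l,j)] *)

Section TwoTens.
Variables (l : nat) (Hl : (l <= d)%N) (j : 'Z_n).
Let V := mod_tens (M d_ge2 0) (M Hl j).
Local Notation T := (basis_tens 2 l).

(** The sum of the first [k] weights along [M(l,j)]; it is the coefficient of [T 1 k.-1] in
    [h^k (T 0 0)]. *)
Let c k : K := \sum_(t < k) w ^+ j * q ^- t.

Lemma two_tens_hX1 k : V h ^+ k *m T 1 0 = T 1 k.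
Proof.
elim: k => [|k IHk]; first by rewrite mul1mx.
rewrite exprS -[_ * _]/(_ *m _) -mulmxA IHk tens_h_basis.
by rewrite [X in _ + _ *: X]basis_tens_outl // scaler0 addr0.
Qed.

Lemma two_tens_hX0 k : V h ^+ k *m T 0 0 = T 0 k + c k *: T 1 k.-1.
Proof.
elim: k => [|k IHk]; first by rewrite mul1mx /c big_ord0 scale0r addr0.
rewrite exprS -[_ * _]/(_ *m _) -mulmxA IHk mulmxDr -scalemxAr !tens_h_basis.
rewrite [X in _ *: (_ + _ *: X)]basis_tens_outl // scaler0 addr0 -addrA.
congr (_ + _); rewrite /c big_ord_recr /= scalerDl addrC; congr (_ + _).
(* At [k = 0] the truncated index [k.-1] is harmless because [c 0 = 0]. *)
by case: k {IHk} => [|k] //; rewrite big_ord0 !scale0r.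
Qed.

(** A geometric sum: up to the factor [w^j] it is [q^-l - 1] divided by [q^-1 - 1], and [q] has
    order [d > l]. *)
Lemma two_tens_c0 : (0 < l < d)%N -> c l != 0.
Proof.
case/andP=> l0 ld; rewrite /c -mulr_sumr mulf_neq0 //.
  by rewrite expf_neq0 // (prim_root_eq0 w_prim) -lt0n (prim_order_gt0 w_prim).
apply: contra_eq_neq (subrX1 q^-1 l) => E.
under eq_bigr do rewrite exprVn; rewrite E mulr0 subr_eq0 exprVn invr_eq1.
by rewrite -(prim_order_dvd q_prim) gtnNdvd.
Qed.

Lemma two_tens_gen (phi : 'rV_(2 * l)) :
  (forall k, (k < l)%N -> phi *m T 0 k = 0) ->
  (forall k, (k < l)%N -> phi *m T 1 k = 0) -> phi = 0.
Proof. by move=> phi0 phi1; apply: basis_tens_ext => -[|[|//]] b _; auto. Qed.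

(** [T 0 0] generates a copy of [M(l+1,j)]. A second generator of weight exponent [j - m] completes
    the span because [c l] is nonzero. *)
Lemma two_tens_lt : (0 < l < d)%N ->
  green_cls V = Mcls l.+1 j + Mcls l.-1 (j - m%:R).
Proof.
move=> /[dup] l0d /andP[l0 ld].
have Hl1 : (l.-1 <= d)%N by rewrite (leq_trans (leq_pred l)).
rewrite -(MclsE ld) -(MclsE Hl1).
(* The multiple of T 1 0 is chosen so that h^(l-1) kills u. *)
pose u := T 0 1 + (c 1 - c l) *: T 1 0.
have hu k : V h ^+ k *m u = T 0 k.+1 + (c k.+1 - c l) *: T 1 k.
  have -> : u = V h *m T 0 0 - c l *: T 1 0.
    rewrite -[V h]expr1 two_tens_hX0 /u scalerBl addrA; congr (_ - _).
  rewrite mulmxBr mulmxA -[_ ^+ k *m V h]/(_ * _) -exprSr two_tens_hX0 -scalemxAr.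
  by rewrite two_tens_hX1 scalerBl addrA.
apply: (@two_generators V (T 0 0) u).
- change (2 * l = l.+1 + l.-1)%N; move: l0; clear; lia.
- by rewrite tens_g_basis // add0r invr1 mulr1.
- by rewrite [LHS]two_tens_hX0 !basis_tens_outr // scaler0 addr0.
- rewrite mulmxDr -scalemxAr !tens_g_basis // weight_shift add0r addn0 expr1.
  by rewrite scalerDr !scalerA [(c 1 - c l) * _]mulrC.
- by rewrite [LHS]hu prednK // basis_tens_outr // subrr scale0r addr0.
move=> phi phi1 phi2.
have T1 k : (k < l)%N -> phi *m T 1 k = 0.
  move=> kl; have := phi1 k.+1 kl; rewrite two_tens_hX0 /= => E1.
  (* For [k < l-1] the vector is [h^k u]; for [k = l-1] it is 0. *)
  have E2 : phi *m (T 0 k.+1 + (c k.+1 - c l) *: T 1 k) = 0.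
    have [kl'|lk] := ltnP k l.-1; first by rewrite -hu phi2.
    have -> : k.+1 = l by move: kl lk; clear; lia.
    by rewrite basis_tens_outr // subrr scale0r addr0 mulmx0.
  (* Subtracting [E2] from [E1] isolates [T 1 k] with coefficient [c l]. *)
  have : c l *: (phi *m T 1 k) = 0.
    rewrite scalemxAr -[RHS](subrr (phi *m (T 0 k.+1 + c k.+1 *: T 1 k))).
    rewrite {2}E1 -[in RHS]E2 -mulmxBr; congr (_ *m _).
    by rewrite scalerBl addrA subKr.
  by move/eqP; rewrite scaler_eq0 (negPf (two_tens_c0 l0d)) => /eqP.
apply: two_tens_gen => // k kl.
have := phi1 k (ltnW kl); rewrite two_tens_hX0 mulmxDr -scalemxAr T1 ?scaler0 ?addr0 //.
exact: leq_ltn_trans (leq_pred _) kl.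
Qed.

(** No generator needs adjusting here: [h^d = 0] already bounds the lengths of the submodules
    generated by [T 0 0] and [T 1 0]. *)
Lemma two_tens_d : l = d -> green_cls V = Mcls l j + Mcls l (j - m%:R).
Proof.
move=> l_d; have lh : V h ^+ l = 0 by rewrite l_d mod_hd.
rewrite -!(MclsE Hl).
apply: (@two_generators V (T 0 0) (T 1 0)).
- by change (2 * l = l + l)%N; rewrite mul2n addnn.
- by rewrite tens_g_basis // add0r invr1 mulr1.
- by rewrite lh mul0mx.
- by rewrite tens_g_basis // weight_shift add0r expr1.
- by rewrite lh mul0mx.
move=> phi phi1 phi2.
have T1 k : (k < l)%N -> phi *m T 1 k = 0.
  by move=> kl; rewrite -two_tens_hX1 phi2.
apply: two_tens_gen => // k kl.
have := phi1 k kl; rewrite two_tens_hX0 mulmxDr -scalemxAr T1 ?scaler0 ?addr0 //.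
exact: leq_ltn_trans (leq_pred _) kl.
Qed.
End TwoTens.

Lemma Mcls2M l j : (0 < l < d)%N ->
  Mcls 2 0 * Mcls l j = Mcls l.+1 j + Mcls l.-1 (j - m%:R).
Proof.
move=> /[dup] l0d /andP[_ ld]; rewrite -(MclsE d_ge2).
by rewrite -(MclsE (ltnW ld)) -green_clsM two_tens_lt.
Qed.

Lemma Mcls2Md j : Mcls 2 0 * Mcls d j = Mcls d j + Mcls d (j - m%:R).
Proof.
by rewrite -(MclsE d_ge2) -(MclsE (leqnn d)) -green_clsM two_tens_d // !MclsE.
Qed.

(** * Coefficients in the basis of indecomposable modules *)

Local Notation rk k i := (green_rank (h ^+ k * weight_proj i)).

Lemma rk_Mcls k i l j : (l <= d)%N ->
  rk k i (Mcls l j) = (\sum_(b < l - k) (j == i + (b * m)%:R)%R)%N :> int.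
Proof.
by move=> Hl; rewrite -(MclsE Hl) green_rankE taftM_rank.
Qed.

(* rk k i counts the summands in which some basis vector v_b has weight w^i
   and b + k < l; the formula extracts the number of summands M(k+1,i). *)
Definition green_coef k (i : 'Z_n) (u : R) : int :=
  rk k i u - rk k.+1 i u - (rk k.+1 (i + m%:R) u - rk k.+2 (i + m%:R) u).

Lemma green_coef_zmod k i : zmod_morphism (green_coef k i).
Proof.
move=> u v; rewrite /green_coef !green_rank_zmod.
move: (rk k i u) (rk k i v) (rk k.+1 i u) (rk k.+1 i v) (rk k.+1 _ u)
  (rk k.+1 _ v) (rk k.+2 _ u) (rk k.+2 _ v).
clear; lia.
Qed.
HB.instance Definition _ k i :=
  GRing.isZmodMorphism.Build R int (green_coef k i) (green_coef_zmod k i).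

(** Only the term [b = l-k-1] survives: the difference tests whether [v_(l-k-1)] exists and has
    weight [w^i]. *)
Lemma rk_diff k i l j : (l <= d)%N -> rk k i (Mcls l j) - rk k.+1 i (Mcls l j) =
  ((k < l)%N && (j == i + ((l - k.+1) * m)%:R)).
Proof.
move=> Hl; rewrite !rk_Mcls //; have [kl|lk] := ltnP k l; last first.
  have -> : (l - k)%N = 0%N by apply/eqP; rewrite subn_eq0.
  have -> : (l - k.+1)%N = 0%N by apply/eqP; rewrite subn_eq0 leqW.
  by rewrite !big_ord0.
by rewrite -(subnSK kl) big_ord_recr /= PoszD addrC addKr.
Qed.

(** For [l > k+1] the two differences in [green_coef] test the same condition and cancel; for
    [l = k+1] only the first contributes. *)
Lemma green_coef_Mcls k i l j : (l <= d)%N ->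
  green_coef k i (Mcls l j) = ((l == k.+1) && (i == j)).
Proof.
move=> Hl; rewrite /green_coef !rk_diff // [l == _]eq_sym [i == j]eq_sym.
have [kl|lk|<-] := ltngtP k.+1 l.
- by rewrite /= -addrA -natrD -mulSn subnSK // subrr.
- by [].
- by rewrite subnn mul0n (addr0 i) /=; case: eqP.
Qed.

(** * Induction on generators and commutativity *)

Lemma Mcls_ind (P : R -> Prop) : P 0 -> (forall u v, P u -> P v -> P (u - v)) ->
  (forall l j, (0 < l <= d)%N -> P (Mcls l j)) -> forall u, P u.
Proof.
move=> P0 PB Pcl.
apply: (green_taft_ind P0 PB).
by move=> l Hl i l0; rewrite MclsE; apply: Pcl; rewrite l0.
Qed.

(** The recursion [[M(l+2,j)] = x [M(l+1,j)] - [M(l,j-m)]] reaches all lengths, hence the induction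
    carries two consecutive lengths. *)
Lemma green_ring_ind (P : R -> Prop) : P 1 -> (forall u v, P u -> P v -> P (u - v)) ->
  (forall i u, P u -> P (Mcls 1 i * u)) -> (forall u, P u -> P (Mcls 2 0 * u)) ->
  forall u, P u.
Proof.
move=> P1 PB Pa Px; have P0 : P 0 by rewrite -(subrr 1); exact: PB.
apply: (Mcls_ind P0 PB) => l i /andP[_ Hl].
suff : (l <= d)%N -> (forall j, P (Mcls l j)) /\ ((l < d)%N -> forall j, P (Mcls l.+1 j)).
  by move=> /(_ Hl)[].
elim: l {i Hl} => [_|l IHl ld].
  split=> [j|_ j]; first by rewrite Mcls0.
  by rewrite -[j]addr0 -Mcls1M ?(prim_order_gt0 q_prim) // Mcls10; exact: Pa.
have [Pl Pl1] := IHl (ltnW ld); split=> [j|l1d j]; first exact: Pl1.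
have -> : Mcls l.+2 j = Mcls 2 0 * Mcls l.+1 j - Mcls l (j - m%:R).
  by rewrite Mcls2M ?l1d // addrK.
by apply: (PB) => //; apply: Px; exact: Pl1.
Qed.

Lemma green_central (u : R) : (forall i, u * Mcls 1 i = Mcls 1 i * u) ->
  u * Mcls 2 0 = Mcls 2 0 * u -> forall v, u * v = v * u.
Proof.
move=> ua ux; apply: green_ring_ind => [|v v' uv uv'|i v uv|v uv].
- by rewrite mulr1 mul1r.
- by rewrite mulrBr mulrBl uv uv'.
- by rewrite mulrA ua -!mulrA uv.
- by rewrite mulrA ux -!mulrA uv.
Qed.

(** The generators commute pairwise, so [green_central] makes each of them central; applied once
    more it gives all elements. *)
Lemma green_mulC (u v : R) : u * v = v * u.
Proof.
have d1 := prim_order_gt0 q_prim.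
have aa i j : Mcls 1 i * Mcls 1 j = Mcls 1 j * Mcls 1 i by rewrite !Mcls1M // addrC.
have ax i : Mcls 1 i * Mcls 2 0 = Mcls 2 0 * Mcls 1 i by rewrite Mcls1M // MclsM1.
have xC := green_central (fun i => esym (ax i)) erefl.
by apply: green_central => [i|]; [apply: esym; exact: green_central|rewrite xC].
Qed.

Lemma green_expand (u : R) :
  u = \sum_(p : 'I_d * 'Z_n) Mcls p.1.+1 p.2 *~ green_coef p.1 p.2 u.
Proof.
move: u; apply: Mcls_ind.
- by rewrite big1 // => p _; rewrite raddf0.
- move=> u v {1}-> {1}->; rewrite -sumrB; apply: eq_bigr => p _.
  by rewrite green_coef_zmod [RHS]mulrzBr.
move=> [//|l] i /andP[_ Hl].
rewrite (bigD1 (Ordinal Hl, i)) //= big1 ?addr0; last first.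
  move=> [k j] /=; rewrite green_coef_Mcls // eqSS => /negPf ne.
  suff -> : (l == k) && (j == i) = false by [].
  apply/negP => /andP[/eqP lk /eqP ji]; case/eqP: ne.
  by congr (_, _) => //; exact: val_inj.
by rewrite green_coef_Mcls // !eqxx.
Qed.

Local Notation coef := green_coef.

Lemma coefMa k j i v : coef k j (Mcls 1 i * v) = coef k (j - i) v.
Proof.
move: v; apply: Mcls_ind => [|u v uE vE|l j' /andP[_ Hl]].
- by rewrite mulr0 !raddf0.
- by rewrite mulrBr !green_coef_zmod uE vE.
by rewrite Mcls1M // !green_coef_Mcls // subr_eq [i + _]addrC.
Qed.

Lemma rkMa j i v : rk 0 j (Mcls 1 i * v) = rk 0 (j - i) v.
Proof.
move: v; apply: Mcls_ind => [|u v uE vE|l j' /andP[_ Hl]].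
- by rewrite mulr0 !raddf0.
- by rewrite mulrBr !green_rank_zmod uE vE.
rewrite Mcls1M // !rk_Mcls //; congr Posz; apply: eq_bigr => b _.
by rewrite addrAC [i + _]addrC -[LHS]/(nat_of_bool (_ == _)) eq_sym -subr_eq eq_sym.
Qed.

(** Length [k+1] receives contributions from lengths [k] and [k+2]. The guard excludes length [d],
    since [x [M(d,j)]] involves length [d] only. *)
Lemma coefMx k j v : (k.+1 < d)%N -> coef k j (Mcls 2 0 * v) =
  (if k is k'.+1 then coef k' j v else 0) +
  (if (k.+2 < d)%N then coef k.+1 (j + m%:R) v else 0).
Proof.
move=> kd; move: v; apply: Mcls_ind => [|u v uE vE|l j' /andP[l0 Hl]].
- by rewrite mulr0 raddf0; case: (k) => [|?]; rewrite !raddf0 if_same.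
- rewrite mulrBr green_coef_zmod uE vE opprD addrACA; congr (_ + _).
    by case: (k) => [|?]; rewrite ?green_coef_zmod ?subrr.
  by case: ifP => _; rewrite ?green_coef_zmod ?subrr.
have -> : (if k is k'.+1 then coef k' j (Mcls l j') else 0) =
    (l == k) && (j == j') :> int.
  by case: (k) => [|k']; [rewrite gtn_eqF|rewrite green_coef_Mcls].
have -> : (if (k.+2 < d)%N then coef k.+1 (j + m%:R) (Mcls l j') else 0) =
    [&& (k.+2 < d)%N, l == k.+2 & j + m%:R == j'] :> int.
  by case: ifP => // _; rewrite green_coef_Mcls.
have [ld|dl] := ltnP l d; last first.
  have -> : l = d by apply/eqP; rewrite eqn_leq Hl.
  rewrite Mcls2Md // raddfD /= !green_coef_Mcls //.
  have -> : (d == k.+1) = false by rewrite gtn_eqF.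
  have -> : (d == k) = false by rewrite gtn_eqF // ltnW.
  by rewrite andbA; case: ltnP => //= kd2; rewrite gtn_eqF.
rewrite Mcls2M ?l0 // raddfD /= !green_coef_Mcls //; last first.
  by rewrite (leq_trans (leq_pred l)).
have -> : (l.-1 == k.+1) = (k.+2 < d)%N && (l == k.+2).
  by move: l0 ld; clear; lia.
have -> : (j == j' - m%:R) = (j + m%:R == j') by rewrite eq_sym subr_eq eq_sym.
by rewrite eqSS andbA.
Qed.

(** The weights of [M(2,0)] are 1 and [w^-m], so exponent [j] in the product arises from [j] and
    [j + m]. *)
Lemma rkMx j v : rk 0 j (Mcls 2 0 * v) = rk 0 j v + rk 0 (j + m%:R) v.
Proof.
move: v; apply: Mcls_ind => [|u v uE vE|l j' /andP[l0 Hl]].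
- by rewrite mulr0 !raddf0.
- by rewrite mulrBr !green_rank_zmod uE vE opprD addrACA.
have sh b : (j' - m%:R == j + (b * m)%:R) = (j' == j + (b.+1 * m)%:R).
  by rewrite subr_eq -addrA -natrD addnC -mulSn.
have sh' b : (j' == j + m%:R + (b * m)%:R) = (j' == j + (b.+1 * m)%:R).
  by rewrite -addrA -natrD -mulSn.
have [ld|dl] := ltnP l d; last first.
  have -> : l = d by apply/eqP; rewrite eqn_leq Hl.
  rewrite Mcls2Md // raddfD /= !rk_Mcls //; congr (_ + Posz _).
  by apply: eq_bigr => b _; rewrite sh sh'.
rewrite Mcls2M ?l0 // raddfD /= !rk_Mcls //; last by rewrite (leq_trans (leq_pred l)).
rewrite -!PoszD; congr Posz; rewrite !subn0.
under [in X in (_ + X)%N = _]eq_bigr do rewrite sh.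
under [in X in _ = (_ + X)%N]eq_bigr do rewrite sh'.
rewrite -[in X in _ = (_ + X)%N](prednK l0) [in RHS]big_ord_recr /= big_ord_recr /=.
by rewrite -addnA; congr (_ + _)%N; rewrite addnC prednK.
Qed.

(** * The invariant form and its radical *)

(* A fusion-ring type form on the classes of length < d, corrected by the
   standard form of the representation ring Z[Z_n] of the group algebra of
   <g>; it is positive semidefinite. *)
Definition green_form (u v : R) : int :=
  \sum_(k < d.-1) \sum_(i : 'Z_n) coef k i u * coef k i v +
  \sum_(i : 'Z_n) rk 0 i u * rk 0 i v.

Lemma green_formC u v : green_form u v = green_form v u.
Proof.
congr (_ + _); last by apply: eq_bigr => i _; rewrite mulrC.
by apply: eq_bigr => k _; apply: eq_bigr => i _; rewrite mulrC.
Qed.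

Lemma green_formBl t : zmod_morphism (green_form^~ t).
Proof.
move=> u v; rewrite /green_form opprD addrACA -!sumrB; congr (_ + _).
  apply: eq_bigr => k _; rewrite -sumrB; apply: eq_bigr => i _.
  by rewrite green_coef_zmod mulrBl.
by apply: eq_bigr => i _; rewrite green_rank_zmod mulrBl.
Qed.
Lemma green_formBr t : zmod_morphism (green_form t).
Proof. by move=> u v; rewrite !(green_formC t) green_formBl. Qed.

Definition green_radical (u : R) : Prop :=
  (forall k i, (k < d.-1)%N -> coef k i u = 0) /\ (forall i, rk 0 i u = 0).

Lemma green_form_eq0 u : green_form u u = 0 -> green_radical u.
Proof.
have sq_ge0 (I : finType) (F : I -> int) : 0 <= \sum_i F i * F i.
  by apply: sumr_ge0 => i _; rewrite -expr2 sqr_ge0.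
have sq_eq0 (I : finType) (F : I -> int) : \sum_i F i * F i = 0 -> forall i, F i = 0.
  move=> /eqP; rewrite psumr_eq0 => [/allP F0 i|i _]; last by rewrite -expr2 sqr_ge0.
  by have := F0 i (mem_index_enum i); rewrite /= mulf_eq0 orbb => /eqP.
move/eqP; rewrite paddr_eq0 ?sq_ge0 //; last by apply: sumr_ge0 => k _.
case/andP=> /eqP c0 /eqP /sq_eq0 r0; split=> // k i kd.
move/eqP: c0; rewrite psumr_eq0 => [/allP c0|k' _]; last exact: sq_ge0.
by have /eqP := c0 (Ordinal kd) (mem_index_enum _); move=> /sq_eq0.
Qed.

Lemma green_radical_form u v : green_radical u -> green_form u v = 0.
Proof.
case=> c0 r0; rewrite /green_form !big1 ?addr0 // => [i _|k _].
  by rewrite r0 mul0r.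
by rewrite big1 // => i _; rewrite c0 ?mul0r.
Qed.

Lemma green_radicalB u v : green_radical u -> green_radical v -> green_radical (u - v).
Proof.
by move=> [c0 r0] [c1 r1]; split=> *;
  rewrite ?green_coef_zmod ?green_rank_zmod ?c0 ?c1 ?r0 ?r1 ?subr0.
Qed.

(** * Adjoints of multiplications *)

Definition green_adjoint u u' :=
  forall v t, green_form (u * v) t = green_form v (u' * t).

Lemma adjoint_a i : green_adjoint (Mcls 1 i) (Mcls 1 (- i)).
Proof.
move=> v t; congr (_ + _).
  apply: eq_bigr => k _; rewrite (reindex_inj (addIr i)) /=.
  by apply: eq_bigr => j _; rewrite !coefMa // addrK opprK.
rewrite (reindex_inj (addIr i)) /=.
by apply: eq_bigr => j _; rewrite !rkMa // addrK opprK.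
Qed.

(** [a^m x] is the class of [M(2,m)], the dual of [M(2,0)]. The weight part follows by translating
    the index; in the other part [sum_shift] exchanges raising and lowering of the length. *)
Lemma adjoint_x : green_adjoint (Mcls 2 0) (Mcls 1 m%:R * Mcls 2 0).
Proof.
move=> v t; congr (_ + _); last first.
  rewrite (eq_bigr (fun i =>
      rk 0 i v * rk 0 i t + rk 0 (i + m%:R) v * rk 0 i t)); last first.
    by move=> i _; rewrite rkMx mulrDl.
  rewrite [RHS](eq_bigr (fun i =>
      rk 0 i v * rk 0 (i - m%:R) t + rk 0 i v * rk 0 i t)); last first.
    by move=> i _; rewrite -mulrA rkMa rkMx mulrDr subrK.
  rewrite !big_split /= addrC; congr (_ + _).
  rewrite [RHS](reindex_inj (addIr m%:R)) /=.
  by apply: eq_bigr => i _; rewrite addrK.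
have ltd k : (k < d.-1)%N -> (k.+1 < d)%N by move: d_ge2; clear; lia.
have ltd' k : (k.+2 < d)%N = (k.+1 < d.-1)%N by move: d_ge2; clear; lia.
rewrite ![\sum_(k < d.-1) _]exchange_big /=.
(* Length [k+1] of [u1] is paired with length [k+2] of [u2], both below [d]. *)
pose F (u1 u2 : R) i1 i2 := \sum_(k < d.-1)
  (if (k.+1 < d.-1)%N then coef k i1 u1 else 0) * coef k.+1 i2 u2.
transitivity (\sum_i (F v t i i + F t v i (i + m%:R))).
  apply: eq_bigr => i _; rewrite /F.
  under eq_bigr => k _ do rewrite (coefMx _ _ (ltd _ (ltn_ord k))) mulrDl ltd'.
  rewrite big_split /= (sum_shift _ (fun k => coef k i v) (fun k => coef k i t)).
  congr (_ + _); apply: eq_bigr => k _.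
  by case: ifP; rewrite ?mul0r // mulrC.
transitivity (\sum_i (F t v (i - m%:R) i + F v t i i)); last first.
  apply: eq_bigr => i _; rewrite /F.
  under [RHS]eq_bigr => k _.
    rewrite -mulrA coefMa (coefMx _ _ (ltd _ (ltn_ord k))) subrK mulrC mulrDl.
    rewrite ltd'; over.
  rewrite big_split /=.
  rewrite (sum_shift _ (fun k => coef k (i - m%:R) t) (fun k => coef k i v)).
  congr (_ + _); apply: eq_bigr => k _.
  by case: ifP; rewrite ?mul0r // mulrC.
rewrite !big_split /= addrC; congr (_ + _).
rewrite [RHS](reindex_inj (addIr m%:R)) /=.
by apply: eq_bigr => i _; rewrite addrK.
Qed.

Lemma adjoint_exists u : exists u', green_adjoint u u'.
Proof.
have adjM u1 u2 u1' u2' : green_adjoint u1 u1' -> green_adjoint u2 u2' ->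
    green_adjoint (u1 * u2) (u2' * u1').
  by move=> A1 A2 v t; rewrite -!mulrA A1 A2.
move: u; apply: (green_ring_ind) => // [|u v [u' uu'] [v' vv']|i u [u' uu']|u [u' uu']].
- by exists 1 => v t; rewrite !mul1r.
- exists (u' - v') => s t; rewrite !mulrBl green_formBl green_formBr.
  by rewrite uu' vv'.
- by exists (u' * Mcls 1 (- i)); apply: adjM => //; exact: adjoint_a.
- by exists (u' * (Mcls 1 m%:R * Mcls 2 0)); apply: adjM => //; exact: adjoint_x.
Qed.

(** With [u'] adjoint to [u], [<uv, uv> = <v, u'uv>] vanishes. *)
Lemma green_radicalM u v : green_radical v -> green_radical (u * v).
Proof.
move=> rv; apply: green_form_eq0; have [u' uu'] := adjoint_exists u.
by rewrite uu'; exact: green_radical_form.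
Qed.

Lemma nilpotent_radical z : (exists k, z ^+ k = 0) -> green_radical z.
Proof.
have mulC := green_mulC.
case=> k zk; have [z' zz'] := adjoint_exists z.
pose y := z' * z.
have self v t : green_form (y * v) t = green_form v (y * t).
  rewrite -mulrA green_formC -zz' green_formC.
  by rewrite zz' mulrA.
have yk : y ^+ k = 0 by rewrite exprMn_comm ?zk ?mulr0 //; exact: mulC.
(* Self-adjointness gives [<yv, yv> = <y^2 v, v>], so powers of [y] can be lowered one at a time
   down to [y] itself. *)
have step v : green_radical (y * (y * v)) -> green_radical (y * v).
  by move=> ry; apply: green_form_eq0; rewrite -self; exact: green_radical_form.
have ry : green_radical (y * 1).
  have : green_radical (y ^+ k * (y * 1)).
    by rewrite yk mul0r; split=> *; rewrite !raddf0.
  elim: k {zk yk} => [|k IHk]; first by rewrite mul1r.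
  case: k IHk => [|k] IHk; first by rewrite expr1 => /step.
  by rewrite exprS -mulrA exprS -mulrA => /step; rewrite mulrA -exprS; exact: IHk.
rewrite -[z]mulr1; apply: green_form_eq0; rewrite zz' mulrA green_formC.
exact: green_radical_form.
Qed.

(** Checked on the generators: on the classes [[M(d,j)]], [a] translates the index and [x] replaces
    [j] by [j] and [j - m], exactly as they do with weights. *)
Lemma radical_projective_mul u j :
  Mcls d j * u = \sum_(i : 'Z_n) Mcls d (j + i) *~ rk 0 i u.
Proof.
have mulC := green_mulC.
move: u j; apply: (green_ring_ind) => // [|u v uE vE|i u uE|u uE] j.
- have r1 i : rk 0 i 1 = (i == 0).
    rewrite -Mcls10 rk_Mcls; last exact: prim_order_gt0 q_prim.
    by rewrite big_ord1 mul0n addr0 eq_sym.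
  rewrite mulr1 (bigD1 0) //= r1 eqxx addr0 big1 ?addr0 // => i /negPf i0.
  by rewrite r1 i0.
- rewrite mulrBr uE vE -sumrB; apply: eq_bigr => i _.
  by rewrite green_rank_zmod [RHS]mulrzBr.
- rewrite mulrA MclsM1 // uE [RHS](reindex_inj (addIr i)).
  apply: eq_bigr => i' _; rewrite (rkMa (i' + i) i u) addrK.
  by rewrite [i + j]addrC -addrA [i + i']addrC.
rewrite mulrA [Mcls d j * _]mulC Mcls2Md // mulrDl !uE.
rewrite [RHS](eq_bigr (fun i => Mcls d (j + i) *~ rk 0 i u +
  Mcls d (j + i) *~ rk 0 (i + m%:R) u)); last by move=> i _; rewrite rkMx mulrzDr.
rewrite big_split /=; congr (_ + _).
rewrite (reindex_inj (addIr m%:R)) /=; apply: eq_bigr => i _.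
by rewrite addrA addrAC subrK.
Qed.

Lemma radical_expand u : green_radical u ->
  u = \sum_(i : 'Z_n) Mcls d i *~ coef d.-1 i u.
Proof.
case=> c0 _; rewrite {1}[u](green_expand).
rewrite -(pair_bigA _ (fun (k : 'I_d) (i : 'Z_n) => Mcls k.+1 i *~ coef k i u)) /=.
have dd : (d.-1 < d)%N by rewrite ltn_predL; exact: prim_order_gt0 q_prim.
rewrite (bigD1 (Ordinal dd)) //= [X in _ + X]big1 ?addr0 => [|k kd].
  by rewrite prednK //; exact: prim_order_gt0 q_prim.
rewrite big1 // => i _; rewrite c0 // ltn_neqAle -ltnS prednK ?ltn_ord ?andbT //.
exact: prim_order_gt0 q_prim.
Qed.

Lemma radical_sq0 u : green_radical u -> u * u = 0.
Proof.
move=> ru; rewrite {1}(radical_expand ru) mulr_suml big1 // => i _.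
rewrite mulrzAl radical_projective_mul big1 ?mul0rz // => j _.
by case: ru => _ ->.
Qed.

Local Notation rad := green_radical.

(** * The integral basis of the radical of the form *)

Lemma m_gt0 : (0 < m)%N.
Proof. by rewrite divn_gt0 ?(prim_order_gt0 q_prim) // dvdn_leq // ltnW. Qed.

Lemma lt_index (s t : nat) : (s < d)%N -> (t < m)%N -> (s * m + t < n)%N.
Proof.
move=> sd tm; have nE : n = (d * m)%N by rewrite mulnC divnK.
rewrite [X in (_ < X)%N]nE; apply: (@leq_trans (s.+1 * m)).
  by rewrite mulSn addnC ltn_add2r.
by rewrite leq_mul2r sd orbT.
Qed.

Lemma index_Zn (s t s' t' : nat) : (s < d)%N -> (t < m)%N -> (s' < d)%N -> (t' < m)%N ->
  ((s * m + t)%:R == (s' * m + t')%:R :> 'Z_n) = (s == s') && (t == t').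
Proof.
move=> sd tm sd' tm'; apply/eqP/andP => [|[/eqP-> /eqP->]] //.
move=> /(congr1 (@nat_of_ord _)); rewrite !val_Zp_nat // !modn_small ?lt_index // => E.
have ss : s = s'.
  have := congr1 (divn^~ m) E; rewrite /= !divnMDl ?m_gt0 //.
  by rewrite (divn_small tm) (divn_small tm') !addn0.
by move: E; rewrite ss => /addnI ->; rewrite !eqxx.
Qed.

(** By division by [m], each element of ['Z_n] is [s m + t] for unique [s < d] and [t < m]. *)
Lemma sum_Zn (V : zmodType) (F : 'Z_n -> V) :
  \sum_i F i = \sum_(t < m) \sum_(s < d) F (s * m + t)%:R.
Proof.
pose f (p : 'I_m * 'I_d) : 'Z_n := (p.2 * m + p.1)%:R.
have f_inj : injective f.
  move=> [t s] [t' s'] /eqP; rewrite index_Zn //= => /andP[/eqP ss /eqP tt].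
  by congr (_, _); exact: val_inj.
rewrite (reindex f); last first.
  apply/onW_bij/inj_card_bij => //.
  by rewrite card_prod !card_ord (Zp_cast n_ge2) divnK.
by rewrite (pair_bigA _ (fun (t : 'I_m) (s : 'I_d) => F (s * m + t)%:R)).
Qed.

(** The tail sums that Abel summation attaches to consecutive differences; they are the coordinates
    dual to [radical_basis]. *)
Definition basis_coef (p : 'I_d.-1 * 'I_m) (u : R) : int :=
  \sum_(r < d | (p.1 < r)%N) coef d.-1 (r * m + p.2)%:R u.

Lemma basis_coef_zmod p : zmod_morphism (basis_coef p).
Proof.
by move=> u v; rewrite -sumrB; apply: eq_bigr => r _; exact: green_coef_zmod.
Qed.
HB.instance Definition _ p :=
  GRing.isZmodMorphism.Build R int (basis_coef p) (basis_coef_zmod p).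

Definition radical_basis (p : 'I_d.-1 * 'I_m) : R :=
  Mcls d (p.1.+1 * m + p.2)%:R - Mcls d (p.1 * m + p.2)%:R.

Lemma basis_coef_basis p p' : basis_coef p (radical_basis p') = (p == p').
Proof.
have d0 := prim_order_gt0 q_prim.
have E (a : nat) : (a < d)%N -> basis_coef p (Mcls d (a * m + p'.2)%:R) =
    ((p.1 < a)%N && (p.2 == p'.2)).
  move=> ad; rewrite /basis_coef.
  under eq_bigr => r _.
    rewrite green_coef_Mcls // prednK // eqxx /= index_Zn //.
    over.
  have [pa|ap] := ltnP p.1 a.
    rewrite (bigD1 (Ordinal ad)) //= eqxx /= big1 ?addr0 // => r /andP[_ ra].
    by rewrite -val_eqE /= in ra; rewrite (negPf ra).
  rewrite big1 // => r pr; rewrite gtn_eqF //; exact: leq_ltn_trans ap pr.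
have lt (s : 'I_d.-1) : (s.+1 < d)%N by rewrite -ltn_predRL.
rewrite /radical_basis basis_coef_zmod !E ?(ltnW (lt _)) //.
rewrite -[p == p']/((p.1 == p'.1) && (p.2 == p'.2)) ltnS.
have -> : (p.1 == p'.1) = (nat_of_ord p.1 == p'.1) by [].
case: (p.2 == p'.2); rewrite ?andbF ?andbT //.
by case: ltngtP.
Qed.

(** For each residue [t] modulo [m], the coefficients of the [[M(d,sm+t)]] add up to the virtual
    dimension of the weight space of exponent [t], which is 0 on the radical; then Abel summation
    applies. *)
Lemma radical_basis_expand u : rad u ->
  u = \sum_p radical_basis p *~ basis_coef p u.
Proof.
move=> ru; have uE := radical_expand ru.
rewrite {1}uE sum_Zn.
rewrite -(pair_bigA _ (fun (s : 'I_d.-1) (t : 'I_m) =>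
  radical_basis (s, t) *~ basis_coef (s, t) u)) exchange_big /=.
apply: eq_bigr => t _.
pose F s := Mcls d (s * m + t)%:R; pose c s := coef d.-1 (s * m + t)%:R u.
have := @abel_summation _ F c d.-1; rewrite prednK ?(prim_order_gt0 q_prim) //; apply.
have [_ /(_ (t%:R : 'Z_n))] := ru; rewrite {1}uE raddf_sum.
move=> r0; rewrite -[RHS]r0.
rewrite [RHS](eq_bigr (fun i : 'Z_n => \sum_(b < d)
    (if i == t%:R + (b * m)%:R then coef d.-1 i u else 0))); last first.
  move=> i _; rewrite raddfMz /= rk_Mcls // subn0 (big_morph Posz PoszD erefl).
  rewrite mulrz_suml; apply: eq_bigr => b _; rewrite mulrzz.
  by case: eqP => _; rewrite ?mul1r ?mul0r.
rewrite exchange_big /=; apply: eq_bigr => b _.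
rewrite (bigD1 (t%:R + (b * m)%:R)) //= eqxx big1 ?addr0 => [|i /negPf ->//].
by rewrite /c addnC natrD.
Qed.

(** Adding [m] to the index rotates the [d] weights of [M(d,i)] cyclically, because [d m = n] is 0
    in ['Z_n]. *)
Lemma rk_mod_m l (i j : 'Z_n) : i = j %[mod m] -> rk 0 l (Mcls d i) = rk 0 l (Mcls d j).
Proof.
have d0 := prim_order_gt0 q_prim.
have shift i' : rk 0 l (Mcls d (i' + m%:R)) = rk 0 l (Mcls d i').
  rewrite !rk_Mcls // subn0; congr Posz.
  rewrite -(sum_rotate (F := fun b => (i' + m%:R == l + (b * m)%:R)%R : nat)).
    by apply: eq_bigr => b _; rewrite mulSnr natrD addrA (inj_eq (addIr _)).
  by rewrite mul0n mulnC divnK // pchar_Zp.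
have shifts i' k : rk 0 l (Mcls d (i' + (k * m)%:R)) = rk 0 l (Mcls d i').
  elim: k => [|k IHk]; first by rewrite addr0.
  by rewrite mulSn addnC natrD addrA shift.
move=> ij; rewrite -[i]natr_Zp -[j]natr_Zp (divn_eq i m) (divn_eq j m).
by rewrite !(addnC (_ * m)%N) !natrD !shifts ij.
Qed.

Lemma radical_generator (i j : 'Z_n) : i = j %[mod m] -> rad (Mcls d i - Mcls d j).
Proof.
move=> ij; split=> [k l kd|l]; last first.
  by rewrite green_rank_zmod (rk_mod_m l ij) subrr.
by rewrite green_coef_zmod !green_coef_Mcls // gtn_eqF // -ltn_predRL.
Qed.

Lemma radical_basis_mod (p : 'I_d.-1 * 'I_m) :
  ((p.1.+1 * m + p.2)%:R : 'Z_n)%R = ((p.1 * m + p.2)%:R : 'Z_n)%R %[mod m].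
Proof.
have pd : (p.1.+1 < d)%N by rewrite -ltn_predRL.
rewrite !val_Zp_nat // (modn_small (lt_index _ _)) //.
rewrite (modn_small (lt_index _ _)) ?(ltnW pd) //.
by rewrite !modnMDl.
Qed.

Lemma radical_comb (c : 'I_d.-1 * 'I_m -> int) :
  rad (\sum_p radical_basis p *~ c p).
Proof.
have rb p : rad (radical_basis p).
  by apply: radical_generator; exact: radical_basis_mod.
split=> [k i kd|i]; rewrite raddf_sum big1 // => p _; rewrite raddfMz /=.
  by case: (rb p) => -> // _; rewrite mul0rz.
by case: (rb p) => _ ->; rewrite mul0rz.
Qed.

End TaftGreenRing.

(** * Nilpotent elements and the Jacobson radical *)

Theorem theorem5p2 (K : closedFieldType) (charK0 : [pchar K] =i pred0)
    (n d : nat) (n_ge2 : (2 <= n)%N) (d_ge2 : (2 <= d)%N)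
    (d_dvd_n : (d %| n)%N) (q w : K) (q_prim : d.-primitive_root q)
    (w_prim : n.-primitive_root w) (wm_q : w ^+ (n %/ d) = q) :
  let m := (n %/ d)%N in
  let r : pzRingType := green (taft_bialg n q_prim) in
  let Md (i : 'Z_n) : r :=
    green_cls (taftM q_prim i d_dvd_n w_prim (leqnn d)) in
  nilpotents r =
    add_span [set x | exists i j : 'Z_n, i = j %[mod m] /\ x = Md i - Md j]
  /\
  is_Zbasis
    (fun p : 'I_d.-1 * 'I_m =>
       Md (p.1.+1 * m + p.2)%:R - Md (p.1 * m + p.2)%:R)
    (jacobson_radical r).
Proof.
move=> m r Md.
have MdE i : Md i = Mcls d_dvd_n q_prim w_prim d i by exact: MclsE.
pose rad := @green_radical K n d q w q_prim.
have rad_nil x : rad x -> nilpotents r x.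
  move=> rx; exists 2%N; rewrite expr2.
  exact: (radical_sq0 charK0 n_ge2 d_ge2 d_dvd_n w_prim wm_q).
have nil_rad x : nilpotents r x -> rad x.
  exact: (nilpotent_radical charK0 n_ge2 d_ge2 d_dvd_n w_prim wm_q).
pose b (p : 'I_d.-1 * 'I_m) : r :=
  Md (p.1.+1 * m + p.2)%:R - Md (p.1 * m + p.2)%:R.
have bE p : b p = radical_basis d_dvd_n q_prim w_prim p by rewrite /b !MdE.
have rad_comb x : rad x -> x = \sum_p b p *~ basis_coef w p x.
  move=> rx; rewrite [LHS](radical_basis_expand charK0 n_ge2 d_dvd_n w_prim wm_q rx).
  by apply: eq_bigr => p _; rewrite bE.
have comb_rad (c : 'I_d.-1 * 'I_m -> int) : rad (\sum_p b p *~ c p).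
  rewrite (eq_bigr (fun p => radical_basis d_dvd_n q_prim w_prim p *~ c p)).
    exact: (radical_comb charK0 n_ge2 d_dvd_n q_prim w_prim wm_q).
  by move=> p _; rewrite bE.
split.
  apply/seteqP; split=> x.
    (* A nilpotent is an integral combination of the [b p], which are among the generators of the
       span. *)
    move=> /nil_rad /rad_comb -> G [G0 GB] SG.
    have GD y z : G y -> G z -> G (y + z).
      by move=> Gy Gz; rewrite -[z]opprK; apply: (GB) => //; rewrite -sub0r; exact: GB.
    have GN y k : G y -> G (y *+ k).
      by move=> Gy; elim: k => [|k IHk]; rewrite ?mulr0n // mulrS; exact: GD.
    elim/big_ind: _ => // p _.
    have Gb : G (b p).
      apply: SG; exists (p.1.+1 * m + p.2)%:R, (p.1 * m + p.2)%:R; split=> //.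
      exact: (radical_basis_mod n_ge2 d_dvd_n).
    case: (basis_coef w p x) => k; first exact: GN.
    by rewrite NegzE mulrNz -sub0r; apply: (GB) => //; exact: GN.
  (* Conversely, [rad] is itself a subgroup containing the generators, hence contains their span. *)
  move=> /(_ rad) radx; apply/rad_nil/radx.
    split; first by split=> *; rewrite raddf0.
    exact: green_radicalB.
  move=> _ [i [j [ij ->]]]; rewrite !MdE.
  exact: (radical_generator charK0 n_ge2 d_dvd_n q_prim w_prim wm_q).
split=> [x|c c0 p].
  split=> [Jx|[c ->]].
    exists (fun p => basis_coef w p x); apply/rad_comb/nil_rad.
    (* The classes of all the indecomposables are a basis of the ring over the integers, so elements
       of the Jacobson radical are nilpotent. *)
    pose B (t : 'I_d * 'Z_n) : r := Mcls d_dvd_n q_prim w_prim t.1.+1 t.2.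
    pose C (t : 'I_d * 'Z_n) : {additive r -> int} := green_coef w t.1 t.2.
    apply: (@jacobson_nilpotent r _ B C) Jx => [s t|u].
      rewrite /C /= (green_coef_Mcls charK0 n_ge2 d_dvd_n q_prim w_prim wm_q) //.
      rewrite eqSS eq_sym -[s == t]/((s.1 == t.1) && (s.2 == t.2)).
      by rewrite -(inj_eq val_inj s.1) natz.
    exact: (green_expand charK0 n_ge2 d_dvd_n w_prim wm_q).
  (* [rad] is an ideal of elements of square zero, so the Jacobson radical contains it. *)
  apply: (sq0_ideal_jacobson (N := rad)) (comb_rad c).
    exact: (green_radicalM charK0 n_ge2 d_ge2 d_dvd_n w_prim wm_q).
  exact: (radical_sq0 charK0 n_ge2 d_ge2 d_dvd_n w_prim wm_q).
have bcE p1 p2 : basis_coef w p1 (b p2) = (p1 == p2).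
  by rewrite bE (basis_coef_basis charK0 n_ge2 d_dvd_n q_prim w_prim wm_q).
have := congr1 (basis_coef w p) (c0 : \sum_p' b p' *~ c p' = 0).
rewrite raddf_sum raddf0 (bigD1 p) //= raddfMz /= bcE eqxx mulrzz mul1r.
rewrite big1 ?addr0 // => p' p'p.
by rewrite raddfMz /= bcE eq_sym (negPf p'p) mul0rz.
Qed.
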